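(* For every $m\in\mathbb{Z}$ and $z\in\mathbb{C}\setminus(-\infty,0]$, $$Y_m(z) = -\frac{2\,\mathrm{i}^m}{\pi}\left\{\frac{1}{\pi}\int_0^\pi e^{-\mathrm{i} z\cos\theta}\Big[\Gamma\big(0,-\mathrm{i} z(1+\cos\theta)\big)-\mathrm{i}\frac{\pi}{2}\Big]\cos(m\theta)\,\mathrm{d}\theta+\sigma_m(z)\right\},$$ where $$\sigma_m(z) = \frac{(-1)^{m}}{\sqrt{\pi}}\,e^{\mathrm{i} z}\sum_{j=1}^{|m|}\frac{\Gamma(\frac12-j)\,\Gamma(j+|m|)}{\Gamma(|m|-j+1)}\,(2\mathrm{i} z)^{-j},$$ the sum being zero when $m=0$.
   Context: $Y_m$ is the Bessel function of the second kind (Neumann function) of integer order, $Y_m=\lim_{\mu\to m}\frac{J_\mu\cos\mu\pi-J_{-\mu}}{\sin\mu\pi}$, with principal branch. $\Gamma(0,w)$ is the upper incomplete gamma function (the exponential integral $E_1(w)$): $\Gamma(0,w)=-\gamma-\ln w-\sum_{k\ge1}\frac{(-w)^k}{k\cdot k!}$, with $\gamma$ the Euler–Mascheroni constant; here, for $w=-\mathrm{i}cz$ with $c>0$, $\ln w$ means $\ln c+\ln z-\mathrm{i}\pi/2$ with $\ln z$ principal. *)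

(* Defs.v *)
From Stdlib Require Import Reals ZArith.
From Coquelicot Require Import Coquelicot.

Open Scope C_scope.

(** Limits of sequences and sums of series in [C], taken componentwise. *)
Definition CLim_seq (u : nat -> C) : C :=
  (real (Lim_seq (fun n => Re (u n))), real (Lim_seq (fun n => Im (u n)))).

Definition CSeries (a : nat -> C) : C :=
  (Series (fun n => Re (a n)), Series (fun n => Im (a n))).

Definition Cexp (z : C) : C :=
  RtoC (exp (Re z)) * (cos (Im z), sin (Im z)).

Definition Ccos (z : C) : C := (Cexp (Ci * z) + Cexp (- (Ci * z))) / 2.
Definition Csin (z : C) : C := (Cexp (Ci * z) - Cexp (- (Ci * z))) / (2 * Ci).

(** Principal argument, in (-PI, PI], for [z <> 0]. *)
Definition Carg (z : C) : R :=
  if Rle_dec 0 (Im z) then acos (Re z / Cmod z) else (- acos (Re z / Cmod z))%R.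

Definition CLn (z : C) : C := (ln (Cmod z), Carg z).

Definition CpowZ (c : C) (m : Z) : C :=
  match m with
  | Z0 => 1
  | Zpos p => c ^ Pos.to_nat p
  | Zneg p => / c ^ Pos.to_nat p
  end.

(** [rising_prod s n] is s (s+1) ... (s+n). *)
Fixpoint rising_prod (s : C) (n : nat) : C :=
  match n with
  | O => s
  | S n' => rising_prod s n' * (s + INR n)
  end.

(** Reciprocal of Euler's Gamma function, by Gauss's limit
    1/Gamma(s) = lim s (s+1) ... (s+n) / (n! n^s); this entire function
    vanishes at the poles of Gamma. *)
Definition RGamma (s : C) : C :=
  CLim_seq (fun n =>
    rising_prod s n / (INR (fact n) * Cexp (s * ln (INR n)))).

Definition Gamma (s : C) : C := / RGamma s.

(** J_mu(z) = sum_k (-1)^k / (k! Gamma(mu+k+1)) (z/2)^(mu+2k), the power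
    being that of the principal logarithm. *)
Definition BesselJ (mu z : C) : C :=
  CSeries (fun k =>
    (- (1)) ^ k / INR (fact k) * RGamma (mu + INR k + 1)
      * Cexp ((mu + 2 * INR k) * CLn (z / 2))).

(** The limit is over complex [mu <> m]. *)
Definition BesselY (m : Z) (z : C) : C :=
  @lim C_R_CompleteNormedModule
    (filtermap
       (fun mu : C =>
          (BesselJ mu z * Ccos (mu * PI) - BesselJ (- mu) z) / Csin (mu * PI))
       (locally' (RtoC (IZR m)))).

Definition EulerMascheroni : R :=
  real (Lim_seq (fun n => (sum_n_m (fun k => / INR k) 1 n - ln (INR n))%R)).

(** Gamma(0, w) at the point of the Riemann surface of the logarithm lying
    over [w] at which the logarithm takes the value [lnw]. *)
Definition Gamma0 (w lnw : C) : C :=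
  - EulerMascheroni - lnw
  - CSeries (fun n => (- w) ^ S n / (INR (S n) * INR (fact (S n)))).

(** Gamma(0, - i c z) for c > 0, with ln(- i c z) = ln c + ln z - i PI / 2;
    if arg z <= - PI / 2 this is not the principal logarithm of - i c z. *)
Definition Gamma0_mi (c : R) (z : C) : C :=
  Gamma0 (- Ci * c * z) (ln c + CLn z - Ci * (PI / 2)).

Definition sigmaY (m : Z) (z : C) : C :=
  let M := Z.abs_nat m in
  CpowZ (- (1)) m / sqrt PI * Cexp (Ci * z)
    * sum_n_m (fun j : nat =>
        Gamma (1 / 2 - INR j) * Gamma (INR j + INR M)
          / Gamma (INR M - INR j + 1) * / (2 * Ci * z) ^ j) 1 M.

Definition Y_integrand (m : Z) (z : C) (theta : R) : C :=
  Cexp (- (Ci * z * cos theta))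
    * (Gamma0_mi (1 + cos theta) z - Ci * (PI / 2))
    * cos (IZR m * theta).

(* Main.v *)
Require Import Defs.
From Stdlib Require Import Reals ZArith Lra Lia Psatz.
From Coquelicot Require Import Coquelicot.

(** Both sides satisfy [y (m - 1) + y (m + 1) = (2 m / z) y m]: the difference quotients
    defining [Y_m] do so even at complex order, because [J] does, and the integrals do by
    integration by parts in [theta], whose remainder [tan (theta / 2) sin (m theta)] is what the
    finite sum [sigma_m] absorbs. So only [m = 0] and [m = 1] remain.

    On the left, expanding [1 / Gamma] and the series of [J] to first order in the order at
    [0] and [1] gives series whose coefficients contain the harmonic numbers [H_k].

    On the right, put [x = - i z] and [u = 1 + cos theta]. Up to the factor [e^(-x)] the integrand
    is [sum_n (x u)^n / n! (kappa - ln (2 u) + H_n)], and the moments of [u^n] and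
    [u^n ln (2 u)] obey two-term recurrences that start from the log-sine integral
    [int_0^PI ln (2 + 2 cos theta) = 0]. Multiplication by [e^x] turns the Bessel recurrence of the
    coefficients of the left-hand series into these same two-term recurrences. *)

Open Scope C_scope.
Set Bullet Behavior "Strict Subproofs".

(** [Y_m] is defined by a 0/0 limit, and near an order [- m] with [m >= 1] the first factors
    [1 / Gamma] in the series of [J] vanish, so the expansion used near nonnegative orders breaks
    down there. At order 1 the recurrence replaces [J_(-1-e)] by [J_(1-e)] and [e J_(-e)];
    expansions are then needed only at the orders 0 and 1, where [1 / Gamma (k + e + 1)] is
    [1 / Gamma (1 + e)] times an explicit product. An expansion is a first-order Taylor formula with
    quadratic remainder ([expands]): products preserve it, and it decides a 0/0 limit.

    The logarithm makes the integrand singular at [theta = PI]. Integrals are therefore limits of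
    primitives ([impR]), and every integration by parts has a boundary term in which a factor [sin]
    must beat the logarithm.

    Power series have real coefficients of exponential type ([exptype]) and a complex argument, so
    that identities between integrals become identities between real sequences, provable by
    recurrence. The branch of the logarithm survives only in [kappa = - gamma - ln (z / 2)], and
    [gamma + ln (z / 2)] is what the order-derivative of [J] produces. *)

(** * Limits and series of complex numbers, by components *)

Lemma C_ext (a b : C) : Re a = Re b -> Im a = Im b -> a = b.
Proof. destruct a, b; simpl; intros -> ->; reflexivity. Qed.

Lemma Re_mult (a b : C) : Re (a * b) = (Re a * Re b - Im a * Im b)%R.
Proof. reflexivity. Qed.

Lemma Im_mult (a b : C) : Im (a * b) = (Re a * Im b + Im a * Re b)%R.
Proof. reflexivity. Qed.

Lemma Re_RtoC_mult (r : R) (a : C) : Re (r * a) = (r * Re a)%R.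
Proof. rewrite Re_mult; simpl; ring. Qed.

Lemma Im_RtoC_mult (r : R) (a : C) : Im (r * a) = (r * Im a)%R.
Proof. rewrite Im_mult; simpl; ring. Qed.

Lemma Cmod_le_Re_Im (a : C) : (Cmod a <= Rabs (Re a) + Rabs (Im a))%R.
Proof.
  destruct a as [x y]; unfold Cmod; simpl fst; simpl snd; simpl Re; simpl Im.
  assert (H1 := Rabs_pos x); assert (H2 := Rabs_pos y).
  rewrite <- (sqrt_Rsqr (Rabs x + Rabs y)) by lra.
  apply sqrt_le_1_alt.
  unfold Rsqr; rewrite <- (pow2_abs x), <- (pow2_abs y); nra.
Qed.

Lemma im_le_Cmod (a : C) : (Rabs (Im a) <= Cmod a)%R.
Proof. generalize (Rmax_Cmod a) (Rmax_r (Rabs (fst a)) (Rabs (snd a))); unfold Im; lra. Qed.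

Definition is_Clim (u : nat -> C) (l : C) : Prop :=
  is_lim_seq (fun n => Re (u n)) (Re l) /\ is_lim_seq (fun n => Im (u n)) (Im l).

Definition is_Cser (a : nat -> C) (l : C) : Prop :=
  is_series (fun n => Re (a n)) (Re l) /\ is_series (fun n => Im (a n)) (Im l).

Definition Cabs (a : nat -> C) : Prop := ex_series (fun n => Cmod (a n)).

Lemma is_Clim_unique u l : is_Clim u l -> CLim_seq u = l.
Proof.
  intros [H1 H2]; apply C_ext; unfold CLim_seq; simpl.
  - now rewrite (is_lim_seq_unique _ _ H1).
  - now rewrite (is_lim_seq_unique _ _ H2).
Qed.

Lemma is_Clim_ext_loc u v l :
  eventually (fun n => u n = v n) -> is_Clim u l -> is_Clim v l.
Proof.
  intros H [H1 H2]; split.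
  - apply is_lim_seq_ext_loc with (2 := H1).
    revert H; apply filter_imp; now intros n ->.
  - apply is_lim_seq_ext_loc with (2 := H2).
    revert H; apply filter_imp; now intros n ->.
Qed.

Lemma is_Clim_mult u v a b :
  is_Clim u a -> is_Clim v b -> is_Clim (fun n => u n * v n) (a * b).
Proof.
  intros [H1 H2] [H3 H4]; split; simpl.
  - apply (is_lim_seq_minus' (fun n => Re (u n) * Re (v n))%R (fun n => Im (u n) * Im (v n))%R);
      now apply (is_lim_seq_mult' (fun n => _ (u n)) (fun n => _ (v n))).
  - apply (is_lim_seq_plus' (fun n => Re (u n) * Im (v n))%R (fun n => Im (u n) * Re (v n))%R);
      now apply (is_lim_seq_mult' (fun n => _ (u n)) (fun n => _ (v n))).
Qed.

Lemma is_Clim_RtoC (u : nat -> R) (l : R) :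
  is_lim_seq u l -> is_Clim (fun n => RtoC (u n)) l.
Proof. intros H; split; simpl; [exact H|apply is_lim_seq_const]. Qed.

Lemma Rser_plus (u v : nat -> R) (a b : R) :
  is_series u a -> is_series v b -> is_series (fun n => (u n + v n)%R) (a + b)%R.
Proof. exact (is_series_plus (V := R_NormedModule) u v a b). Qed.

Lemma Rser_minus (u v : nat -> R) (a b : R) :
  is_series u a -> is_series v b -> is_series (fun n => (u n - v n)%R) (a - b)%R.
Proof. exact (is_series_minus (V := R_NormedModule) u v a b). Qed.

Lemma Rser_scal (c : R) (u : nat -> R) (a : R) :
  is_series u a -> is_series (fun n => (c * u n)%R) (c * a)%R.
Proof. exact (is_series_scal (V := R_NormedModule) c u a). Qed.

Lemma is_Cser_unique a l : is_Cser a l -> CSeries a = l.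
Proof.
  intros [H1 H2]; apply C_ext; unfold CSeries; simpl; now apply is_series_unique.
Qed.

Lemma is_Cser_ext a b l : (forall n, a n = b n) -> is_Cser a l -> is_Cser b l.
Proof.
  intros H [H1 H2]; split.
  - apply is_series_ext with (2 := H1); intros n; now rewrite H.
  - apply is_series_ext with (2 := H2); intros n; now rewrite H.
Qed.

Lemma is_Cser_inj a l l' : is_Cser a l -> is_Cser a l' -> l = l'.
Proof. intros H H'; rewrite <- (is_Cser_unique _ _ H); now apply is_Cser_unique. Qed.

Lemma is_Cser_plus a b la lb :
  is_Cser a la -> is_Cser b lb -> is_Cser (fun n => a n + b n) (la + lb).
Proof.
  intros [H1 H2] [H3 H4]; split; simpl.
  - now apply (is_series_plus (fun n => Re (a n)) (fun n => Re (b n))).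
  - now apply (is_series_plus (fun n => Im (a n)) (fun n => Im (b n))).
Qed.

Lemma is_Cser_scal c a la : is_Cser a la -> is_Cser (fun n => c * a n) (c * la).
Proof.
  intros [H1 H2]; split.
  - exact (is_series_minus _ _ _ _
      (Rser_scal (Re c) _ _ H1) (Rser_scal (Im c) _ _ H2)).
  - exact (is_series_plus _ _ _ _
      (Rser_scal (Re c) _ _ H2) (Rser_scal (Im c) _ _ H1)).
Qed.

Lemma is_Cser_minus a b la lb :
  is_Cser a la -> is_Cser b lb -> is_Cser (fun n => a n - b n) (la - lb).
Proof.
  intros H1 H2.
  replace (la - lb) with (la + (- (1)) * lb) by ring.
  apply is_Cser_ext with (fun n => a n + (- (1)) * b n); [intros n; ring|].
  apply is_Cser_plus; auto; now apply is_Cser_scal.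
Qed.

Lemma is_Cser_incr a l : is_Cser a l -> is_Cser (fun n => a (S n)) (l - a O).
Proof.
  intros [H1 H2]; split.
  - apply (is_series_incr_1 (fun n => Re (a n))).
    replace (plus _ _) with (Re l); [exact H1|]. unfold plus; simpl; unfold Re; simpl; ring.
  - apply (is_series_incr_1 (fun n => Im (a n))).
    replace (plus _ _) with (Im l); [exact H2|]. unfold plus; simpl; unfold Im; simpl; ring.
Qed.

Lemma is_Cser_decr a l : is_Cser (fun n => a (S n)) l -> is_Cser a (l + a O).
Proof.
  intros [H1 H2]; split.
  - apply (is_series_decr_1 (fun n => Re (a n))).
    replace (plus _ _) with (Re l); [exact H1|].
    unfold plus, opp; simpl; unfold Re; simpl; ring.
  - apply (is_series_decr_1 (fun n => Im (a n))).
    replace (plus _ _) with (Im l); [exact H2|].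
    unfold plus, opp; simpl; unfold Im; simpl; ring.
Qed.

Lemma ex_series_dom (a b : nat -> R) :
  (forall n, Rabs (a n) <= b n)%R -> ex_series b -> ex_series a.
Proof. intros H Hb; exact (ex_series_le (V := R_CompleteNormedModule) a b H Hb). Qed.

Lemma Cabs_Re a : Cabs a -> ex_series (fun n => Rabs (Re (a n))).
Proof.
  apply ex_series_dom; intros n; rewrite Rabs_Rabsolu; apply re_le_Cmod.
Qed.

Lemma Cabs_Im a : Cabs a -> ex_series (fun n => Rabs (Im (a n))).
Proof.
  apply ex_series_dom; intros n; rewrite Rabs_Rabsolu; apply im_le_Cmod.
Qed.

Lemma Cabs_ser a : Cabs a -> is_Cser a (CSeries a).
Proof.
  intros H; split; apply Series_correct; apply ex_series_Rabs;
    [now apply Cabs_Re | now apply Cabs_Im].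
Qed.

Lemma Cabs_le a (b : nat -> R) :
  (forall n, Cmod (a n) <= b n)%R -> ex_series b -> Cabs a.
Proof.
  intros H; apply ex_series_dom; intros n.
  rewrite Rabs_pos_eq; [apply H|apply Cmod_ge_0].
Qed.

Lemma Rser_bound (a b : nat -> R) (l B : R) :
  is_series a l -> (forall n, Rabs (a n) <= b n)%R -> is_series b B -> (Rabs l <= B)%R.
Proof.
  intros Ha Hab Hb.
  assert (E : ex_series b) by (now exists B).
  assert (Ea : ex_series (fun n => Rabs (a n))).
  { apply ex_series_dom with (2 := E); intros n; rewrite Rabs_Rabsolu; apply Hab. }
  rewrite <- (is_series_unique _ _ Ha), <- (is_series_unique _ _ Hb).
  eapply Rle_trans; [apply Series_Rabs; exact Ea|].
  apply Series_le; [|exact E]. intros n; split; [apply Rabs_pos|apply Hab].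
Qed.

(** The factor 2 comes from bounding real and imaginary parts separately; it is harmless, since only
    orders of magnitude are used. *)
Lemma is_Cser_bound a l (b : nat -> R) (B : R) :
  is_Cser a l -> (forall n, Cmod (a n) <= b n)%R -> is_series b B ->
  (Cmod l <= 2 * B)%R.
Proof.
  intros [H1 H2] H3 H4.
  assert (Rabs (Re l) <= B)%R.
  { apply (Rser_bound _ _ _ _ H1) with (2 := H4).
    intros n; eapply Rle_trans; [apply re_le_Cmod|apply H3]. }
  assert (Rabs (Im l) <= B)%R.
  { apply (Rser_bound _ _ _ _ H2) with (2 := H4).
    intros n; eapply Rle_trans; [apply im_le_Cmod|apply H3]. }
  generalize (Cmod_le_Re_Im l); lra.
Qed.

Definition conv (a b : nat -> R) (n : nat) : R :=
  sum_f_R0 (fun k => (a k * b (n - k)%nat)%R) n.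

Lemma Cpow_add (x : C) n m : x ^ (n + m) = x ^ n * x ^ m.
Proof. induction n; simpl; [ring|rewrite IHn; ring]. Qed.

Lemma sum_f_R0_pair (f : nat -> R) (u : R) n :
  (sum_f_R0 (fun k => f k) n * u)%R = sum_f_R0 (fun k => (f k * u)%R) n.
Proof. rewrite Rmult_comm. apply scal_sum. Qed.

(** Mertens' theorem is available for real series, and the real and imaginary parts of the Cauchy
    product are combinations of four real Cauchy products, because [x ^ n = x ^ k * x ^ (n - k)]
    while the coefficients are real. *)
Lemma is_Cser_conv (a b : nat -> R) (x A B : C) :
  is_Cser (fun n => a n * x ^ n) A -> Cabs (fun n => a n * x ^ n) ->
  is_Cser (fun n => b n * x ^ n) B -> Cabs (fun n => b n * x ^ n) ->
  is_Cser (fun n => conv a b n * x ^ n) (A * B).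
Proof.
  intros [HA1 HA2] HA [HB1 HB2] HB.
  assert (a1 := Cabs_Re _ HA). assert (a2 := Cabs_Im _ HA).
  assert (b1 := Cabs_Re _ HB). assert (b2 := Cabs_Im _ HB).
  assert (P11 := is_series_mult _ _ _ _ HA1 HB1 a1 b1).
  assert (P12 := is_series_mult _ _ _ _ HA1 HB2 a1 b2).
  assert (P21 := is_series_mult _ _ _ _ HA2 HB1 a2 b1).
  assert (P22 := is_series_mult _ _ _ _ HA2 HB2 a2 b2).
  assert (X : forall n k, (k <= n)%nat -> x ^ n = x ^ k * x ^ (n - k)).
  { intros n k Hk. rewrite <- Cpow_add. f_equal. lia. }
  split.
  - assert (PQ := Rser_minus _ _ _ _ P11 P22). rewrite Re_mult.
    apply is_series_ext with (2 := PQ).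
    intros n. unfold conv. rewrite Re_RtoC_mult, sum_f_R0_pair, <- minus_sum.
    apply sum_eq. intros i Hi.
    rewrite (X n i Hi), !Re_RtoC_mult, ?Im_RtoC_mult, ?Re_mult, ?Im_mult; ring.
  - assert (PQ := Rser_plus _ _ _ _ P12 P21). rewrite Im_mult.
    apply is_series_ext with (2 := PQ).
    intros n. unfold conv. rewrite Im_RtoC_mult, sum_f_R0_pair, <- plus_sum.
    apply sum_eq. intros i Hi.
    rewrite (X n i Hi), !Re_RtoC_mult, ?Im_RtoC_mult, ?Re_mult, ?Im_mult; ring.
Qed.

Lemma is_series_even (a : nat -> R) (l : R) :
  (forall k, a (2 * k + 1)%nat = 0%R) -> is_series a l ->
  is_series (fun k => a (2 * k)%nat) l.
Proof.
  intros H Ha.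
  assert (E : forall n, sum_n (fun k => a (2 * k)%nat) n = sum_n a (2 * n)).
  { induction n; [now rewrite !sum_O|].
    replace (2 * S n)%nat with (S (S (2 * n))) by lia.
    rewrite !sum_Sn, IHn. replace (S (2 * n)) with (2 * n + 1)%nat by lia.
    rewrite H. replace (2 * S n)%nat with (S (2 * n + 1)) by lia.
    unfold plus; simpl; ring. }
  unfold is_series. eapply filterlim_ext; [intros n; symmetry; apply E|].
  eapply filterlim_comp; [|exact Ha].
  intros P [N HN]; exists N; intros n Hn; apply HN; lia.
Qed.

Lemma is_Cser_even (a : nat -> C) (l : C) :
  (forall k, a (2 * k + 1)%nat = 0) -> is_Cser a l ->
  is_Cser (fun k => a (2 * k)%nat) l.
Proof.
  intros H [H1 H2]; split.
  - apply (is_series_even (fun n => Re (a n))); auto. intros k; now rewrite H.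
  - apply (is_series_even (fun n => Im (a n))); auto. intros k; now rewrite H.
Qed.

(** * Power series of exponential type *)

Lemma is_series_exp (r : R) : is_series (fun n => (r ^ n / INR (fact n))%R) (exp r).
Proof.
  apply is_series_ext with (fun n => (scal (r ^ n) (/ INR (fact n)))%R).
  - intros n; reflexivity.
  - rewrite <- (is_pseries_unique _ _ _ (is_exp_Reals r)).
    replace (PSeries _ r) with (exp r); [apply is_exp_Reals|].
    symmetry; apply is_pseries_unique, is_exp_Reals.
Qed.

(** Coefficients of an entire function of exponential type. *)
Definition exptype (a : nat -> R) : Prop :=
  exists A K : R, (0 <= A /\ 0 <= K /\ forall n, Rabs (a n) <= A * K ^ n / INR (fact n))%R.

Lemma exptype_bound (a : nat -> R) : exptype a -> forall r : R,
  (0 <= r)%R -> ex_series (fun n => (Rabs (a n) * r ^ n)%R).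
Proof.
  intros (A & K & HA & HK & H) r Hr.
  apply (ex_series_dom _ (fun n => (A * ((K * r) ^ n / INR (fact n)))%R)).
  - intros n; rewrite Rabs_pos_eq.
    + rewrite Rpow_mult_distr. specialize (H n).
      replace (A * (K ^ n * r ^ n / INR (fact n)))%R with (A * K ^ n / INR (fact n) * r ^ n)%R
        by (field; apply INR_fact_neq_0).
      apply Rmult_le_compat_r; auto. now apply pow_le.
    + apply Rmult_le_pos; [apply Rabs_pos|now apply pow_le].
  - apply (ex_series_scal (V := R_NormedModule) A (fun n => ((K * r) ^ n / INR (fact n))%R)).
    eexists; apply is_series_exp.
Qed.

Lemma exptype_Cabs (a : nat -> R) (x : C) :
  exptype a -> Cabs (fun n => a n * x ^ n).
Proof.
  intros H. apply Cabs_le with (fun n => (Rabs (a n) * Cmod x ^ n)%R).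
  - intros n. rewrite Cmod_mult, Cmod_R, Cmod_pow. lra.
  - apply exptype_bound; auto. apply Cmod_ge_0.
Qed.

Definition CPS (a : nat -> R) (x : C) : C := CSeries (fun n => a n * x ^ n).

Lemma CPS_correct a x : exptype a -> is_Cser (fun n => a n * x ^ n) (CPS a x).
Proof. intros H; apply Cabs_ser, exptype_Cabs, H. Qed.

Lemma CPS_conv a b x c : exptype a -> exptype b -> (forall n, conv a b n = c n) ->
  is_Cser (fun n => c n * x ^ n) (CPS a x * CPS b x).
Proof.
  intros Ha Hb Hc.
  apply is_Cser_ext with (fun n => conv a b n * x ^ n); [intros n; now rewrite Hc|].
  apply is_Cser_conv; auto using CPS_correct, exptype_Cabs.
Qed.

Definition invfact (n : nat) : R := (/ INR (fact n))%R.

Lemma exptype_invfact : exptype invfact.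
Proof.
  exists 1%R, 1%R. repeat split; try lra. intros n. rewrite pow1.
  unfold invfact. rewrite Rabs_pos_eq; [lra|].
  left; apply Rinv_0_lt_compat, INR_fact_lt_0.
Qed.

Ltac Req := match goal with |- ?a = ?b => change (@eq R a b) end.

(** The geometric factor [K ^ n] absorbs powers of [|x|], factors [n] and factors [2 ^ n]; most
    sequences below are handled by one such comparison. *)
Lemma exptype_le (a b : nat -> R) (A K : R) : exptype a -> (0 <= A)%R -> (0 <= K)%R ->
  (forall n, Rabs (b n) <= A * K ^ n * Rabs (a n))%R -> exptype b.
Proof.
  intros (A' & K' & HA' & HK' & Ha) HA HK H.
  exists (A * A')%R, (K * K')%R. repeat split; try now apply Rmult_le_pos.
  intros n. eapply Rle_trans; [apply H|].
  rewrite Rpow_mult_distr.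
  replace (A * A' * (K ^ n * K' ^ n) / INR (fact n))%R
    with (A * K ^ n * (A' * K' ^ n / INR (fact n)))%R by (field; apply INR_fact_neq_0).
  apply Rmult_le_compat_l; [|apply Ha].
  apply Rmult_le_pos; auto. now apply pow_le.
Qed.

Lemma exptype_Re a x : exptype a -> exptype (fun n => (a n * Re (x ^ n))%R).
Proof.
  intros Ha. apply (exptype_le a _ 1 (Cmod x)); auto; try lra; [apply Cmod_ge_0|].
  intros n. rewrite Rabs_mult, <- Cmod_pow.
  generalize (re_le_Cmod (x ^ n)) (Rabs_pos (a n)); nra.
Qed.

Lemma exptype_Im a x : exptype a -> exptype (fun n => (a n * Im (x ^ n))%R).
Proof.
  intros Ha. apply (exptype_le a _ 1 (Cmod x)); auto; try lra; [apply Cmod_ge_0|].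
  intros n. rewrite Rabs_mult, <- Cmod_pow.
  generalize (im_le_Cmod (x ^ n)) (Rabs_pos (a n)); nra.
Qed.

Lemma exptype_PSeries (p : nat -> R) (t : R) :
  exptype p -> is_series (fun n => (p n * t ^ n)%R) (PSeries p t).
Proof.
  intros Hp. apply Series_correct, ex_series_Rabs.
  apply ex_series_ext with (fun n => (Rabs (p n) * Rabs t ^ n)%R).
  - intros n. now rewrite Rabs_mult, RPow_abs.
  - apply exptype_bound; auto. apply Rabs_pos.
Qed.

Lemma exptype_CV (p : nat -> R) : exptype p -> CV_radius p = p_infty.
Proof.
  intros Hp. destruct (Lub_Rbar_correct (CV_disk p)) as [H _].
  fold (CV_radius p) in H.
  assert (K : forall r : R, (0 <= r)%R -> Rbar_le r (CV_radius p)).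
  { intros r Hr. apply H. unfold CV_disk.
    apply ex_series_ext with (fun n => (Rabs (p n) * r ^ n)%R).
    - intros n. rewrite Rabs_mult, <- RPow_abs, (Rabs_pos_eq r); auto.
    - now apply exptype_bound. }
  destruct (CV_radius p) as [c| |]; auto.
  - assert (0 <= c)%R by (apply (K 0%R); lra).
    assert (c + 1 <= c)%R by (apply (K (c + 1)%R); lra). lra.
  - exfalso. apply (K 0%R); lra.
Qed.

Lemma exptype_is_derive (p q : nat -> R) (t : R) :
  exptype p -> (forall n, (INR (S n) * p (S n))%R = q n) ->
  is_derive (PSeries p) t (PSeries q t).
Proof.
  intros Hp Hq. replace (PSeries q t) with (PSeries (PS_derive p) t).
  - apply is_derive_PSeries. now rewrite exptype_CV.
  - apply Series_ext. intros n. unfold PS_derive. now rewrite <- Hq.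
Qed.

(** On the line through 0 and [x] a complex series splits into two real power series in [t]. This
    carries real results on differentiation and integration over to [CPS]. *)
Lemma CPS_Re (a : nat -> R) (x : C) (t : R) :
  Re (CPS a (x * t)) = PSeries (fun n => (a n * Re (x ^ n))%R) t.
Proof.
  change (Series (fun n => Re (a n * (x * t) ^ n)) = PSeries (fun n => (a n * Re (x ^ n))%R) t).
  apply Series_ext; intros n. rewrite Cpow_mult_l, <- RtoC_pow, Re_RtoC_mult.
  rewrite (Cmult_comm _ (RtoC (t ^ n))), Re_RtoC_mult. ring.
Qed.

Lemma CPS_Im (a : nat -> R) (x : C) (t : R) :
  Im (CPS a (x * t)) = PSeries (fun n => (a n * Im (x ^ n))%R) t.
Proof.
  change (Series (fun n => Im (a n * (x * t) ^ n)) = PSeries (fun n => (a n * Im (x ^ n))%R) t).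
  apply Series_ext; intros n. rewrite Cpow_mult_l, <- RtoC_pow, Im_RtoC_mult.
  rewrite (Cmult_comm _ (RtoC (t ^ n))), Im_RtoC_mult. ring.
Qed.

(** * The complex exponential and its series *)

Lemma Cexp_add a b : Cexp (a + b) = Cexp a * Cexp b.
Proof.
  destruct a as [a1 a2], b as [b1 b2]. unfold Cexp; simpl.
  apply C_ext; unfold Re, Im; simpl; rewrite exp_plus, ?cos_plus, ?sin_plus; ring.
Qed.

Lemma Cexp_0 : Cexp 0 = 1.
Proof. apply C_ext; unfold Cexp, Re, Im; simpl; rewrite exp_0, cos_0, sin_0; ring. Qed.

Lemma Cexp_opp_l a : Cexp (- a) * Cexp a = 1.
Proof. rewrite <- Cexp_add, <- Cexp_0. f_equal. ring. Qed.

Lemma Cexp_neq_0 a : Cexp a <> 0.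
Proof.
  intros H. generalize (Cexp_opp_l a). rewrite H, Cmult_0_r.
  intros E. apply (f_equal Re) in E. simpl in E. lra.
Qed.

Lemma Cexp_opp a : Cexp (- a) = / Cexp a.
Proof.
  rewrite <- (Cmult_1_r (/ _)), <- (Cexp_opp_l a). field. apply Cexp_neq_0.
Qed.

Lemma Cexp_RtoC (r : R) : Cexp r = exp r.
Proof. unfold Cexp. simpl. rewrite cos_0, sin_0. apply C_ext; unfold Re, Im; simpl; ring. Qed.

Lemma Cexp_scal_n a n : Cexp (INR n * a) = Cexp a ^ n.
Proof.
  induction n.
  - simpl Cpow. simpl INR. rewrite Cmult_0_l. apply Cexp_0.
  - rewrite S_INR, RtoC_plus. simpl Cpow. rewrite <- IHn, <- Cexp_add. f_equal. ring.
Qed.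

Lemma spiral_ode (a b : R) (f g : R -> R) :
  (forall t, is_derive f t (a * f t - b * g t)%R) ->
  (forall t, is_derive g t (b * f t + a * g t)%R) ->
  f 0%R = 1%R -> g 0%R = 0%R ->
  (f 1 = exp a * cos b /\ g 1 = exp a * sin b)%R.
Proof.
  intros Df Dg f0 g0.
  assert (Ef : forall t, Derive (fun x : R => f x) t = (a * f t - b * g t)%R)
    by (intros t; apply is_derive_unique, Df).
  assert (Eg : forall t, Derive (fun x : R => g x) t = (b * f t + a * g t)%R)
    by (intros t; apply is_derive_unique, Dg).
  (* [u] and [v] are the real and imaginary parts of [exp (- (a + i b) t) * (f + i g)], which the
     system keeps constant. *)
  set (u := fun t => (exp (- (a * t)) * (f t * cos (b * t) + g t * sin (b * t)))%R).
  set (v := fun t => (exp (- (a * t)) * (g t * cos (b * t) - f t * sin (b * t)))%R).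
  assert (U : u 0%R = u 1%R).
  { apply eq_is_derive; [|lra]. intros t _. unfold u.
    auto_derive; [split; [eexists; apply Df|split; [eexists; apply Dg|exact I]]|].
    rewrite Ef, Eg.
    unfold zero; simpl. ring. }
  assert (V : v 0%R = v 1%R).
  { apply eq_is_derive; [|lra]. intros t _. unfold v.
    auto_derive; [split; [eexists; apply Dg|split; [eexists; apply Df|exact I]]|].
    rewrite Ef, Eg.
    unfold zero; simpl. ring. }
  unfold u in U. unfold v in V. rewrite f0, g0, !Rmult_0_r, !Rmult_1_r in U, V.
  rewrite Ropp_0, exp_0, cos_0, sin_0 in U, V.
  assert (X : (exp a * exp (- a) = 1)%R) by (rewrite <- exp_plus, Rplus_opp_r; apply exp_0).
  assert (Y := sin2_cos2 b). unfold Rsqr in Y.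
  assert (U' : (exp (- a) * (f 1 * cos b + g 1 * sin b) = 1)%R) by lra.
  assert (V' : (exp (- a) * (g 1 * cos b - f 1 * sin b) = 0)%R) by lra.
  split.
  - transitivity ((exp a * exp (- a)) * (sin b * sin b + cos b * cos b) * f 1)%R;
      [rewrite X, Y; ring|].
    transitivity (exp a * (cos b * (exp (- a) * (f 1 * cos b + g 1 * sin b))
      - sin b * (exp (- a) * (g 1 * cos b - f 1 * sin b))))%R; [ring|].
    rewrite U', V'. ring.
  - transitivity ((exp a * exp (- a)) * (sin b * sin b + cos b * cos b) * g 1)%R;
      [rewrite X, Y; ring|].
    transitivity (exp a * (sin b * (exp (- a) * (f 1 * cos b + g 1 * sin b))
      + cos b * (exp (- a) * (g 1 * cos b - f 1 * sin b))))%R; [ring|].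
    rewrite U', V'. ring.
Qed.

(* Along a ray the real and imaginary parts of the series solve a linear system
   with constant coefficients, which the explicit exponential solves too. *)
Lemma Cexp_CPS (x : C) : Cexp x = CPS invfact x.
Proof.
  set (a := Re x). set (b := Im x).
  set (p := fun n => (invfact n * Re (x ^ n))%R).
  set (q := fun n => (invfact n * Im (x ^ n))%R).
  set (f := PSeries p). set (g := PSeries q).
  assert (Hp : exptype p) by apply exptype_Re, exptype_invfact.
  assert (Hq : exptype q) by apply exptype_Im, exptype_invfact.
  assert (E : forall n, (INR (S n) * invfact (S n))%R = invfact n).
  { intros n. unfold invfact. rewrite fact_simpl, mult_INR. field.
    split; [apply INR_fact_neq_0|now apply not_0_INR]. }
  assert (Df : forall t, is_derive f t (a * f t - b * g t)%R).
  { intros t.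
    replace (a * f t - b * g t)%R with (PSeries (fun n => a * p n - b * q n)%R t).
    - apply exptype_is_derive; auto. intros n. unfold p, q.
      rewrite <- Rmult_assoc, E. simpl Cpow. rewrite Re_mult. unfold a, b. ring.
    - apply is_series_unique.
      apply is_series_ext with (fun n => (a * (p n * t ^ n) - b * (q n * t ^ n))%R);
        [intros n; Req; ring|].
      apply Rser_minus; apply Rser_scal;
        now apply exptype_PSeries. }
  assert (Dg : forall t, is_derive g t (b * f t + a * g t)%R).
  { intros t.
    replace (b * f t + a * g t)%R with (PSeries (fun n => b * p n + a * q n)%R t).
    - apply exptype_is_derive; auto. intros n. unfold p, q.
      rewrite <- Rmult_assoc, E. simpl Cpow. rewrite Im_mult. unfold a, b. ring.
    - apply is_series_unique.
      apply is_series_ext with (fun n => (b * (p n * t ^ n) + a * (q n * t ^ n))%R);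
        [intros n; Req; ring|].
      apply Rser_plus; apply Rser_scal;
        now apply exptype_PSeries. }
  assert (f0 : f 0%R = 1%R).
  { unfold f. rewrite PSeries_0. unfold p, invfact; simpl. field. }
  assert (g0 : g 0%R = 0%R).
  { unfold g. rewrite PSeries_0. unfold q, invfact; simpl. field. }
  destruct (spiral_ode a b f g Df Dg f0 g0) as [F1 G1].
  replace (CPS invfact x) with (CPS invfact (x * 1%R)) by (f_equal; ring).
  apply C_ext.
  - rewrite CPS_Re. fold p; fold f. rewrite F1.
    unfold Cexp. now rewrite Re_RtoC_mult.
  - rewrite CPS_Im. fold q; fold g. rewrite G1.
    unfold Cexp. now rewrite Im_RtoC_mult.
Qed.

Lemma Cexp_ser x : is_Cser (fun n => invfact n * x ^ n) (Cexp x).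
Proof. rewrite Cexp_CPS. apply CPS_correct, exptype_invfact. Qed.

Lemma Cmod_Cexp_eq a : Cmod (Cexp a) = exp (Re a).
Proof.
  unfold Cexp. rewrite Cmod_mult, Cmod_R, Rabs_pos_eq by (left; apply exp_pos).
  unfold Cmod; simpl. replace (_ + _)%R with 1%R.
  - rewrite sqrt_1; ring.
  - assert (E := sin2_cos2 (Im a)); unfold Rsqr in E; Req; lra.
Qed.

Lemma exp_le_exp (a b : R) : (a <= b -> exp a <= exp b)%R.
Proof. intros [L| ->]; [left; now apply exp_increasing|right; reflexivity]. Qed.

Lemma Cmod_Cexp a : (Cmod (Cexp a) <= exp (Cmod a))%R.
Proof.
  rewrite Cmod_Cexp_eq. assert (H := re_le_Cmod a). assert (H' := Rle_abs (Re a)).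
  apply exp_le_exp; lra.
Qed.

Lemma Cexp_taylor1 a : (Cmod (Cexp a - 1 - a) <= 2 * (Cmod a ^ 2 * exp (Cmod a)))%R.
Proof.
  assert (H := is_Cser_incr _ _ (is_Cser_incr _ _ (Cexp_ser a))). cbv beta in H.
  replace (Cexp a - invfact 0 * a ^ 0 - invfact 1 * a ^ 1) with (Cexp a - 1 - a) in H.
  2: { unfold invfact; simpl fact; simpl INR; rewrite Rinv_1; simpl Cpow; ring. }
  apply (is_Cser_bound _ _ (fun n => Cmod a ^ 2 * (Cmod a ^ n / INR (fact n)))%R _ H).
  - intros n. rewrite !Cmod_mult, Cmod_R, Cmod_pow.
    assert (P : (0 < INR (fact n))%R) by apply INR_fact_lt_0.
    (* After two terms are dropped, [1 / (n + 2)! <= 1 / n!] leaves [|a|^2] times the series of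
       [exp |a|]. *)
    assert (Q : (INR (fact n) <= INR (fact (S (S n))))%R) by (apply le_INR, fact_le; lia).
    unfold invfact.
    rewrite Rabs_pos_eq by (left; apply Rinv_0_lt_compat, INR_fact_lt_0).
    assert (I : (/ INR (fact (S (S n))) <= / INR (fact n))%R) by (apply Rinv_le_contravar; lra).
    assert (M := Cmod_ge_0 a). assert (Mn : (0 <= Cmod a ^ n)%R) by now apply pow_le.
    unfold Rdiv. simpl pow. rewrite Rmult_1_r.
    assert (0 <= Cmod a * Cmod a * Cmod a ^ n)%R by (repeat apply Rmult_le_pos; auto). nra.
  - apply Rser_scal, is_series_exp.
Qed.

(** * The Gamma function *)

#[local] Arguments INR : simpl never.

Fixpoint harm (n : nat) : R :=
  match n with O => 0%R | S p => (harm p + / INR (S p))%R end.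

Lemma harm_S n : harm (S n) = (harm n + / INR (S n))%R.
Proof. reflexivity. Qed.

Lemma harm_sum n : sum_n_m (fun k => / INR k)%R 1 n = harm n.
Proof.
  induction n; [now rewrite sum_n_m_zero by lia|].
  rewrite sum_n_Sm by lia. rewrite IHn. reflexivity.
Qed.

Lemma harm_bound n : (0 <= harm n <= INR n)%R.
Proof.
  induction n; [change (INR 0) with 0%R; simpl; lra|].
  rewrite harm_S, S_INR. assert (0 <= INR n)%R by apply pos_INR.
  assert (0 < / (INR n + 1))%R by (apply Rinv_0_lt_compat; lra).
  assert (/ (INR n + 1) <= 1)%R by (rewrite <- Rinv_1; apply Rinv_le_contravar; lra).
  lra.
Qed.

Lemma ln_le_sub1 (x : R) : (0 < x)%R -> (ln x <= x - 1)%R.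
Proof.
  intros Hx. assert (H := exp_ineq1_le (ln x)). rewrite exp_ln in H by auto. lra.
Qed.

Lemma ln_INR_step n :
  (/ INR (S (S n)) <= ln (INR (S (S n))) - ln (INR (S n)) <= / INR (S n))%R.
Proof.
  rewrite (S_INR (S n)). assert (P : (0 < INR (S n))%R) by (apply lt_0_INR; lia).
  set (a := INR (S n)) in *. split.
  - assert (H := ln_le_sub1 (a / (a + 1))). unfold Rdiv in H.
    rewrite ln_mult, ln_Rinv in H by (try apply Rinv_0_lt_compat; lra).
    assert (E : (a * / (a + 1) = 1 - / (a + 1))%R) by (field; lra).
    rewrite E in H. assert (0 < 1 - / (a + 1))%R; [|lra].
    rewrite <- E. apply Rmult_lt_0_compat; auto. apply Rinv_0_lt_compat; lra.
  - assert (H := ln_le_sub1 ((a + 1) / a)). unfold Rdiv in H.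
    rewrite ln_mult, ln_Rinv in H by (try apply Rinv_0_lt_compat; lra).
    assert (E : ((a + 1) * / a = 1 + / a)%R) by (field; lra).
    rewrite E in H. assert (0 < / a)%R by now apply Rinv_0_lt_compat. lra.
Qed.

Lemma is_lim_Euler : is_lim_seq (fun n => harm n - ln (INR n))%R EulerMascheroni.
Proof.
  assert (E : ex_finite_lim_seq (fun n => harm n - ln (INR n))%R).
  (* The index starts at 1: the junk value of [ln 0] would break monotonicity. *)
  { assert (B : ex_finite_lim_seq (fun n => harm (S n) - ln (INR (S n)))%R).
    { apply ex_finite_lim_seq_decr with 0%R.
      - intros n. rewrite (harm_S (S n)). generalize (ln_INR_step n). lra.
      (* Positivity alone is not inductive. The lower bound [1 / (n + 1)] is, because the next
         increment of the logarithm is at most that. *)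
      - intros n. assert (/ INR (S n) <= harm (S n) - ln (INR (S n)))%R.
        { induction n; [rewrite harm_S; change (INR 1) with 1%R; rewrite ln_1; simpl; lra|].
          rewrite (harm_S (S n)).
          generalize (ln_INR_step n). lra. }
        assert (0 < / INR (S n))%R by (apply Rinv_0_lt_compat, lt_0_INR; lia). lra. }
    destruct B as [l Hl]. exists l. now apply is_lim_seq_incr_1. }
  destruct E as [l Hl]. unfold EulerMascheroni.
  rewrite (Lim_seq_ext _ (fun n => harm n - ln (INR n))%R) by (intros n; now rewrite harm_sum).
  now rewrite (is_lim_seq_unique _ _ Hl).
Qed.

(** Factor of the Weierstrass product [1 / Gamma (s) = s e^(gamma s) prod_(j>=1) (1 + s / j) e^(- s
    / j)]. Unlike [1 + s / j], it is [1 + O(s^2 / j^2)], which gives both convergence and a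
    vanishing derivative at [s = 0]. *)
Definition wfactor (s : C) (j : nat) : C := (1 + s / INR (S j)) * Cexp (- (s / INR (S j))).

Fixpoint wprod (s : C) (n : nat) : C :=
  match n with O => 1 | S p => wprod s p * wfactor s p end.

Lemma RtoC_INR_neq_0 n : n <> O -> RtoC (INR n) <> 0.
Proof. intros H E. apply (not_0_INR n H). now apply RtoC_inj. Qed.

Lemma RtoC_fact_neq_0 n : RtoC (INR (fact n)) <> 0.
Proof. apply RtoC_INR_neq_0, fact_neq_0. Qed.

Ltac cneq := repeat split;
  try first [apply not_0_INR; lia | apply Cexp_neq_0 | apply RtoC_fact_neq_0 | apply RtoC_INR_neq_0; lia | assumption].

(** The exponentials inserted into the product multiply to [e^(- s H_n)]; compensating them against
    [n^(-s)] leaves [e^(s (H_n - ln n))], the source of [gamma]. *)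
Lemma gauss_wprod s n :
  rising_prod s n / (INR (fact n) * Cexp (s * ln (INR n)))
  = s * wprod s n * Cexp (s * (harm n - ln (INR n))%R).
Proof.
  assert (E : rising_prod s n = s * INR (fact n) * (wprod s n * Cexp (s * harm n))).
  { induction n.
    - simpl. rewrite Cmult_0_r, Cexp_0. change (INR 1) with 1%R. ring.
    - simpl rising_prod. rewrite IHn. rewrite harm_S.
      simpl wprod. unfold wfactor. rewrite fact_simpl, mult_INR, RtoC_mult, RtoC_plus.
      rewrite (Cmult_plus_distr_l s (harm n)), Cexp_add, Cexp_opp.
      rewrite RtoC_inv by (apply not_0_INR; lia). fold (s / INR (S n)).
      field. cneq. }
  rewrite E, RtoC_minus.
  replace (s * (harm n - ln (INR n))) with (s * harm n + - (s * ln (INR n))) by ring.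
  rewrite Cexp_add, Cexp_opp.
  field. cneq.
Qed.

Lemma wfactor_bound s j (r : R) : (Cmod s <= r)%R ->
  (Cmod (wfactor s j - 1) <= Cmod s ^ 2 * (1 + 2 * (1 + r) * exp r) / INR (S j) ^ 2)%R.
Proof.
  intros Hr. assert (P : (1 <= INR (S j))%R) by (rewrite S_INR; generalize (pos_INR j); lra).
  set (k := INR (S j)) in *. set (w := s / k).
  assert (Ew : (Cmod w = Cmod s / k)%R).
  { unfold w. rewrite Cmod_div, Cmod_R, Rabs_pos_eq; try lra.
    intros E; apply RtoC_inj in E; lra. }
  assert (P1 : (0 < / k <= 1)%R).
  { split; [apply Rinv_0_lt_compat; lra|]. rewrite <- Rinv_1. apply Rinv_le_contravar; lra. }
  assert (Ms := Cmod_ge_0 s).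
  assert (Hw : (Cmod w <= r)%R).
  { rewrite Ew. unfold Rdiv. nra. }
  set (q := Cexp (- w) - 1 - (- w)).
  (* With [w = s / k] the linear terms cancel: [(1 + w) (1 - w) - 1 = - w^2], and the rest is the
     second-order remainder of [e^(-w)]. *)
  replace (wfactor s j - 1) with (- (w * w) + (1 + w) * q).
  2: { unfold q, wfactor. fold k w. ring. }
  assert (Hq : (Cmod q <= 2 * (Cmod w ^ 2 * exp r))%R).
  { eapply Rle_trans; [apply Cexp_taylor1|]. rewrite Cmod_opp.
    assert (E := exp_le_exp _ _ Hw).
    assert (0 <= Cmod w ^ 2)%R by apply pow2_ge_0. nra. }
  eapply Rle_trans; [apply Cmod_triangle|]. rewrite Cmod_opp, !Cmod_mult.
  assert (H1 : (Cmod (1 + w) <= 1 + r)%R).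
  { eapply Rle_trans; [apply Cmod_triangle|]. rewrite Cmod_1. lra. }
  replace (Cmod s ^ 2 * (1 + 2 * (1 + r) * exp r) / k ^ 2)%R
    with (Cmod w ^ 2 + (1 + r) * (2 * (Cmod w ^ 2 * exp r)))%R.
  2: { rewrite Ew. field. lra. }
  assert (H2 := Cmod_ge_0 (1 + w)). assert (H3 := Cmod_ge_0 q).
  assert (Cmod (1 + w) * Cmod q <= (1 + r) * (2 * (Cmod w ^ 2 * exp r)))%R
    by (apply Rmult_le_compat; auto).
  simpl. lra.
Qed.

Lemma inv_sq_telescope n :
  (/ INR (S n) ^ 2 <= 2 / INR (S n) - 2 / INR (S (S n)))%R.
Proof.
  rewrite (S_INR (S n)). assert (P : (1 <= INR (S n))%R) by (rewrite S_INR; generalize (pos_INR n); lra).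
  set (k := INR (S n)) in *.
  replace (2 / k - 2 / (k + 1))%R with (/ (k * (k + 1) / 2))%R by (field; lra).
  apply Rinv_le_contravar; simpl; nra.
Qed.

Lemma is_lim_inv_INR : is_lim_seq (fun n => / INR n)%R 0%R.
Proof. apply (is_lim_seq_inv INR p_infty); [apply is_lim_seq_INR|easy]. Qed.

Lemma is_lim_two_inv : is_lim_seq (fun n => 2 / INR (S n))%R 0%R.
Proof.
  apply (is_lim_seq_incr_1 (fun n => 2 / INR n)%R).
  replace (Finite 0) with (Rbar_mult 2 0%R) by (simpl; f_equal; ring).
  apply is_lim_seq_scal_l, is_lim_inv_INR.
Qed.

(** With [b n = 2 / (n + 1)] the hypothesis makes [u + M b] decreasing and [u - M b] increasing, so
    monotone convergence applies; the total variation is at most [M * b 0 = 2 M]. *)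
Lemma telescope_lim (u : nat -> R) (M : R) :
  (forall n, Rabs (u (S n) - u n) <= M * (2 / INR (S n) - 2 / INR (S (S n))))%R ->
  exists l : R, is_lim_seq u l /\ (Rabs (l - u O) <= 2 * M)%R.
Proof.
  intros H. set (b := fun n => (2 / INR (S n))%R).
  assert (H1 : forall n, (u (S n) + M * b (S n) <= u n + M * b n)%R).
  { intros n. generalize (H n). unfold b. intros K. apply Rabs_le_between in K. lra. }
  assert (H2 : forall n, (u n - M * b n <= u (S n) - M * b (S n))%R).
  { intros n. generalize (H n). unfold b. intros K. apply Rabs_le_between in K. lra. }
  assert (M0 : (0 <= M)%R).
  { generalize (H O) (Rabs_pos (u 1%nat - u 0%nat)).
    replace (2 / INR 1 - 2 / INR 2)%R with 1%R
      by (rewrite (S_INR 1); change (INR 1) with 1%R; field). lra. }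
  assert (B : forall n, (0 <= b n)%R).
  { intros n. unfold b. apply Rlt_le, Rdiv_lt_0_compat; [lra|apply lt_0_INR; lia]. }
  assert (b0 : b O = 2%R) by (unfold b; change (INR 1) with 1%R; field).
  assert (H3 : forall n, (u O - M * b O <= u n - M * b n)%R).
  { induction n; [lra|generalize (H2 n); lra]. }
  assert (H4 : forall n, (u n + M * b n <= u O + M * b O)%R).
  { induction n; [lra|generalize (H1 n); lra]. }
  assert (E : ex_finite_lim_seq (fun n => u n + M * b n)%R).
  { apply ex_finite_lim_seq_decr with (u O - M * b O)%R; auto.
    intros n. generalize (H3 n). assert (0 <= M * b n)%R by (apply Rmult_le_pos; auto). lra. }
  destruct E as [l Hl]. exists l.
  assert (L : is_lim_seq u l).
  { replace (Finite l) with (Finite (l - M * 0)%R) by (f_equal; ring).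
    apply is_lim_seq_ext with (fun n => (u n + M * b n) - M * b n)%R; [intros n; ring|].
    apply is_lim_seq_minus'; auto.
    apply (is_lim_seq_scal_l _ M 0%R). apply is_lim_two_inv. }
  split; auto. apply Rabs_le_between'.
  assert (L1 := is_lim_seq_le _ _ _ _ H4 Hl (is_lim_seq_const _)). simpl in L1.
  assert (H5 : forall n, (u O - M * b O <= u n)%R).
  { intros n. generalize (H3 n). assert (0 <= M * b n)%R by (apply Rmult_le_pos; auto). lra. }
  assert (L2 := is_lim_seq_le _ _ _ _ H5 (is_lim_seq_const _) L). simpl in L2.
  rewrite b0 in *. lra.
Qed.

Definition wbound (r : R) : R := (1 + 2 * (1 + r) * exp r)%R.

Lemma wprod_lim s (r : R) : (Cmod s <= r)%R ->
  exists l, is_Clim (wprod s) l /\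
    (Cmod (l - 1) <= 4 * (exp (2 * (Cmod s ^ 2 * wbound r)) * (Cmod s ^ 2 * wbound r)))%R.
Proof.
  intros Hr. set (V := (Cmod s ^ 2 * wbound r)%R).
  assert (r0 : (0 <= r)%R) by (generalize (Cmod_ge_0 s); lra).
  assert (V0 : (0 <= V)%R).
  { apply Rmult_le_pos; [apply pow2_ge_0|]. unfold wbound. generalize (exp_pos r); nra. }
  set (b := fun n => (2 / INR (S n))%R).
  assert (Hb : forall n, (/ INR (S n) ^ 2 <= b n - b (S n))%R) by (intros n; apply inv_sq_telescope).
  assert (Hf : forall n, (Cmod (wfactor s n - 1) <= V * (b n - b (S n)))%R).
  { intros n. eapply Rle_trans; [apply (wfactor_bound s n r Hr)|].
    fold (wbound r). fold V. unfold Rdiv. apply Rmult_le_compat_l; auto. }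
  assert (B : forall n, (0 <= b n)%R).
  { intros n. unfold b. apply Rlt_le, Rdiv_lt_0_compat; [lra|apply lt_0_INR; lia]. }
  (* From [1 + y <= exp y], with the exponents telescoping; this makes the increments of the product
     summable. *)
  assert (HP : forall n, (Cmod (wprod s n) <= exp (V * (2 - b n)))%R).
  { induction n.
    - simpl. rewrite Cmod_1. unfold b. change (INR 1) with 1%R. replace (V * (2 - 2 / 1))%R with 0%R by field.
      rewrite exp_0; lra.
    - simpl. rewrite Cmod_mult.
      replace (V * (2 - b (S n)))%R with (V * (2 - b n) + V * (b n - b (S n)))%R by ring.
      rewrite exp_plus. apply Rmult_le_compat; auto using Cmod_ge_0.
      replace (wfactor s n) with (1 + (wfactor s n - 1)) by ring.
      eapply Rle_trans; [apply Cmod_triangle|]. rewrite Cmod_1.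
      eapply Rle_trans; [|apply exp_ineq1_le]. generalize (Hf n). lra. }
  assert (HD : forall n, (Cmod (wprod s (S n) - wprod s n) <= exp (2 * V) * V * (b n - b (S n)))%R).
  { intros n. simpl. replace (wprod s n * wfactor s n - wprod s n)
      with (wprod s n * (wfactor s n - 1)) by ring.
    rewrite Cmod_mult, Rmult_assoc. apply Rmult_le_compat; auto using Cmod_ge_0.
    eapply Rle_trans; [apply HP|].
    apply exp_le_exp. generalize (B n); nra. }
  destruct (telescope_lim (fun n => Re (wprod s n)) (exp (2 * V) * V)) as (l1 & L1 & B1).
  { intros n. eapply Rle_trans; [|apply HD].
    eapply Rle_trans; [|apply re_le_Cmod]. right; reflexivity. }
  destruct (telescope_lim (fun n => Im (wprod s n)) (exp (2 * V) * V)) as (l2 & L2 & B2).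
  { intros n. eapply Rle_trans; [|apply HD].
    eapply Rle_trans; [|apply im_le_Cmod]. right; reflexivity. }
  exists (l1, l2). split; [now split|].
  eapply Rle_trans; [apply Cmod_le_Re_Im|].
  change (Re ((l1, l2) - 1)) with (l1 - Re (wprod s 0))%R.
  change (Im ((l1, l2) - 1)) with (l2 - Im (wprod s 0))%R. lra.
Qed.

Definition wlim (s : C) : C := CLim_seq (wprod s).

Lemma wlim_correct s : is_Clim (wprod s) (wlim s).
Proof.
  destruct (wprod_lim s (Cmod s) (Rle_refl _)) as (l & H & _).
  unfold wlim. now rewrite (is_Clim_unique _ _ H).
Qed.

Lemma wlim_near_one s (r : R) : (Cmod s <= r)%R ->
  (Cmod (wlim s - 1) <= 4 * (exp (2 * (Cmod s ^ 2 * wbound r)) * (Cmod s ^ 2 * wbound r)))%R.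
Proof.
  intros Hr. destruct (wprod_lim s r Hr) as (l & H & B).
  unfold wlim. now rewrite (is_Clim_unique _ _ H).
Qed.

Lemma exp_continuous_seq (u : nat -> R) (l : R) :
  is_lim_seq u l -> is_lim_seq (fun n => exp (u n)) (exp l).
Proof.
  intros H. apply (is_lim_seq_continuous exp); auto.
  apply derivable_continuous_pt, derivable_pt_exp.
Qed.

Lemma is_Clim_Cexp_scal s (u : nat -> R) (l : R) :
  is_lim_seq u l -> is_Clim (fun n => Cexp (s * u n)) (Cexp (s * l)).
Proof.
  intros H.
  assert (E1 : is_lim_seq (fun n => exp (Re s * u n))%R (exp (Re s * l))).
  { apply exp_continuous_seq. now apply (is_lim_seq_scal_l _ _ l). }
  assert (E2 : is_lim_seq (fun n => Im s * u n)%R (Im s * l)%R) by now apply (is_lim_seq_scal_l _ _ l).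
  assert (X : forall t : R, Cexp (s * t) = exp (Re s * t) * (cos (Im s * t), sin (Im s * t))).
  { intros t. unfold Cexp. rewrite (Cmult_comm s), Re_RtoC_mult, Im_RtoC_mult.
    now rewrite !(Rmult_comm t). }
  rewrite X. apply is_Clim_ext_loc with
    (fun n => exp (Re s * u n) * (cos (Im s * u n), sin (Im s * u n))).
  { exists O. intros n _. now rewrite X. }
  apply is_Clim_mult.
  - now apply is_Clim_RtoC.
  - split; simpl.
    + apply (is_lim_seq_continuous cos); auto. apply continuity_cos.
    + apply (is_lim_seq_continuous sin); auto. apply continuity_sin.
Qed.

Lemma is_Clim_const c : is_Clim (fun _ => c) c.
Proof. split; apply is_lim_seq_const. Qed.

Definition gauss (s : C) (n : nat) : C :=
  rising_prod s n / (INR (fact n) * Cexp (s * ln (INR n))).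

Lemma gauss_lim s : is_Clim (gauss s) (s * wlim s * Cexp (s * EulerMascheroni)).
Proof.
  apply is_Clim_ext_loc with (fun n => s * wprod s n * Cexp (s * (harm n - ln (INR n))%R)).
  { exists O. intros n _. symmetry; apply gauss_wprod. }
  apply is_Clim_mult; [apply is_Clim_mult; [apply is_Clim_const|apply wlim_correct]|].
  apply is_Clim_Cexp_scal, is_lim_Euler.
Qed.

Lemma RGamma_eq s : RGamma s = s * wlim s * Cexp (s * EulerMascheroni).
Proof. apply is_Clim_unique, gauss_lim. Qed.

Lemma RGamma_correct s : is_Clim (gauss s) (RGamma s).
Proof. rewrite RGamma_eq. apply gauss_lim. Qed.

Lemma rising_prod_shift s n : s * rising_prod (s + 1) n = rising_prod s n * (s + INR (S n)).
Proof.
  induction n.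
  - simpl rising_prod. change (INR 1) with 1%R. ring.
  - simpl rising_prod. rewrite Cmult_assoc, IHn. simpl rising_prod.
    rewrite (S_INR (S n)), RtoC_plus. ring.
Qed.

Lemma RGamma_rec s : RGamma s = s * RGamma (s + 1).
Proof.
  assert (H : is_Clim (fun n => s * gauss (s + 1) n) (s * RGamma (s + 1)))
    by (apply is_Clim_mult; [apply is_Clim_const|apply RGamma_correct]).
  (* For [n >= 1], [s * gauss (s + 1) n] is [gauss s n * (s + 1 + n) / n], and the last quotient
     tends to 1. *)
  assert (K : is_Clim (fun n => gauss s n * ((s + 1) * RtoC (/ INR n) + 1)) (RGamma s * ((s + 1) * 0 + 1))).
  { apply is_Clim_mult; [apply RGamma_correct|].
    assert (Z : is_Clim (fun n => (s + 1) * RtoC (/ INR n)) ((s + 1) * 0)).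
    { apply is_Clim_mult; [apply is_Clim_const|]. apply is_Clim_RtoC.
      apply is_lim_inv_INR. }
    destruct Z as [Z1 Z2]. split.
    - apply (is_lim_seq_plus' _ (fun _ => 1%R) _ 1%R Z1). apply is_lim_seq_const.
    - apply (is_lim_seq_plus' _ (fun _ => 0%R) _ 0%R Z2). apply is_lim_seq_const. }
  replace (RGamma s) with (RGamma s * ((s + 1) * 0 + 1)) by ring.
  apply is_Clim_unique in K. rewrite <- K. apply is_Clim_unique.
  apply is_Clim_ext_loc with (2 := H). exists 1%nat. intros n Hn. unfold gauss.
  unfold Cdiv. rewrite Cmult_assoc, rising_prod_shift.
  rewrite Cmult_plus_distr_r, Cmult_1_l, Cexp_add, Cexp_RtoC, exp_ln
    by (apply lt_0_INR; lia).
  rewrite S_INR, RtoC_plus, RtoC_inv by (apply not_0_INR; lia).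
  field. cneq.
Qed.

Lemma wprod_0 n : wprod 0 n = 1.
Proof.
  induction n; simpl; [reflexivity|]. rewrite IHn. unfold wfactor.
  replace (0 / INR (S n)) with (RtoC 0) by (field; cneq).
  replace (- RtoC 0) with (RtoC 0) by ring. rewrite Cexp_0. ring.
Qed.

Lemma RGamma_1 : RGamma 1 = 1.
Proof.
  apply is_Clim_unique.
  apply is_Clim_ext_loc with (fun n => RtoC (1 + / INR n)%R).
  - exists 1%nat. intros n Hn.
    assert (E : forall n, rising_prod 1 n = INR (fact (S n))).
    { clear. induction n; [simpl; reflexivity|].
      simpl rising_prod. rewrite IHn, (fact_simpl (S n)), mult_INR, RtoC_mult.
      rewrite (S_INR (S n)), RtoC_plus. ring. }
    rewrite E, fact_simpl, mult_INR, Cmult_1_l, Cexp_RtoC, exp_ln by (apply lt_0_INR; lia).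
    rewrite S_INR. rewrite RtoC_plus, RtoC_inv, !RtoC_mult, RtoC_plus
      by (apply not_0_INR; lia). field. cneq.
  - replace (RtoC 1) with (RtoC (1 + 0)%R) by (f_equal; ring).
    apply is_Clim_RtoC, is_lim_seq_plus'; [apply is_lim_seq_const|apply is_lim_inv_INR].
Qed.

Lemma RGamma_nat n : RGamma (INR n + 1) = invfact n.
Proof.
  unfold invfact. induction n.
  - change (INR 0) with 0%R. rewrite Cplus_0_l, RGamma_1. simpl.
    change (INR 1) with 1%R. now rewrite Rinv_1.
  - assert (H := RGamma_rec (INR n + 1)). rewrite IHn in H.
    rewrite (S_INR n), RtoC_plus. rewrite fact_simpl, mult_INR, S_INR.
    assert (Z : (INR n + 1 <> 0)%R) by (rewrite <- S_INR; apply not_0_INR; lia).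
    assert (Zc : INR n + 1 <> 0) by (rewrite <- RtoC_plus; intros E; apply RtoC_inj in E; auto).
    rewrite Rinv_mult, RtoC_mult, H, RtoC_inv, RtoC_plus by auto.
    field. auto.
Qed.

(** Dividing the product formula by [e] through the functional equation removes the zero at 0 and
    leaves a form whose first-order behaviour is visible. The point [e = 0] is treated apart. *)
Lemma RGamma_one_add e : RGamma (1 + e) = wlim e * Cexp (e * EulerMascheroni).
Proof.
  destruct (Ceq_dec e 0) as [->|H].
  - rewrite Cplus_0_r, RGamma_1, Cmult_0_l, Cexp_0, Cmult_1_r. symmetry.
    apply is_Clim_unique. apply is_Clim_ext_loc with (fun _ => 1); [|apply is_Clim_const].
    exists O. intros n _. now rewrite wprod_0.
  - assert (E := RGamma_rec e). rewrite RGamma_eq in E.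
    rewrite (Cplus_comm e) in E.
    apply (f_equal (fun c => / e * c)) in E.
    replace (/ e * (e * RGamma (1 + e))) with (RGamma (1 + e)) in E by (field; auto).
    rewrite <- E. field. auto.
Qed.

(** * First-order expansions at 0 *)

(** The quadratic remainder, rather than mere differentiability, keeps all estimates explicit. The
    bound [delta <= 1] lets higher powers of [|e|] be absorbed in products. *)
Definition expands (f : C -> C) (a d : C) : Prop :=
  exists (M delta : R), (0 <= M)%R /\ (0 < delta <= 1)%R /\
    forall e, (Cmod e < delta)%R -> (Cmod (f e - a - d * e) <= M * Cmod e ^ 2)%R.

Lemma expands_const a : expands (fun _ => a) a 0.
Proof.
  exists 0%R, 1%R. repeat split; try lra. intros e _.
  replace (a - a - 0 * e) with (RtoC 0) by ring. rewrite Cmod_0. lra.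
Qed.

Lemma expands_ext f g a d :
  (forall e, (Cmod e <= 1 / 2)%R -> f e = g e) ->
  expands f a d -> expands g a d.
Proof.
  intros H (M & delta & H1 & H2 & H3). exists M, (Rmin delta (1 / 2)). split; [auto|].
  split; [split; [apply Rmin_glb_lt; lra|generalize (Rmin_l delta (1 / 2)); lra]|].
  intros e He. generalize (Rmin_l delta (1 / 2)) (Rmin_r delta (1 / 2)). intros.
  rewrite <- H by lra. apply H3. lra.
Qed.

Lemma expands_eq f a d a' d' : expands f a d -> a = a' -> d = d' -> expands f a' d'.
Proof. now intros H <- <-. Qed.

Lemma expands_plus f g a b d d' :
  expands f a d -> expands g b d' -> expands (fun e => f e + g e) (a + b) (d + d').
Proof.
  intros (M & delta & H1 & H2 & H3) (M' & delta' & H1' & H2' & H3').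
  exists (M + M')%R, (Rmin delta delta'). split; [lra|]. split.
  { split; [apply Rmin_glb_lt; lra|]. generalize (Rmin_l delta delta'). lra. }
  intros e He. assert (K := H3 e). assert (K' := H3' e).
  generalize (Rmin_l delta delta') (Rmin_r delta delta'). intros.
  replace (f e + g e - (a + b) - (d + d') * e)
    with ((f e - a - d * e) + (g e - b - d' * e)) by ring.
  eapply Rle_trans; [apply Cmod_triangle|].
  assert (Cmod (f e - a - d * e) <= M * Cmod e ^ 2)%R by (apply K; lra).
  assert (Cmod (g e - b - d' * e) <= M' * Cmod e ^ 2)%R by (apply K'; lra). lra.
Qed.

Lemma expands_mult f g a b d d' :
  expands f a d -> expands g b d' ->
  expands (fun e => f e * g e) (a * b) (d * b + a * d').
Proof.
  intros (M & delta & H1 & H2 & H3) (M' & delta' & H1' & H2' & H3').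
  exists (M * (Cmod b + Cmod d' + M') + (Cmod a + Cmod d) * M' + Cmod d * Cmod d')%R, (Rmin delta delta').
  assert (A0 := Cmod_ge_0 a). assert (B0 := Cmod_ge_0 b).
  assert (D0 := Cmod_ge_0 d). assert (D0' := Cmod_ge_0 d').
  split; [nra|]. split.
  { split; [apply Rmin_glb_lt; lra|]. generalize (Rmin_l delta delta'). lra. }
  intros e He. assert (K := H3 e). assert (K' := H3' e).
  generalize (Rmin_l delta delta') (Rmin_r delta delta'). intros.
  assert (e0 := Cmod_ge_0 e).
  assert (P : (Cmod (f e - a - d * e) <= M * Cmod e ^ 2)%R) by (apply K; lra).
  assert (P' : (Cmod (g e - b - d' * e) <= M' * Cmod e ^ 2)%R) by (apply K'; lra).
  set (r := f e - a - d * e) in *. set (r' := g e - b - d' * e) in *.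
  assert (Q' : (Cmod (g e) <= Cmod b + Cmod d' + M')%R).
  { replace (g e) with (b + d' * e + r') by (unfold r'; ring).
    eapply Rle_trans; [apply Cmod_triangle|].
    assert (Cmod (b + d' * e) <= Cmod b + Cmod d' * Cmod e)%R.
    { rewrite <- Cmod_mult. apply Cmod_triangle. }
    assert (Cmod e ^ 2 <= 1)%R by (simpl; nra). assert (0 <= Cmod e ^ 2)%R by apply pow2_ge_0.
    nra. }
  (* The remainder of the product is [r g + (a + d e) r' + d d' e^2], each part being [O(e^2)]. *)
  replace (f e * g e - a * b - (d * b + a * d') * e)
    with (r * g e + ((a + d * e) * r' + d * d' * (e * e))) by (unfold r, r'; ring).
  eapply Rle_trans; [apply Cmod_triangle|].
  eapply Rle_trans; [apply Rplus_le_compat_l, Cmod_triangle|].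
  rewrite !Cmod_mult.
  assert (X1 : (Cmod r * Cmod (g e) <= M * Cmod e ^ 2 * (Cmod b + Cmod d' + M'))%R)
    by (apply Rmult_le_compat; auto using Cmod_ge_0).
  assert (X2 : (Cmod (a + d * e) * Cmod r' <= (Cmod a + Cmod d) * (M' * Cmod e ^ 2))%R).
  { apply Rmult_le_compat; auto using Cmod_ge_0.
    eapply Rle_trans; [apply Cmod_triangle|]. rewrite Cmod_mult. nra. }
  simpl in *. lra.
Qed.

Lemma expands_opp_var f a d : expands f a d -> expands (fun e => f (- e)) a (- d).
Proof.
  intros (M & delta & H1 & H2 & H3). exists M, delta. repeat split; try tauto.
  intros e He. rewrite <- (Cmod_opp e) in *. generalize (H3 (- e) He).
  replace (f (- e) - a - d * - e) with (f (- e) - a - - d * e) by ring. auto.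
Qed.

Lemma expands_exp c : expands (fun e => Cexp (c * e)) 1 c.
Proof.
  exists (2 * (Cmod c ^ 2 * exp (Cmod c)))%R, 1%R.
  assert (0 <= Cmod c ^ 2)%R by apply pow2_ge_0. assert (E := exp_pos (Cmod c)).
  split; [nra|]. split; [lra|]. intros e He.
  eapply Rle_trans; [apply Cexp_taylor1|]. rewrite Cmod_mult, Rpow_mult_distr.
  assert (0 <= Cmod e ^ 2)%R by apply pow2_ge_0.
  assert (c0 := Cmod_ge_0 c). assert (e0 := Cmod_ge_0 e).
  assert (L : (Cmod c * Cmod e <= Cmod c)%R) by nra.
  apply exp_le_exp in L.
  assert (0 <= Cmod c ^ 2 * Cmod e ^ 2)%R by now apply Rmult_le_pos.
  assert (Cmod c ^ 2 * Cmod e ^ 2 * exp (Cmod c * Cmod e) <= Cmod c ^ 2 * Cmod e ^ 2 * exp (Cmod c))%R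
    by now apply Rmult_le_compat_l.
  lra.
Qed.

Lemma expands_scal c f a d : expands f a d -> expands (fun e => c * f e) (c * a) (c * d).
Proof.
  intros H. eapply expands_eq;
    [apply (expands_mult (fun _ => c)); [apply expands_const|exact H]|ring|ring].
Qed.

Lemma expands_wlim : expands wlim 1 0.
Proof.
  exists (4 * (exp (2 * wbound 1) * wbound 1))%R, 1%R.
  assert (W : (0 <= wbound 1)%R) by (unfold wbound; generalize (exp_pos 1); nra).
  assert (E := exp_pos (2 * wbound 1)).
  split; [nra|]. split; [lra|]. intros e He.
  replace (wlim e - 1 - 0 * e) with (wlim e - 1) by ring.
  eapply Rle_trans; [apply (wlim_near_one e 1); lra|].
  assert (0 <= Cmod e ^ 2)%R by apply pow2_ge_0. assert (e0 := Cmod_ge_0 e).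
  assert (Cmod e ^ 2 <= 1)%R by (simpl; nra).
  assert (L : (2 * (Cmod e ^ 2 * wbound 1) <= 2 * wbound 1)%R) by nra.
  apply exp_le_exp in L.
  assert (0 <= Cmod e ^ 2 * wbound 1)%R by now apply Rmult_le_pos.
  assert (exp (2 * (Cmod e ^ 2 * wbound 1)) * (Cmod e ^ 2 * wbound 1)
    <= exp (2 * wbound 1) * (Cmod e ^ 2 * wbound 1))%R by now apply Rmult_le_compat_r.
  lra.
Qed.

Lemma expands_RGamma : expands (fun e => RGamma (1 + e)) 1 EulerMascheroni.
Proof.
  apply expands_ext with (fun e => wlim e * Cexp (EulerMascheroni * e)).
  { intros e _. now rewrite RGamma_one_add, (Cmult_comm e). }
  eapply expands_eq; [apply expands_mult; [apply expands_wlim|apply expands_exp]|ring|ring].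
Qed.

(** * Wallis integrals and Gamma at 1 / 2 *)

(** These numbers are [binomial (2 n, n) / 4^n]. They appear both in the integrals of powers of
    [sin] and in the Gauss product at [1 / 2], which is how [sqrt PI] enters the values
    [Gamma (1 / 2 - j)] of the finite sum. *)
Fixpoint wallis (n : nat) : R :=
  match n with O => 1%R | S p => (wallis p * ((2 * INR p + 1) / (2 * INR p + 2)))%R end.

Ltac Rcont := match goal with |- continuous ?f ?x =>
  apply (ex_derive_continuous (K := R_AbsRing) (V := R_NormedModule) f x); auto_derive; auto end.

Lemma is_RInt_inj (f : R -> R) (a b l l' : R) : is_RInt f a b l -> is_RInt f a b l' -> l = l'.
Proof.
  intros H H'. rewrite <- (is_RInt_unique (V := R_CompleteNormedModule) _ _ _ _ H).
  exact (is_RInt_unique (V := R_CompleteNormedModule) _ _ _ _ H').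
Qed.

Lemma ex_RInt_sin_pow k : ex_RInt (fun t => sin t ^ k)%R 0 PI.
Proof. apply (ex_RInt_continuous (V := R_CompleteNormedModule)). intros t _. Rcont. Qed.

Lemma sin_pow_step n : RInt (fun t => sin t ^ (S (S n)))%R 0 PI =
  (INR (S n) / INR (S (S n)) * RInt (fun t => sin t ^ n) 0 PI)%R.
Proof.
  assert (H : is_RInt (fun t => INR (S n) * sin t ^ n - INR (S (S n)) * sin t ^ (S (S n)))%R 0 PI
    (minus (sin PI ^ S n * cos PI) (sin 0 ^ S n * cos 0))%R).
  { apply (is_RInt_derive (fun t => sin t ^ S n * cos t)%R).
    - intros t _. auto_derive; auto.
      change (pred (S n)) with n. rewrite (S_INR (S n)). simpl pow.
      assert (E := sin2_cos2 t). unfold Rsqr in E.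
      replace (1 * cos t * (INR (S n) * sin t ^ n) * cos t)%R
        with (INR (S n) * sin t ^ n * (cos t * cos t))%R by ring.
      replace (cos t * cos t)%R with (1 - sin t * sin t)%R by lra. ring.
    - intros t _. Rcont. }
  assert (K : is_RInt (fun t => INR (S n) * sin t ^ n - INR (S (S n)) * sin t ^ (S (S n)))%R 0 PI
    (INR (S n) * RInt (fun t => sin t ^ n) 0 PI - INR (S (S n)) * RInt (fun t => sin t ^ (S (S n))) 0 PI)%R).
  { apply (is_RInt_minus (V := R_NormedModule)); apply (is_RInt_scal (V := R_NormedModule));
      apply (RInt_correct (V := R_CompleteNormedModule)), ex_RInt_sin_pow. }
  apply (is_RInt_inj _ _ _ _ _ H) in K.
  rewrite sin_PI, sin_0 in K. unfold minus, plus, opp in K; simpl in K.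
  assert (INR (S (S n)) <> 0)%R by (apply not_0_INR; lia).
  apply Rmult_eq_reg_l with (INR (S (S n))); auto.
  replace (INR (S (S n)) * (INR (S n) / INR (S (S n)) * RInt (fun t => sin t ^ n) 0 PI))%R
    with (INR (S n) * RInt (fun t => sin t ^ n) 0 PI)%R by (field; auto).
  simpl. lra.
Qed.

Lemma sin_pow_decr n :
  (RInt (fun t => sin t ^ S n) 0 PI <= RInt (fun t => sin t ^ n) 0 PI)%R.
Proof.
  apply RInt_le; auto using ex_RInt_sin_pow; [left; apply PI_RGT_0|].
  intros t Ht. assert (0 <= sin t)%R by (apply sin_ge_0; lra).
  assert (S1 := SIN_bound t). assert (0 <= sin t ^ n)%R by now apply pow_le.
  simpl. nra.
Qed.

Lemma sin_pow_even n : RInt (fun t => sin t ^ (2 * n))%R 0 PI = (PI * wallis n)%R.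
Proof.
  induction n.
  - simpl. rewrite RInt_const. unfold scal; simpl; unfold mult; simpl. ring.
  - replace (2 * S n)%nat with (S (S (2 * n))) by lia.
    rewrite sin_pow_step, IHn. simpl wallis. rewrite !S_INR, mult_INR.
    change (INR 2) with (1 + 1)%R. assert (P := pos_INR n). Req; field; repeat split; lra.
Qed.

Lemma wallis_pos n : (0 < wallis n)%R.
Proof.
  induction n; simpl; [lra|]. apply Rmult_lt_0_compat; auto.
  assert (P := pos_INR n). apply Rdiv_lt_0_compat; lra.
Qed.

Lemma sin_pow_odd n :
  RInt (fun t => sin t ^ (2 * n + 1))%R 0 PI = (2 / ((2 * INR n + 1) * wallis n))%R.
Proof.
  induction n.
  - simpl. change (INR 0) with 0%R.
    rewrite (is_RInt_unique _ _ _ (minus (- cos PI) (- cos 0))%R).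
    + rewrite cos_PI, cos_0. unfold minus, plus, opp; simpl. Req; field.
    + apply (is_RInt_derive (fun t => - cos t)%R).
      * intros t _. auto_derive; auto. ring.
      * intros t _. Rcont.
  - replace (2 * S n + 1)%nat with (S (S (2 * n + 1))) by lia.
    rewrite sin_pow_step, IHn. simpl wallis. rewrite !S_INR, plus_INR, mult_INR.
    change (INR 2) with (1 + 1)%R. change (INR 1) with 1%R.
    assert (P := pos_INR n). assert (W := wallis_pos n). Req; field; repeat split; lra.
Qed.

(** The integrals of [sin ^ k] over [[0, PI]] decrease in [k]; comparing the exponents [2 n],
    [2 n + 1] and [2 n + 2] gives the two inequalities. *)
Lemma wallis_bounds n :
  (2 / PI <= wallis n ^ 2 * (2 * INR n + 1) <= 2 / PI * ((2 * INR n + 2) / (2 * INR n + 1)))%R.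
Proof.
  assert (H1 := sin_pow_decr (2 * n)). assert (H2 := sin_pow_decr (2 * n + 1)).
  replace (S (2 * n)) with (2 * n + 1)%nat in H1 by lia.
  replace (S (2 * n + 1)) with (2 * S n)%nat in H2 by lia.
  rewrite sin_pow_odd, sin_pow_even in *. simpl wallis in H2.
  assert (P := pos_INR n). assert (W := wallis_pos n). assert (PP := PI_RGT_0).
  set (w := wallis n) in *. set (k := (2 * INR n + 1)%R) in *.
  replace (2 * INR n + 2)%R with (k + 1)%R in * by (unfold k; ring).
  assert (k1 : (1 <= k)%R) by (unfold k; lra).
  split.
  - apply Rmult_le_reg_l with (PI / (k * w))%R; [apply Rdiv_lt_0_compat; nra|].
    replace (PI / (k * w) * (2 / PI))%R with (2 / (k * w))%R by (field; repeat split; lra).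
    replace (PI / (k * w) * (w ^ 2 * k))%R with (PI * w)%R by (field; repeat split; lra). exact H1.
  - apply Rmult_le_reg_l with (PI * k / (w * k * (k + 1)))%R; [apply Rdiv_lt_0_compat; nra|].
    replace (PI * k / (w * k * (k + 1)) * (w ^ 2 * k))%R with (PI * (w * (k / (k + 1))))%R by (field; repeat split; lra).
    replace (PI * k / (w * k * (k + 1)) * (2 / PI * ((k + 1) / k)))%R with (2 / (k * w))%R by (field; repeat split; lra).
    exact H2.
Qed.

Lemma gauss_half n : (1 <= n)%nat ->
  gauss (1 / 2) n = RtoC ((INR n + / 2) * wallis n / sqrt (INR n))%R.
Proof.
  intros Hn.
  assert (E : rising_prod (1 / 2) n = RtoC ((INR n + / 2) * wallis n * INR (fact n))%R).
  { clear Hn. induction n.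
    - simpl. change (INR 0) with 0%R. change (INR 1) with 1%R.
      rewrite <- RtoC_div by lra. f_equal. field.
    - simpl rising_prod. rewrite IHn, fact_simpl, mult_INR.
      rewrite <- RtoC_div, <- RtoC_plus, <- RtoC_mult by lra. f_equal.
      simpl wallis. rewrite S_INR. assert (P := pos_INR n). Req; field; repeat split; lra. }
  assert (P : (0 < INR n)%R) by (apply lt_0_INR; lia).
  unfold gauss. rewrite E.
  replace (Cexp (1 / 2 * ln (INR n))) with (RtoC (sqrt (INR n))).
  - assert (Q := sqrt_lt_R0 _ P). assert (F := INR_fact_lt_0 n).
    rewrite <- RtoC_mult, <- RtoC_div by nra. f_equal. Req; field; repeat split; lra.
  - rewrite <- RtoC_div, <- RtoC_mult, Cexp_RtoC by lra. f_equal.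
    rewrite <- (exp_ln (sqrt _)) by now apply sqrt_lt_R0. f_equal.
    assert (E2 : (ln (INR n) = ln (sqrt (INR n)) + ln (sqrt (INR n)))%R).
    { rewrite <- ln_mult by now apply sqrt_lt_R0. now rewrite sqrt_sqrt by lra. }
    lra.
Qed.

Lemma RGamma_half : RGamma (1 / 2) = RtoC (/ sqrt PI).
Proof.
  assert (PP := PI_RGT_0).
  set (a := fun n => ((INR n + / 2) * wallis n / sqrt (INR n))%R).
  (* [wallis_bounds] concerns squares, so the squared Gauss product is squeezed between [1 / PI] and
     [(1 + 1 / n) / PI]; the positive root is taken at the end. *)
  assert (A2 : is_lim_seq (fun n => a n ^ 2)%R (/ PI)%R).
  { apply is_lim_seq_le_le_loc with (fun _ => / PI)%R (fun n => / PI * (1 + / INR n))%R.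
    - exists 1%nat. intros n Hn. unfold a.
      assert (P : (0 < INR n)%R) by (apply lt_0_INR; lia).
      assert (Q : (0 < / INR n)%R) by now apply Rinv_0_lt_compat.
      assert (W := wallis_bounds n).
      replace (((INR n + / 2) * wallis n / sqrt (INR n)) ^ 2)%R
        with ((2 * INR n + 1) / (4 * INR n) * (wallis n ^ 2 * (2 * INR n + 1)))%R.
      2: { unfold Rdiv. rewrite !Rpow_mult_distr, pow_inv, pow2_sqrt by lra. field. lra. }
      assert (0 < (2 * INR n + 1) / (4 * INR n))%R by (apply Rdiv_lt_0_compat; lra).
      assert (0 < / PI)%R by now apply Rinv_0_lt_compat.
      split.
      + apply Rle_trans with ((2 * INR n + 1) / (4 * INR n) * (2 / PI))%R;
          [|apply Rmult_le_compat_l; lra].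
        replace ((2 * INR n + 1) / (4 * INR n) * (2 / PI))%R
          with (/ PI + / PI * / INR n / 2)%R by (field; lra). nra.
      + apply Rle_trans with ((2 * INR n + 1) / (4 * INR n)
          * (2 / PI * ((2 * INR n + 2) / (2 * INR n + 1))))%R;
          [apply Rmult_le_compat_l; lra|].
        right. field. repeat split; lra.
    - apply is_lim_seq_const.
    - replace (Finite (/ PI)) with (Rbar_mult (/ PI)%R (1 + 0)%R) by (simpl; f_equal; ring).
      apply is_lim_seq_scal_l. apply is_lim_seq_plus'; [apply is_lim_seq_const|apply is_lim_inv_INR]. }
  apply is_Clim_unique. apply is_Clim_ext_loc with (fun n => RtoC (a n)).
  { exists 1%nat. intros n Hn. symmetry. now apply gauss_half. }
  apply is_Clim_RtoC. rewrite <- sqrt_inv.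
  apply is_lim_seq_ext_loc with (fun n => sqrt (a n ^ 2)).
  { exists 1%nat. intros n Hn. apply sqrt_pow2. unfold a.
    assert (P := pos_INR n). assert (W := wallis_pos n).
    apply Rmult_le_pos; [nra|]. left. apply Rinv_0_lt_compat, sqrt_lt_R0, lt_0_INR. lia. }
  apply (is_lim_seq_continuous sqrt); auto.
  apply continuity_pt_sqrt. left. now apply Rinv_0_lt_compat.
Qed.

(** * Bessel functions of the first kind in the order *)

Lemma Cexp_CLn (w : C) : w <> 0 -> Cexp (CLn w) = w.
Proof.
  intros Hw. assert (M : (0 < Cmod w)%R) by exact (proj1 (Cmod_gt_0 w) Hw).
  unfold Cexp, CLn. simpl Re; simpl Im. rewrite exp_ln by auto.
  set (t := (Re w / Cmod w)%R).
  assert (T : (-1 <= t <= 1)%R).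
  { assert (R := re_le_Cmod w). apply Rabs_le_between in R. unfold t. split.
    - apply Rmult_le_reg_r with (Cmod w); auto. unfold Rdiv. rewrite Rmult_assoc, Rinv_l; lra.
    - apply Rmult_le_reg_r with (Cmod w); auto. unfold Rdiv. rewrite Rmult_assoc, Rinv_l; lra. }
  (* This determines the sine of the argument up to sign; the case split in [Carg] supplies the
     sign. *)
  assert (S : (Cmod w * sqrt (1 - t²) = Rabs (Im w))%R).
  { replace (1 - t²)%R with ((Im w / Cmod w)²)%R.
    - rewrite sqrt_Rsqr_abs. unfold Rdiv. rewrite Rabs_mult, Rabs_inv.
      rewrite (Rabs_pos_eq (Cmod w)) by lra. field. lra.
    - unfold t. rewrite !Rsqr_div'. unfold Rsqr.
      assert (E := Cmod2_alt w). simpl in E. unfold Re, Im in *. field_simplify_eq; [|lra]. nra. }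
  assert (X : (Cmod w * t = Re w)%R) by (unfold t; field; lra).
  unfold Carg. destruct (Rle_dec 0 (Im w)) as [I|I]; fold t.
  - apply C_ext.
    + rewrite Re_RtoC_mult. simpl. rewrite cos_acos; auto.
    + rewrite Im_RtoC_mult. simpl. rewrite sin_acos by auto. rewrite S. apply Rabs_pos_eq; auto.
  - apply C_ext.
    + rewrite Re_RtoC_mult. simpl. rewrite cos_neg, cos_acos; auto.
    + rewrite Im_RtoC_mult. simpl. rewrite sin_neg, sin_acos by auto.
      rewrite <- Ropp_mult_distr_r, S. rewrite Rabs_left; lra.
Qed.

Lemma Cexp_Ci_PI : Cexp (Ci * PI) = - (1).
Proof.
  unfold Cexp. replace (Re (Ci * PI)) with 0%R by (simpl; ring).
  replace (Im (Ci * PI)) with PI by (simpl; ring).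
  rewrite exp_0, cos_PI, sin_PI. apply C_ext; simpl; ring.
Qed.

Lemma Cexp_opp_Ci_PI : Cexp (- (Ci * PI)) = - (1).
Proof. rewrite Cexp_opp, Cexp_Ci_PI. field. Qed.

Lemma Ccos_add_PI a : Ccos (a + PI) = - Ccos a.
Proof.
  unfold Ccos. replace (Ci * (a + PI)) with (Ci * a + Ci * PI) by ring.
  replace (- (Ci * a + Ci * PI)) with (- (Ci * a) + - (Ci * PI)) by ring.
  rewrite !Cexp_add, Cexp_Ci_PI, Cexp_opp_Ci_PI. field.
Qed.

Lemma Csin_add_PI a : Csin (a + PI) = - Csin a.
Proof.
  unfold Csin. replace (Ci * (a + PI)) with (Ci * a + Ci * PI) by ring.
  replace (- (Ci * a + Ci * PI)) with (- (Ci * a) + - (Ci * PI)) by ring.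
  rewrite !Cexp_add, Cexp_Ci_PI, Cexp_opp_Ci_PI. unfold Cdiv. ring.
Qed.

Lemma Ci2 : Ci * Ci = - (1).
Proof. apply C_ext; simpl; ring. Qed.

Lemma Ci_neq_0 : Ci <> 0.
Proof. intros E. apply (f_equal Im) in E. simpl in E. lra. Qed.

Lemma expands_cos : expands (fun e => Ccos (e * PI)) 1 0.
Proof.
  apply expands_ext with (fun e => / 2 * (Cexp ((Ci * PI) * e) + Cexp (- (Ci * PI) * e))).
  { intros e _. unfold Ccos. replace (Ci * PI * e) with (Ci * (e * PI)) by ring.
    replace (- (Ci * PI) * e) with (- (Ci * (e * PI))) by ring. field. }
  eapply expands_eq; [apply expands_scal, expands_plus; apply expands_exp|field|ring].
Qed.

Lemma expands_sin : expands (fun e => Csin (e * PI)) 0 PI.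
Proof.
  apply expands_ext with (fun e => / (2 * Ci) * (Cexp ((Ci * PI) * e) + (- (1)) * Cexp (- (Ci * PI) * e))).
  { intros e _. unfold Csin. replace (Ci * PI * e) with (Ci * (e * PI)) by ring.
    replace (- (Ci * PI) * e) with (- (Ci * (e * PI))) by ring. field. apply Ci_neq_0. }
  eapply expands_eq; [apply expands_scal, expands_plus; [|apply expands_scal]; apply expands_exp|ring|].
  field. apply Ci_neq_0.
Qed.

Lemma eventually_decr_bounded (N : nat) : forall u : nat -> R,
  (forall k, (N <= k)%nat -> u (S k) <= u k)%R -> exists B, forall k, (u k <= B)%R.
Proof.
  induction N; intros u H.
  - exists (u O). intros k. induction k; [lra|]. generalize (H k ltac:(lia)). lra.
  - destruct (IHN (fun k => u (S k))) as [B HB].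
    + intros k Hk. apply H. lia.
    + exists (Rmax B (u O)). intros [|k]; [apply Rmax_r|].
      eapply Rle_trans; [apply HB|apply Rmax_l].
Qed.

(** By the functional equation [|1 / Gamma (mu + k + 1)|] decreases in [k] as soon as
    [|mu + k + 1| >= 1], which holds for [k > |mu| + 1]. Boundedness is all that the convergence of
    the Bessel series needs, since [1 / k!] remains. *)
Lemma RGamma_bounded mu : exists B, forall k, (Cmod (RGamma (mu + INR k + 1)) <= B)%R.
Proof.
  destruct (nfloor_ex (Cmod mu) (Cmod_ge_0 mu)) as [N [_ HN]].
  apply (eventually_decr_bounded (S N)). intros k Hk.
  rewrite (RGamma_rec (mu + INR k + 1)), Cmod_mult.
  rewrite S_INR, RtoC_plus.
  replace (mu + (INR k + 1) + 1) with (mu + INR k + 1 + 1) by ring.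
  assert (1 <= Cmod (mu + INR k + 1))%R.
  { assert (K : (INR N + 1 <= INR k)%R) by (rewrite <- S_INR; now apply le_INR).
    assert (T := Cmod_triangle (mu + INR k + 1) (- mu)). rewrite Cmod_opp in T.
    replace (mu + INR k + 1 + - mu) with (RtoC (INR k + 1)) in T by (rewrite RtoC_plus; ring).
    rewrite Cmod_R, Rabs_pos_eq in T; generalize (pos_INR k); lra. }
  generalize (Cmod_ge_0 (RGamma (mu + INR k + 1 + 1))). nra.
Qed.

(** The series of [J_mu] without its factor [(z / 2)^mu], as a function of [q = (z / 2)^2]; the only
    multivalued part is thereby split off. *)
Definition bser (mu q : C) : C :=
  CSeries (fun k => RGamma (mu + INR k + 1) * (invfact k * (- q) ^ k)).

Lemma bser_correct mu q :
  is_Cser (fun k => RGamma (mu + INR k + 1) * (invfact k * (- q) ^ k)) (bser mu q).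
Proof.
  apply Cabs_ser. destruct (RGamma_bounded mu) as [B HB].
  apply Cabs_le with (fun k => (B * (Cmod q ^ k / INR (fact k)))%R).
  - intros k. rewrite !Cmod_mult, Cmod_R, Cmod_pow, Cmod_opp.
    assert (F := INR_fact_lt_0 k). unfold invfact.
    rewrite (Rabs_pos_eq (/ _)) by (left; now apply Rinv_0_lt_compat).
    unfold Rdiv. rewrite (Rmult_comm (Cmod q ^ k)).
    apply Rmult_le_compat_r; [|apply HB].
    apply Rmult_le_pos; [left; now apply Rinv_0_lt_compat|apply pow_le, Cmod_ge_0].
  - apply (ex_series_scal (V := R_NormedModule) B (fun k => (Cmod q ^ k / INR (fact k))%R)).
    eexists; apply is_series_exp.
Qed.

Lemma BesselJ_bser mu z :
  BesselJ mu z = Cexp (mu * CLn (z / 2)) * bser mu (Cexp (2 * CLn (z / 2))).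
Proof.
  unfold BesselJ. set (L := CLn (z / 2)).
  apply is_Cser_unique.
  apply is_Cser_ext with (2 := is_Cser_scal (Cexp (mu * L)) _ _ (bser_correct mu (Cexp (2 * L)))).
  intros k. replace ((mu + 2 * INR k) * L) with (mu * L + INR k * (2 * L)) by ring.
  rewrite Cexp_add, Cexp_scal_n.
  replace (- Cexp (2 * L)) with (- (1) * Cexp (2 * L)) by ring.
  rewrite Cpow_mult_l. unfold invfact. rewrite RtoC_inv by apply INR_fact_neq_0.
  field. cneq.
Qed.

Lemma invfact_S k : (INR (S k) * invfact (S k) = invfact k)%R.
Proof.
  unfold invfact. rewrite fact_simpl, mult_INR. field.
  split; [apply INR_fact_neq_0|now apply not_0_INR].
Qed.

(** Writing [1 / Gamma (mu + k) = (mu + k) / Gamma (mu + k + 1)] splits the sum in two; in the part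
    with the factor [k], [k / k! = 1 / (k - 1)!] shifts the index and raises the order. *)
Lemma bser_rec mu q : bser (mu - 1) q = mu * bser mu q - q * bser (mu + 1) q.
Proof.
  apply is_Cser_unique.
  apply is_Cser_ext with (fun k => mu * (RGamma (mu + INR k + 1) * (invfact k * (- q) ^ k))
    + INR k * (RGamma (mu + INR k + 1) * (invfact k * (- q) ^ k))).
  { intros k. replace (mu - 1 + INR k + 1) with (mu + INR k) by ring.
    rewrite (RGamma_rec (mu + INR k)). ring. }
  replace (mu * bser mu q - q * bser (mu + 1) q)
    with (mu * bser mu q + (- q) * bser (mu + 1) q) by ring.
  apply is_Cser_plus; [apply is_Cser_scal, bser_correct|].
  replace (- q * bser (mu + 1) q) with (- q * bser (mu + 1) q +
    INR 0 * (RGamma (mu + INR 0 + 1) * (invfact 0 * (- q) ^ 0)))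
    by (change (INR 0) with 0%R; ring).
  apply (is_Cser_decr (fun k => INR k * (RGamma (mu + INR k + 1) * (invfact k * (- q) ^ k)))).
  apply is_Cser_ext with (2 := is_Cser_scal (- q) _ _ (bser_correct (mu + 1) q)).
  intros k. rewrite <- (invfact_S k), RtoC_mult, S_INR, RtoC_plus.
  replace (mu + 1 + INR k + 1) with (mu + (INR k + 1) + 1) by ring.
  simpl Cpow. ring.
Qed.

Lemma BesselJ_rec (mu z : C) : z <> 0 ->
  BesselJ (mu - 1) z + BesselJ (mu + 1) z = 2 * mu / z * BesselJ mu z.
Proof.
  intros Hz. rewrite !BesselJ_bser, bser_rec. set (L := CLn (z / 2)).
  assert (E : Cexp L = z / 2).
  { apply Cexp_CLn. intros E. apply Hz. replace z with (2 * (z / 2)) by field. rewrite E; ring. }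
  replace (2 * L) with (L + L) by ring.
  replace ((mu - 1) * L) with (mu * L + - L) by ring.
  replace ((mu + 1) * L) with (mu * L + L) by ring.
  rewrite !Cexp_add, Cexp_opp, E. field. auto.
Qed.

Definition Yquot (z mu : C) : C :=
  (BesselJ mu z * Ccos (mu * PI) - BesselJ (- mu) z) / Csin (mu * PI).

(** At the order [- mu] the recurrence of [J] has the opposite sign, which the sign changes of [sin]
    and [cos] under a shift by [PI] compensate. *)
Lemma Yquot_rec (mu z : C) : z <> 0 ->
  Yquot z (mu - 1) + Yquot z (mu + 1) = 2 * mu / z * Yquot z mu.
Proof.
  intros Hz. unfold Yquot.
  assert (H1 := BesselJ_rec mu z Hz). assert (H2 := BesselJ_rec (- mu) z Hz).
  replace (- (mu - 1)) with (- mu + 1) by ring.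
  replace (- (mu + 1)) with (- mu - 1) by ring.
  replace ((mu + 1) * PI) with (mu * PI + PI) by ring.
  rewrite Csin_add_PI, Ccos_add_PI.
  replace (mu * PI) with ((mu - 1) * PI + PI) by ring.
  rewrite !Csin_add_PI, !Ccos_add_PI. set (s := Csin _). set (c := Ccos _).
  replace (BesselJ (mu + 1) z) with (2 * mu / z * BesselJ mu z - BesselJ (mu - 1) z)
    by (rewrite <- H1; ring).
  replace (BesselJ (- mu + 1) z) with (2 * - mu / z * BesselJ (- mu) z - BesselJ (- mu - 1) z)
    by (rewrite <- H2; ring).
  (* Where the sine vanishes, all three quotients are 0 by the convention [/ 0 = 0], so the identity
     holds at every complex order. *)
  destruct (Ceq_dec s 0) as [E|E]; [|field; auto].
  rewrite E. replace (- - RtoC 0) with (RtoC 0) by ring. replace (- RtoC 0) with (RtoC 0) by ring.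
  unfold Cdiv. replace (/ RtoC 0) with (RtoC 0); [ring|].
  apply C_ext; simpl; unfold Rdiv; ring.
Qed.

(** * Expansion of the Bessel series at an integer order *)

(** This is [Gamma (1 + e) / Gamma (k + 1 + e)]: the quotient isolates the dependence on [k], with
    value [1 / k!] and derivative [- H_k / k!] at [e = 0]. *)
Fixpoint hprod (e : C) (k : nat) : C :=
  match k with O => 1 | S p => hprod e p / (INR (S p) + e) end.

Lemma INR_add_neq_0 (e : C) k : (Cmod e <= 1 / 2)%R ->
  INR (S k) + e <> 0 /\ (/ 2 <= Cmod (INR (S k) + e))%R.
Proof.
  intros He.
  assert (K : (/ 2 <= Cmod (INR (S k) + e))%R).
  { assert (T := Cmod_triangle (INR (S k) + e) (- e)). rewrite Cmod_opp in T.
    replace (INR (S k) + e + - e) with (RtoC (INR (S k))) in T by ring.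
    rewrite Cmod_R, Rabs_pos_eq in T; rewrite S_INR in *; generalize (pos_INR k); lra. }
  split; auto. intros E. rewrite E, Cmod_0 in K. lra.
Qed.

Lemma RGamma_hprod (e : C) k : (Cmod e <= 1 / 2)%R ->
  RGamma (INR k + e + 1) = RGamma (1 + e) * hprod e k.
Proof.
  intros He. induction k.
  - change (INR 0) with 0%R. simpl. rewrite Cmult_1_r. f_equal. ring.
  - destruct (INR_add_neq_0 e k He) as [N _].
    assert (R := RGamma_rec (INR (S k) + e)).
    replace (INR k + e + 1) with (INR (S k) + e) in IHk by (rewrite S_INR, RtoC_plus; ring).
    rewrite IHk in R. simpl hprod.
    replace (RGamma (INR (S k) + e + 1)) with
      (/ (INR (S k) + e) * ((INR (S k) + e) * RGamma (INR (S k) + e + 1))) by (field; auto).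
    rewrite <- R. field. auto.
Qed.

Lemma harm_invfact_le k : (0 <= harm k * invfact k <= 1)%R.
Proof.
  assert (F := INR_fact_lt_0 k). assert (I : (0 < invfact k)%R) by now apply Rinv_0_lt_compat.
  assert (H := harm_bound k). split; [apply Rmult_le_pos; lra|].
  apply Rmult_le_reg_r with (INR (fact k)); auto. unfold invfact.
  rewrite Rmult_assoc, Rinv_l by lra.
  assert (INR k <= INR (fact k))%R; [|lra].
  apply le_INR. clear. induction k; [simpl; lia|].
  rewrite fact_simpl. generalize (lt_O_fact k). nia.
Qed.

Lemma harm_invfact_S k :
  (INR (S k) * (harm (S k) * invfact (S k)) = harm k * invfact k + invfact (S k))%R.
Proof.
  rewrite harm_S, <- (invfact_S k). field. apply not_0_INR; lia.
Qed.

(** The error obeys [r_(k+1) = (r_k + H_(k+1) / (k+1)! * e^2) / (k + 1 + e)], and the denominator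
    has modulus at least [1 / 2]. Each step thus at most doubles [r_k + |e|^2], which the bound
    [4^k - 1] survives. Geometric growth is acceptable because the series supplies another
    [1 / k!]. *)
Lemma hprod_expand (e : C) k : (Cmod e <= 1 / 2)%R ->
  (Cmod (hprod e k - (invfact k - harm k * invfact k * e)) <= (4 ^ k - 1) * Cmod e ^ 2)%R.
Proof.
  intros He. induction k.
  - simpl. unfold invfact; simpl. change (INR 1) with 1%R. rewrite Rinv_1.
    replace (1 - (1 - 0 * 1 * e)) with (RtoC 0) by ring. rewrite Cmod_0. lra.
  - destruct (INR_add_neq_0 e k He) as [N K].
    set (r := hprod e k - (invfact k - harm k * invfact k * e)) in *.
    assert (E : hprod e (S k) - (invfact (S k) - harm (S k) * invfact (S k) * e)
      = (r + (harm (S k) * invfact (S k))%R * (e * e)) / (INR (S k) + e)).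
    { simpl hprod. unfold r.
      assert (E1 := invfact_S k). assert (E2 := harm_invfact_S k).
      assert (E3 : (harm k * invfact k)%R = (INR (S k) * (harm (S k) * invfact (S k)) - invfact (S k))%R) by lra.
      rewrite <- (RtoC_mult (harm k)), E3, <- E1.
      rewrite !RtoC_minus, !RtoC_mult. field. auto. }
    rewrite E, Cmod_div by auto.
    assert (B : (Cmod (r + (harm (S k) * invfact (S k))%R * (e * e)) <= (4 ^ k - 1) * Cmod e ^ 2 + Cmod e ^ 2)%R).
    { eapply Rle_trans; [apply Cmod_triangle|]. apply Rplus_le_compat; auto.
      rewrite !Cmod_mult, Cmod_R. destruct (harm_invfact_le (S k)).
      rewrite Rabs_pos_eq by auto. assert (M := Cmod_ge_0 e). simpl pow.
      assert (0 <= Cmod e * Cmod e)%R by nra. nra. }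
    assert (P4 : (1 <= 4 ^ k)%R) by (apply pow_R1_Rle; lra).
    assert (M2 : (0 <= Cmod e ^ 2)%R) by apply pow2_ge_0.
    apply Rmult_le_reg_r with (Cmod (INR (S k) + e)); [lra|].
    unfold Rdiv. rewrite Rmult_assoc, Rinv_l, Rmult_1_r by lra.
    eapply Rle_trans; [apply B|].
    apply Rle_trans with ((4 ^ S k - 1) * Cmod e ^ 2 * / 2)%R; [simpl pow in *; nra|].
    apply Rmult_le_compat_l; auto. apply Rmult_le_pos; auto. simpl. lra.
Qed.

Definition hser (M : nat) (q e : C) : C :=
  CSeries (fun k => hprod e (k + M) * (invfact k * (- q) ^ k)).

Lemma invfact_pos k : (0 < invfact k <= 1)%R.
Proof.
  assert (F := INR_fact_lt_0 k). unfold invfact. split; [now apply Rinv_0_lt_compat|].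
  rewrite <- Rinv_1. apply Rinv_le_contravar; [lra|].
  change 1%R with (INR 1). apply le_INR, lt_O_fact.
Qed.

Definition Jcoef (M k : nat) : R := (invfact (k + M) * invfact k)%R.
Definition Hcoef (M k : nat) : R := (harm (k + M) * invfact (k + M) * invfact k)%R.

Lemma exptype_Jcoef M : exptype (Jcoef M).
Proof.
  apply (exptype_le invfact _ 1 1); try lra; [apply exptype_invfact|].
  intros n. unfold Jcoef. rewrite pow1. rewrite Rabs_mult.
  assert (I := invfact_pos (n + M)). rewrite (Rabs_pos_eq (invfact (n + M))) by lra.
  generalize (Rabs_pos (invfact n)). nra.
Qed.

Lemma exptype_Hcoef M : exptype (Hcoef M).
Proof.
  apply (exptype_le invfact _ 1 1); try lra; [apply exptype_invfact|].
  intros n. unfold Hcoef. rewrite pow1. rewrite Rabs_mult.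
  assert (I := harm_invfact_le (n + M)). rewrite (Rabs_pos_eq (harm _ * _)) by lra.
  generalize (Rabs_pos (invfact n)). nra.
Qed.

Lemma expands_hser M q :
  expands (hser M q) (CPS (Jcoef M) (- q)) (- CPS (Hcoef M) (- q)).
Proof.
  (* The sum over [k] of [4^(k + M) |q|^k / k!], which dominates the errors of [hprod_expand]. *)
  set (B := (4 ^ M * exp (4 * Cmod q))%R).
  assert (B0 : (0 <= B)%R).
  { apply Rmult_le_pos; [apply pow_le; lra|left; apply exp_pos]. }
  exists (2 * B)%R, (1 / 2)%R. split; [lra|]. split; [lra|]. intros e He.
  set (t := fun k => invfact k * (- q) ^ k).
  set (r := fun k => (hprod e (k + M) - (invfact (k + M) - harm (k + M) * invfact (k + M) * e)) * t k).
  assert (Br : forall k, (Cmod (r k) <= Cmod e ^ 2 * (4 ^ M * ((4 * Cmod q) ^ k / INR (fact k))))%R).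
  { intros k. unfold r, t. rewrite !Cmod_mult, Cmod_R, Cmod_pow, Cmod_opp.
    destruct (invfact_pos k) as [I _]. rewrite (Rabs_pos_eq (invfact k)) by lra.
    assert (H := hprod_expand e (k + M) ltac:(lra)).
    assert (Q : (0 <= Cmod q ^ k)%R) by apply pow_le, Cmod_ge_0.
    assert (M2 : (0 <= Cmod e ^ 2)%R) by apply pow2_ge_0.
    replace (Cmod e ^ 2 * (4 ^ M * ((4 * Cmod q) ^ k / INR (fact k))))%R
      with (4 ^ (k + M) * Cmod e ^ 2 * (invfact k * Cmod q ^ k))%R.
    - apply Rmult_le_compat_r; [apply Rmult_le_pos; lra|]. nra.
    - rewrite pow_add, Rpow_mult_distr. unfold invfact, Rdiv. ring. }
  assert (Sr : is_series (fun k => Cmod e ^ 2 * (4 ^ M * ((4 * Cmod q) ^ k / INR (fact k))))%R (Cmod e ^ 2 * B)%R).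
  { unfold B. do 2 apply Rser_scal. apply is_series_exp. }
  assert (Hr : is_Cser r (CSeries r)).
  { apply Cabs_ser, (Cabs_le _ _ Br). eexists; apply Sr. }
  assert (Hh : hser M q e = CSeries r + (CPS (Jcoef M) (- q) + (- e) * CPS (Hcoef M) (- q))).
  { apply is_Cser_unique.
    eapply is_Cser_ext; [|apply is_Cser_plus; [exact Hr|apply is_Cser_plus;
      [apply CPS_correct, exptype_Jcoef|apply is_Cser_scal, CPS_correct, exptype_Hcoef]]].
    intros k. cbv beta. unfold r, t, Jcoef, Hcoef. rewrite !RtoC_mult. ring. }
  rewrite Hh.
  replace (CSeries r + (CPS (Jcoef M) (- q) + - e * CPS (Hcoef M) (- q)) -
    CPS (Jcoef M) (- q) - - CPS (Hcoef M) (- q) * e) with (CSeries r) by ring.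
  generalize (is_Cser_bound _ _ _ _ Hr Br Sr). lra.
Qed.

Lemma hprod_bound (e : C) k : (Cmod e <= 1 / 2)%R -> (Cmod (hprod e k) <= 2 ^ k)%R.
Proof.
  intros He. induction k; simpl; [rewrite Cmod_1; lra|].
  destruct (INR_add_neq_0 e k He) as [N K]. rewrite Cmod_div by auto.
  apply Rmult_le_reg_r with (Cmod (INR (S k) + e)); [lra|].
  unfold Rdiv. rewrite Rmult_assoc, Rinv_l, Rmult_1_r by lra.
  assert (0 <= 2 ^ k)%R by (apply pow_le; lra). nra.
Qed.

Lemma hser_correct M (q e : C) : (Cmod e <= 1 / 2)%R ->
  is_Cser (fun k => hprod e (k + M) * (invfact k * (- q) ^ k)) (hser M q e).
Proof.
  intros He. apply Cabs_ser.
  apply Cabs_le with (fun k => (2 ^ M * ((2 * Cmod q) ^ k / INR (fact k)))%R).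
  - intros k. rewrite !Cmod_mult, Cmod_R, Cmod_pow, Cmod_opp.
    destruct (invfact_pos k) as [I _]. rewrite (Rabs_pos_eq (invfact k)) by lra.
    replace (2 ^ M * ((2 * Cmod q) ^ k / INR (fact k)))%R
      with (2 ^ (k + M) * (invfact k * Cmod q ^ k))%R.
    + apply Rmult_le_compat_r; [|now apply hprod_bound].
      apply Rmult_le_pos; [lra|apply pow_le, Cmod_ge_0].
    + rewrite pow_add, Rpow_mult_distr. unfold invfact, Rdiv. ring.
  - apply (ex_series_scal (V := R_NormedModule) (2 ^ M)%R (fun k => ((2 * Cmod q) ^ k / INR (fact k))%R)).
    eexists; apply is_series_exp.
Qed.

Lemma BesselJ_hser M (e z : C) : (Cmod e <= 1 / 2)%R ->
  BesselJ (INR M + e) z = Cexp ((INR M + e) * CLn (z / 2)) *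
    (RGamma (1 + e) * hser M (Cexp (2 * CLn (z / 2))) e).
Proof.
  intros He. rewrite BesselJ_bser. f_equal. set (q := Cexp _).
  apply is_Cser_unique.
  apply is_Cser_ext with (2 := is_Cser_scal (RGamma (1 + e)) _ _ (hser_correct M q e He)).
  intros k.
  replace (INR M + e + INR k + 1) with (INR (k + M) + e + 1) by (rewrite plus_INR, RtoC_plus; ring).
  rewrite RGamma_hprod by auto. ring.
Qed.

(** The value and the order-derivative of [BesselJ] at the order [M]. *)
Definition Jval (M : nat) (z : C) : C :=
  Cexp (INR M * CLn (z / 2)) * CPS (Jcoef M) (- Cexp (2 * CLn (z / 2))).
Definition Jder (M : nat) (z : C) : C :=
  (EulerMascheroni + CLn (z / 2)) * Jval M z
  - Cexp (INR M * CLn (z / 2)) * CPS (Hcoef M) (- Cexp (2 * CLn (z / 2))).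

Lemma expands_BesselJ M z :
  expands (fun e => BesselJ (INR M + e) z) (Jval M z) (Jder M z).
Proof.
  set (L := CLn (z / 2)). set (q := Cexp (2 * L)).
  apply expands_ext with (fun e => Cexp (INR M * L) * (Cexp (L * e) * (RGamma (1 + e) * hser M q e))).
  { intros e He. rewrite BesselJ_hser by auto. fold L q.
    replace ((INR M + e) * L) with (INR M * L + L * e) by ring. rewrite Cexp_add. ring. }
  eapply expands_eq; [apply expands_scal, expands_mult; [apply expands_exp|
    apply expands_mult; [apply expands_RGamma|apply expands_hser]]| |].
  - unfold Jval. fold L q. ring.
  - unfold Jder, Jval. fold L q. ring.
Qed.

(** * The limit defining [Y_m] *)

Definition LimAt (g : C -> C) (a l : C) : Prop :=
  forall eps : R, (0 < eps)%R -> exists delta : R, (0 < delta)%R /\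
    forall e : C, e <> 0 -> (Cmod e < delta)%R -> (Cmod (g (a + e)%C - l) < eps)%R.

Lemma LimAt_quot (g N D : C -> C) (a n d : C) :
  expands N 0 n -> expands D 0 d -> d <> 0 ->
  (forall e, (Cmod e <= 1 / 2)%R -> g (a + e) = N e / D e) -> LimAt g a (n / d).
Proof.
  intros (M & delta & H1 & H2 & H3) (M' & delta' & H1' & H2' & H3') Hd Hg eps Heps.
  assert (d0 : (0 < Cmod d)%R) by exact (proj1 (Cmod_gt_0 d) Hd).
  set (K := (M + M' * Cmod (n / d))%R).
  assert (K0 : (0 <= K)%R) by (unfold K; generalize (Cmod_ge_0 (n / d)); nra).
  (* Below [b] the denominator satisfies [|D e| >= |d| |e| / 2]; below [b'] the numerator error
     [K |e|^2] is less than [eps] times that bound. The summands 1 avoid division by zero. *)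
  set (b := (Cmod d / (2 * (M' + 1)))%R). set (b' := (eps * Cmod d / (2 * (K + 1)))%R).
  assert (P1 : (0 < b)%R) by (apply Rdiv_lt_0_compat; lra).
  assert (P2 : (0 < b')%R) by (apply Rdiv_lt_0_compat; nra).
  exists (Rmin (1 / 2) (Rmin (Rmin delta delta') (Rmin b b'))).
  split; [repeat apply Rmin_glb_lt; lra|].
  intros e He Hm.
  apply Rmin_Rgt in Hm. destruct Hm as [m1 Hm]. apply Rmin_Rgt in Hm. destruct Hm as [Hm Hm'].
  apply Rmin_Rgt in Hm. destruct Hm as [m2 m3]. apply Rmin_Rgt in Hm'. destruct Hm' as [m4 m5].
  set (c := Cmod e) in *.
  assert (c0 : (0 < c)%R) by exact (proj1 (Cmod_gt_0 e) He).
  assert (Q1 : (c * (2 * (M' + 1)) < Cmod d)%R).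
  { apply Rlt_le_trans with (b * (2 * (M' + 1)))%R.
    - apply Rmult_lt_compat_r; lra.
    - right. unfold b. field. lra. }
  assert (Q2 : (c * (2 * (K + 1)) < eps * Cmod d)%R).
  { apply Rlt_le_trans with (b' * (2 * (K + 1)))%R.
    - apply Rmult_lt_compat_r; lra.
    - right. unfold b'. field. lra. }
  assert (R1 := H3 e ltac:(fold c; lra)). assert (R2 := H3' e ltac:(fold c; lra)). fold c in R1, R2.
  set (rn := N e - 0 - n * e) in *. set (rd := D e - 0 - d * e) in *.
  assert (LD : (c * (Cmod d / 2) <= Cmod (D e))%R).
  { assert (T := Cmod_triangle (D e) (- rd)). rewrite Cmod_opp in T.
    replace (D e + - rd) with (d * e) in T by (unfold rd; ring).
    rewrite Cmod_mult in T. fold c in T. simpl in R2. nra. }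
  assert (De : D e <> 0).
  { intros E. rewrite E, Cmod_0 in LD. nra. }
  rewrite Hg by (fold c; lra).
  replace (N e / D e - n / d) with ((rn - rd * (n / d)) / D e) by (unfold rn, rd; field; auto).
  rewrite Cmod_div by auto.
  assert (X : (Cmod (rn - rd * (n / d)) <= K * c ^ 2)%R).
  { unfold Cminus. eapply Rle_trans; [apply Cmod_triangle|]. rewrite Cmod_opp, Cmod_mult.
    unfold K. assert (0 <= Cmod (n / d))%R by apply Cmod_ge_0. nra. }
  assert (DD : (0 < Cmod (D e))%R) by exact (proj1 (Cmod_gt_0 (D e)) De).
  apply Rmult_lt_reg_r with (Cmod (D e)); auto.
  unfold Rdiv. rewrite Rmult_assoc, Rinv_l, Rmult_1_r by lra.
  eapply Rle_lt_trans; [apply X|]. apply Rlt_le_trans with (eps * (c * (Cmod d / 2)))%R.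
  - simpl. nra.
  - apply Rmult_le_compat_l; lra.
Qed.

Lemma PI_C_neq_0 : RtoC PI <> 0.
Proof. intros E. apply RtoC_inj in E. generalize PI_RGT_0. lra. Qed.

(** At order 0 the values of [J_e] and [J_(-e)] cancel and their derivatives add up, whence the
    factor 2; [cos (e PI)] has no first-order term. *)
Lemma LimAt_Yquot_0 z : LimAt (Yquot z) 0 (2 * Jder 0 z / PI).
Proof.
  apply LimAt_quot with (fun e => BesselJ (INR 0 + e) z * Ccos (e * PI) + - (1) * BesselJ (INR 0 + - e) z)
    (fun e => Csin (e * PI)).
  - eapply expands_eq; [apply expands_plus; [apply expands_mult; [apply expands_BesselJ|apply expands_cos]|
      apply expands_scal, (expands_opp_var (fun e => BesselJ (INR 0 + e) z)), expands_BesselJ]|ring|ring].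
  - apply expands_sin.
  - apply PI_C_neq_0.
  - intros e He. unfold Yquot. change (INR 0) with 0%R. rewrite !Cplus_0_l. f_equal. ring.
Qed.

Lemma expands_id : expands (fun e => e) 0 1.
Proof.
  exists 0%R, 1%R. repeat split; try lra. intros e _.
  replace (e - 0 - 1 * e) with (RtoC 0) by ring. rewrite Cmod_0. lra.
Qed.

(** The recurrence gives [J_(-1-e) = - (2 e / z) J_(-e) - J_(1-e)]. No expansion near the order
    [- 1] is required, and the explicit factor [e] produces the extra term in [Jval 0]. *)
Lemma LimAt_Yquot_1 (z : C) : z <> 0 ->
  LimAt (Yquot z) 1 ((2 * Jder 1 z - 2 / z * Jval 0 z) / PI).
Proof.
  intros Hz.
  apply LimAt_quot with (fun e => BesselJ (INR 1 + e) z * Ccos (e * PI)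
      + - (1) * (BesselJ (INR 1 + - e) z + (2 / z) * (e * BesselJ (INR 0 + - e) z)))
    (fun e => Csin (e * PI)).
  - eapply expands_eq; [apply expands_plus; [apply expands_mult; [apply expands_BesselJ|apply expands_cos]|
      apply expands_scal, expands_plus; [apply (expands_opp_var (fun e => BesselJ (INR 1 + e) z)), expands_BesselJ|
       apply expands_scal, expands_mult; [apply expands_id|
       apply (expands_opp_var (fun e => BesselJ (INR 0 + e) z)), expands_BesselJ]]]|ring|ring].
  - apply expands_sin.
  - apply PI_C_neq_0.
  - intros e He. unfold Yquot. change (INR 0) with 0%R. change (INR 1) with 1%R.
    replace ((1 + e) * PI) with (e * PI + PI) by ring.
    rewrite Ccos_add_PI, Csin_add_PI, Cplus_0_l.
    assert (R := BesselJ_rec (- e) z Hz).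
    replace (- (1 + e)) with (- e - 1) by ring. replace (1 + - e) with (- e + 1) by ring.
    replace (BesselJ (- e - 1) z) with (2 * - e / z * BesselJ (- e) z - BesselJ (- e + 1) z)
      by (rewrite <- R; ring).
    set (s := Csin _). set (c := Ccos _).
    destruct (Ceq_dec s 0) as [E|E].
    + rewrite E. replace (- RtoC 0) with (RtoC 0) by ring.
      unfold Cdiv. replace (/ RtoC 0) with (RtoC 0); [ring|].
      apply C_ext; simpl; unfold Rdiv; ring.
    + field. auto.
Qed.

Lemma LimAt_linear (f g h : C -> C) (a b : C) (la lb : C) (z : C) : z <> 0 ->
  LimAt g a la -> LimAt h a lb ->
  (forall e, f (b + e) = 2 * (a + e) / z * g (a + e) - h (a + e)) ->
  LimAt f b (2 * a / z * la - lb).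
Proof.
  intros Hz Hg Hh Hf eps He.
  set (K := (Cmod (2 / z) * (Cmod a + Cmod la + 2))%R).
  assert (K0 : (0 <= K)%R).
  { apply Rmult_le_pos; [apply Cmod_ge_0|]. generalize (Cmod_ge_0 a) (Cmod_ge_0 la). lra. }
  set (eta := Rmin 1 (eps / (2 * (K + 1)))).
  assert (E1 : (0 < eps / (2 * (K + 1)))%R) by (apply Rdiv_lt_0_compat; lra).
  assert (E0 : (0 < eta)%R) by (apply Rmin_glb_lt; lra).
  destruct (Hg eta E0) as (d1 & D1 & G1).
  destruct (Hh (eps / 2)%R ltac:(lra)) as (d2 & D2 & G2).
  exists (Rmin eta (Rmin d1 d2)). split; [repeat apply Rmin_glb_lt; lra|].
  intros e Ee Em.   assert (m1 := Rmin_l eta (Rmin d1 d2)). assert (m2 := Rmin_r eta (Rmin d1 d2)).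
  assert (m3 := Rmin_l d1 d2). assert (m4 := Rmin_r d1 d2).
  assert (X1 := G1 e Ee ltac:(lra)). assert (X2 := G2 e Ee ltac:(lra)).
  rewrite Hf.
  replace (2 * (a + e) / z * g (a + e) - h (a + e) - (2 * a / z * la - lb))
    with ((2 / z) * ((a + e) * (g (a + e) - la) + e * la) + - (h (a + e) - lb)) by (field; auto).
  eapply Rle_lt_trans; [apply Cmod_triangle|]. rewrite Cmod_opp, Cmod_mult.
  assert (m5 := Rmin_l 1 (eps / (2 * (K + 1)))). assert (m6 := Rmin_r 1 (eps / (2 * (K + 1)))).
  fold eta in m5, m6.
  assert (X3 : (Cmod ((a + e) * (g (a + e)%C - la) + e * la) <= eta * (Cmod a + Cmod la + 2))%R).
  { eapply Rle_trans; [apply Cmod_triangle|]. rewrite !Cmod_mult.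
    assert (T := Cmod_triangle a e).
    assert (A0 := Cmod_ge_0 a). assert (L0 := Cmod_ge_0 la). assert (e0 := Cmod_ge_0 e).
    assert (Cmod (a + e) * Cmod (g (a + e)%C - la) <= (Cmod a + 1) * eta)%R
      by (apply Rmult_le_compat; auto using Cmod_ge_0; lra).
    assert (Cmod e * Cmod la <= eta * Cmod la)%R by (apply Rmult_le_compat_r; lra). lra. }
  assert (X4 : (Cmod (2 / z) * Cmod ((a + e) * (g (a + e)%C - la) + e * la) <= eta * K)%R).
  { unfold K. replace (eta * (Cmod (2 / z) * (Cmod a + Cmod la + 2)))%R
      with (Cmod (2 / z) * (eta * (Cmod a + Cmod la + 2)))%R by ring.
    apply Rmult_le_compat_l; auto. apply Cmod_ge_0. }
  assert (X5 : (eta * K <= eps / 2)%R).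
  { apply Rle_trans with (eps / (2 * (K + 1)) * (K + 1))%R.
    - apply Rmult_le_compat; lra.
    - right. field. lra. }
  lra.
Qed.

Lemma LimAt_Yquot_up (z : C) a l l' : z <> 0 ->
  LimAt (Yquot z) a l -> LimAt (Yquot z) (a - 1) l' ->
  LimAt (Yquot z) (a + 1) (2 * a / z * l - l').
Proof.
  intros Hz H H'. apply (LimAt_linear _ (Yquot z) (fun mu => Yquot z (mu - 1))); auto.
  - intros eps He. destruct (H' eps He) as (d & D & K). exists d. split; auto.
    intros e E1 E2. replace (a + e - 1) with (a - 1 + e) by ring. auto.
  - intros e. assert (R := Yquot_rec (a + e) z Hz).
    replace (a + 1 + e) with (a + e + 1) by ring. rewrite <- R. ring.
Qed.

Lemma LimAt_Yquot_down (z : C) a l l' : z <> 0 ->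
  LimAt (Yquot z) a l -> LimAt (Yquot z) (a + 1) l' ->
  LimAt (Yquot z) (a - 1) (2 * a / z * l - l').
Proof.
  intros Hz H H'. apply (LimAt_linear _ (Yquot z) (fun mu => Yquot z (mu + 1))); auto.
  - intros eps He. destruct (H' eps He) as (d & D & K). exists d. split; auto.
    intros e E1 E2. replace (a + e + 1) with (a + 1 + e) by ring. auto.
  - intros e. assert (R := Yquot_rec (a + e) z Hz).
    replace (a - 1 + e) with (a + e - 1) by ring. rewrite <- R. ring.
Qed.

(** Two consecutive values determine a solution of the three-term recurrence; the induction carries
    a pair of neighbouring orders, once upwards and once downwards. *)
Lemma LimAt_Yquot_all (z : C) (Rm : Z -> C) : z <> 0 ->
  (forall m, Rm (m - 1)%Z + Rm (m + 1)%Z = 2 * IZR m / z * Rm m) ->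
  LimAt (Yquot z) 0 (Rm 0%Z) -> LimAt (Yquot z) 1 (Rm 1%Z) ->
  forall m : Z, LimAt (Yquot z) (IZR m) (Rm m).
Proof.
  intros Hz HR H0 H1.
  assert (P : forall n : nat, LimAt (Yquot z) (IZR (Z.of_nat n)) (Rm (Z.of_nat n)) /\
    LimAt (Yquot z) (IZR (Z.of_nat n + 1)) (Rm (Z.of_nat n + 1)%Z)).
  { induction n; [split; auto|]. destruct IHn as [A B].
    replace (Z.of_nat (S n)) with (Z.of_nat n + 1)%Z by lia. split; auto.
    set (k := (Z.of_nat n + 1)%Z) in *.
    replace (Rm (k + 1)%Z) with (2 * IZR k / z * Rm k - Rm (k - 1)%Z) by (rewrite <- HR; ring).
    rewrite plus_IZR, RtoC_plus. apply LimAt_Yquot_up; auto.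
    rewrite <- RtoC_minus, <- minus_IZR. replace (k - 1)%Z with (Z.of_nat n) by lia. auto. }
  assert (Q : forall n : nat, LimAt (Yquot z) (IZR (- Z.of_nat n)) (Rm (- Z.of_nat n)%Z) /\
    LimAt (Yquot z) (IZR (- Z.of_nat n + 1)) (Rm (- Z.of_nat n + 1)%Z)).
  { induction n; [split; auto|]. destruct IHn as [A B].
    replace (- Z.of_nat (S n))%Z with (- Z.of_nat n - 1)%Z by lia.
    replace (- Z.of_nat n - 1 + 1)%Z with (- Z.of_nat n)%Z by lia. split; auto.
    set (k := (- Z.of_nat n)%Z) in *.
    replace (Rm (k - 1)%Z) with (2 * IZR k / z * Rm k - Rm (k + 1)%Z) by (rewrite <- HR; ring).
    rewrite minus_IZR, RtoC_minus. apply LimAt_Yquot_down; auto.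
    rewrite <- RtoC_plus, <- plus_IZR. auto. }
  intros m. destruct (Z.le_ge_cases 0 m) as [M|M].
  - destruct (P (Z.to_nat m)) as [A _]. now rewrite Z2Nat.id in A.
  - destruct (Q (Z.to_nat (- m))) as [A _]. rewrite Z2Nat.id in A by lia.
    now rewrite Z.opp_involutive in A.
Qed.

Lemma locally'_C_punctured (a : C) (P : C -> Prop) :
  locally' (T := C_UniformSpace) a P ->
  exists delta : R, (0 < delta)%R /\ forall e : C, e <> 0 -> (Cmod e < delta)%R -> P (a + e).
Proof.
  intros [d Hd]. exists d. split; [apply cond_pos|].
  intros e E1 E2. apply Hd.
  - apply (C_NormedModule_mixin_compat1 a (a + e) d).
    replace (minus (a + e) a) with e; auto.
    unfold minus, plus, opp; simpl. ring.
  - intros E. apply E1. replace e with (a + e - a) by ring. rewrite E. ring.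
Qed.

(** [lim] is meaningful on Cauchy filters only. Convergence to [l] makes the filter Cauchy, and two
    limits of a proper filter are arbitrarily close, hence equal. *)
Lemma BesselY_LimAt (m : Z) (z l : C) : LimAt (Yquot z) (IZR m) l -> BesselY m z = l.
Proof.
  intros H. set (a := RtoC (IZR m)) in *.
  set (F := filtermap (Yquot z) (locally' (T := C_UniformSpace) a)).
  assert (FF : ProperFilter F).
  { apply filtermap_proper_filter. split; [|apply locally'_filter].
    intros P HP. destruct (locally'_C_punctured a P HP) as (d & D & K).
    exists (a + RtoC (d / 2)). apply K.
    - intros E. apply RtoC_inj in E. lra.
    - rewrite Cmod_R, Rabs_pos_eq; lra. }
  assert (B : forall eps : posreal, F (fun y => ball (M := C_R_CompleteNormedModule) l eps y)).
  { intros eps. destruct (H eps (cond_pos eps)) as (d & D & K).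
    (* Balls of [C] are squares, so the radius shrinks by [sqrt 2] to control the modulus. *)
    assert (D' : (0 < d / sqrt 2)%R) by (apply Rdiv_lt_0_compat; auto; apply sqrt_lt_R0; lra).
    exists (mkposreal _ D'). intros y Hy Hne. change (UniformSpace.sort C_UniformSpace) with C in y. simpl in Hy.
    apply (C_NormedModule_mixin_compat1 l (Yquot z y) eps).
    assert (M : (Cmod (y - a) < d)%R).
    { assert (X := C_NormedModule_mixin_compat2 a y (mkposreal _ D') Hy). simpl in X.
      replace (sqrt 2 * (d / sqrt 2))%R with d in X
        by (field; apply Rgt_not_eq, sqrt_lt_R0; lra).
      exact X. }
    assert (N : y - a <> 0).
    { intros E. apply Hne. replace y with (y - a + a) by ring. rewrite E. 
      match goal with |- ?u = ?v => change (@eq C u v) end. ring. }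
    assert (X := K (y - a) N M). replace (a + (y - a)) with y in X by ring. exact X. }
  assert (CF : cauchy (T := C_R_CompleteNormedModule) F).
  { intros eps. exists l. apply B. }
  assert (L := complete_cauchy (T := C_R_CompleteNormedModule) F FF CF).
  change (BesselY m z) with (lim (T := C_R_CompleteNormedModule) F).
  apply (eq_close (V := C_R_NormedModule)). intros eps.
  set (e2 := pos_div_2 eps).
  assert (X : F (fun y => ball (M := C_R_CompleteNormedModule) (lim (T := C_R_CompleteNormedModule) F) e2 y
    /\ ball (M := C_R_CompleteNormedModule) l e2 y)) by (apply filter_and; auto).
  destruct (filter_ex _ X) as (y & Y1 & Y2).
  replace (pos eps) with (pos e2 + pos e2)%R by (unfold e2; simpl; field).
  apply ball_triangle with y; auto. now apply ball_sym.
Qed.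

(** * Improper integrals on a half-open interval *)

Open Scope R_scope.

Definition limL (F : R -> R) (l : R) : Prop :=
  forall eps, 0 < eps -> exists delta, 0 < delta /\
    forall b, 0 <= b < PI -> PI - delta < b -> Rabs (F b - l) < eps.

Lemma limL_ext F G l : (forall b, 0 <= b < PI -> F b = G b) -> limL F l -> limL G l.
Proof.
  intros H HF eps He. destruct (HF eps He) as (d & D & K). exists d. split; auto.
  intros b B1 B2. rewrite <- H by auto. auto.
Qed.

Lemma limL_plus F G l m : limL F l -> limL G m -> limL (fun b => F b + G b) (l + m).
Proof.
  intros HF HG eps He. destruct (HF (eps / 2)) as (d & D & K); [lra|].
  destruct (HG (eps / 2)) as (d' & D' & K'); [lra|].
  exists (Rmin d d'). split; [now apply Rmin_glb_lt|]. intros b B1 B2.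
  assert (m1 := Rmin_l d d'). assert (m2 := Rmin_r d d').
  specialize (K b B1 ltac:(lra)). specialize (K' b B1 ltac:(lra)).
  replace (F b + G b - (l + m)) with ((F b - l) + (G b - m)) by ring.
  eapply Rle_lt_trans; [apply Rabs_triang|]. lra.
Qed.

Lemma limL_scal c F l : limL F l -> limL (fun b => c * F b) (c * l).
Proof.
  intros HF eps He. assert (C0 := Rabs_pos c).
  destruct (HF (eps / (Rabs c + 1))) as (d & D & K); [apply Rdiv_lt_0_compat; lra|].
  exists d. split; auto. intros b B1 B2. specialize (K b B1 B2).
  rewrite <- Rmult_minus_distr_l, Rabs_mult.
  apply Rle_lt_trans with (Rabs c * (eps / (Rabs c + 1))).
  - apply Rmult_le_compat_l; lra.
  - apply Rmult_lt_reg_r with (Rabs c + 1); [lra|].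
    replace (Rabs c * (eps / (Rabs c + 1)) * (Rabs c + 1)) with (Rabs c * eps) by (field; lra).
    nra.
Qed.

Lemma limL_continuous (F : R -> R) : continuous F PI -> limL F (F PI).
Proof.
  intros H eps He.
  assert (L : locally (F PI) (fun y => Rabs (y - F PI) < eps)).
  { exists (mkposreal eps He). intros y Hy. exact Hy. }
  destruct (H _ L) as [d Hd]. exists d. split; [apply cond_pos|].
  intros b B1 B2. apply Hd. unfold ball; simpl; unfold AbsRing_ball, abs, minus, plus, opp; simpl.
  rewrite Rabs_left; lra.
Qed.

Lemma limL_squeeze_0 (F G : R -> R) :
  (forall b, 0 <= b < PI -> Rabs (F b) <= G b) -> limL G 0 -> limL F 0.
Proof.
  intros H HG eps He. destruct (HG eps He) as (d & D & K). exists d. split; auto.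
  intros b B1 B2. specialize (K b B1 B2). specialize (H b B1). rewrite Rminus_0_r in *.
  generalize (Rle_abs (G b)). lra.
Qed.

Lemma limL_le_const F l M : limL F l -> (forall b, 0 <= b < PI -> Rabs (F b) <= M) -> Rabs l <= M.
Proof.
  intros H HM. apply Rnot_lt_le. intros L.
  destruct (H (Rabs l - M)) as (d & D & K); [lra|].
  assert (PP := PI_RGT_0). set (s := Rmin PI d).
  assert (S0 : 0 < s) by (unfold s; now apply Rmin_glb_lt).
  assert (s1 := Rmin_l PI d). assert (s2 := Rmin_r PI d). fold s in s1, s2.
  specialize (K (PI - s / 2) ltac:(lra) ltac:(lra)). specialize (HM (PI - s / 2) ltac:(lra)).
  set (y := F (PI - s / 2)) in *.
  assert (T := Rabs_triang (l - y) y). replace (l - y + y) with l in T by ring.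
  rewrite (Rabs_minus_sym l y) in T. lra.
Qed.

(** The primitive is part of the data, so that linearity and the fundamental theorem transfer
    directly; only its left limit at [PI] is required, because of the logarithm there. *)
Definition impR (f : R -> R) (l : R) : Prop :=
  exists F : R -> R, (forall b, 0 <= b < PI -> is_RInt f 0 b (F b)) /\ limL F l.

Lemma impR_ext f g l : (forall t, 0 <= t < PI -> f t = g t) -> impR f l -> impR g l.
Proof.
  intros H (F & H1 & H2). exists F. split; auto. intros b Hb.
  apply is_RInt_ext with (2 := H1 b Hb). intros t Ht.
  rewrite Rmin_left, Rmax_right in Ht by lra. apply H. lra.
Qed.

Lemma impR_plus f g l m : impR f l -> impR g m -> impR (fun t => f t + g t) (l + m).
Proof.
  intros (F & H1 & H2) (G & H3 & H4). exists (fun b => F b + G b). split.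
  - intros b Hb. apply (is_RInt_plus (V := R_NormedModule)); auto.
  - now apply limL_plus.
Qed.

Lemma impR_scal c f l : impR f l -> impR (fun t => c * f t) (c * l).
Proof.
  intros (F & H1 & H2). exists (fun b => c * F b). split.
  - intros b Hb. apply (is_RInt_scal (V := R_NormedModule)); auto.
  - now apply limL_scal.
Qed.

Lemma impR_derive (f df : R -> R) (L : R) :
  (forall t, 0 <= t < PI -> is_derive f t (df t)) ->
  (forall t, 0 <= t < PI -> continuous df t) ->
  limL f L -> impR df (L - f 0).
Proof.
  intros H1 H2 H3. exists (fun b => f b - f 0). split.
  - intros b Hb. apply (is_RInt_derive (V := R_CompleteNormedModule)); intros t Ht;
      rewrite Rmin_left, Rmax_right in Ht by lra; [apply H1|apply H2]; lra.
  - apply limL_ext with (fun b => f b + (- (1)) * f 0); [intros; ring|].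
    replace (L - f 0) with (L + (- (1)) * f 0) by ring. apply limL_plus; auto.
    intros eps He. exists 1. split; [lra|]. intros b _ _. rewrite Rminus_diag, Rabs_R0. auto.
Qed.

Lemma one_cos_pos t : 0 <= t < PI -> 0 < 1 + cos t.
Proof.
  intros Ht. assert (cos PI < cos t); [|rewrite cos_PI in *; lra].
  apply cos_decreasing_1; lra.
Qed.

Lemma ln4_le_3 : 0 <= ln 4 <= 3.
Proof.
  split; [|generalize (ln_le_sub1 4); lra].
  rewrite <- ln_1. apply Rcomplements.ln_le; lra.
Qed.

(** * The log-sine integral *)

Definition lw (t : R) : R := ln (2 * (1 + cos t)).

Lemma lw_le_3 t : 0 <= t < PI -> lw t <= 3.
Proof.
  intros Ht. assert (P := one_cos_pos t Ht). assert (C1 := COS_bound t).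
  apply Rle_trans with (ln 4); [|apply ln4_le_3]. apply Rcomplements.ln_le; lra.
Qed.

Lemma lw_derive t : 0 < 1 + cos t -> is_derive lw t (- sin t / (1 + cos t)).
Proof. intros P. unfold lw. auto_derive; [lra|]. field. lra. Qed.

Lemma lw_continuous t : 0 < 1 + cos t -> continuous lw t.
Proof. intros P. apply (ex_derive_continuous (V := R_NormedModule)). eexists. now apply lw_derive. Qed.

Lemma one_cos_pos' t : - PI < t < PI -> 0 < 1 + cos t.
Proof.
  intros Ht. destruct (Rle_dec 0 t); [apply one_cos_pos; lra|].
  rewrite <- cos_neg. apply one_cos_pos; lra.
Qed.

Definition Alw (b : R) : R := RInt lw 0 b.

Lemma Alw_correct b : 0 <= b < PI -> is_RInt lw 0 b (Alw b).
Proof.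
  intros Hb. apply (RInt_correct (V := R_CompleteNormedModule)).
  apply (ex_RInt_continuous (V := R_CompleteNormedModule)). intros t Ht.
  rewrite Rmin_left, Rmax_right in Ht by lra. apply lw_continuous, one_cos_pos. lra.
Qed.

(** Negative [b] are included because [Alw_double] differentiates [Alw (PI - 2 * s)] up to
    [s = PI / 2], where the argument is 0 and a two-sided derivative is needed. *)
Lemma Alw_derive b : - PI < b < PI -> is_derive Alw b (lw b).
Proof.
  intros Hb. apply (is_derive_RInt (V := R_NormedModule) lw Alw 0 b).
  - assert (P : 0 < (PI - Rabs b) / 2) by (unfold Rabs; destruct (Rcase_abs b); lra).
    exists (mkposreal _ P). intros y Hy.
    unfold ball in Hy; simpl in Hy; unfold AbsRing_ball, abs, minus, plus, opp in Hy; simpl in Hy.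
    assert (Y : - PI < y < PI).
    { unfold Rabs in *; destruct (Rcase_abs b), (Rcase_abs (y + - b)); lra. }
    apply (RInt_correct (V := R_CompleteNormedModule)).
    apply (ex_RInt_continuous (V := R_CompleteNormedModule)). intros t Ht.
    apply lw_continuous, one_cos_pos'. unfold Rmin, Rmax in Ht; destruct (Rle_dec 0 y); lra.
  - now apply lw_continuous, one_cos_pos'.
Qed.

Lemma is_RInt_cst (b c : R) : is_RInt (fun _ => c) 0 b (c * b).
Proof.
  replace (c * b) with (scal (b - 0) c) by (unfold scal; simpl; unfold mult; simpl; ring).
  apply (is_RInt_const (V := R_NormedModule)).
Qed.

Lemma Alw_small b : 0 <= b <= PI / 2 -> Rabs (Alw b) <= 3 * b.
Proof.
  intros Hb. assert (PP := PI_RGT_0).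
  assert (H := norm_RInt_le (V := R_NormedModule) lw (fun _ => 3) 0 b (Alw b) (3 * b)).
  apply H; clear H; try lra.
  - intros t Ht. change (Rabs (lw t) <= 3).
    assert (C0 : 0 <= cos t) by (apply cos_ge_0; lra).
    assert (L : 0 <= lw t) by (unfold lw; rewrite <- ln_1; apply Rcomplements.ln_le; lra).
    rewrite Rabs_pos_eq by auto. apply lw_le_3. lra.
  - apply Alw_correct. lra.
  - apply is_RInt_cst.
Qed.

(* [4 sin^2 t = 2 - 2 cos (2 t)] turns the derivative of the left-hand side minus the
   right-hand side into [ln 1 = 0]. *)
Lemma Alw_double t : 0 < t <= PI / 2 -> Alw (PI - t) = Alw t + Alw (PI - 2 * t) / 2.
Proof.
  intros Ht. assert (PP := PI_RGT_0).
  destruct (Req_dec t (PI / 2)) as [->|Hn].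
  { replace (PI - PI / 2) with (PI / 2) by field. replace (PI - 2 * (PI / 2)) with 0 by field.
    unfold Alw at 3. rewrite RInt_point. unfold zero; simpl. lra. }
  set (h := fun t => Alw t - Alw (PI - t) + Alw (PI - 2 * t) / 2).
  assert (H : h t = h (PI / 2)).
  { apply (eq_is_derive (V := R_NormedModule)); [|lra]. intros s Hs. unfold h.
    assert (D1 := Alw_derive s ltac:(lra)). assert (D2 := Alw_derive (PI - s) ltac:(lra)).
    assert (D3 := Alw_derive (PI - 2 * s) ltac:(lra)).
    assert (E1 : Derive (fun x : R => Alw x) s = lw s) by now apply is_derive_unique.
    assert (E2 : Derive (fun x : R => Alw x) (PI - s) = lw (PI - s)) by now apply is_derive_unique.
    assert (E3 : Derive (fun x : R => Alw x) (PI - 2 * s) = lw (PI - 2 * s)) by now apply is_derive_unique.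
    evar_last.
    - auto_derive; [repeat split; eexists; [apply D1|apply D2|apply D3]|reflexivity].
    - rewrite E1. unfold Rminus in E2, E3. rewrite ?E2, ?E3. fold (PI - s) (PI - 2 * s).
      assert (X : lw s + lw (PI - s) = lw (PI - 2 * s)).
      { unfold lw. rewrite <- ln_mult.
        - f_equal. rewrite !Rtrigo_facts.cos_pi_minus, cos_2a_cos. ring.
        - assert (0 < 1 + cos s) by (apply one_cos_pos; lra). lra.
        - assert (0 < 1 + cos (PI - s)) by (apply one_cos_pos; lra). lra. }
      unfold zero; simpl. lra. }
  unfold h in H.
  replace (PI - PI / 2) with (PI / 2) in H by field. replace (PI - 2 * (PI / 2)) with 0 in H by field.
  replace (Alw 0) with 0 in H by (unfold Alw; now rewrite RInt_point). lra.
Qed.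

(* [B t := Alw (PI - t)] satisfies [B t = O(t) + B (2 t) / 2] by [Alw_double], and halving the
   argument loses a factor [sqrt 2 < 2] on the claimed bound. *)
Lemma Alw_near_PI : exists K, 0 <= K /\ forall t, 0 < t <= PI -> Rabs (Alw (PI - t)) <= K * sqrt t.
Proof.
  assert (PP := PI_RGT_0). assert (P4 := PI_4).
  (* The induction step needs [3 t + (K / 2) sqrt 2 sqrt t <= K sqrt t]. As [sqrt t <= 2] and
     [sqrt 2 <= 3 / 2], any [K >= 24] would do. *)
  exists 40. split; [lra|].
  assert (S4 : sqrt 4 = 2) by (replace 4 with (2 * 2) by ring; apply sqrt_square; lra).
  assert (Sq : forall t, 0 < t <= PI -> 0 < sqrt t <= 2 /\ t = sqrt t * sqrt t).
  { intros t Ht. split; [split; [apply sqrt_lt_R0; lra|]|rewrite sqrt_sqrt; lra].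
    rewrite <- S4. apply sqrt_le_1_alt. lra. }
  assert (S2 : sqrt 2 <= 3 / 2).
  { replace (3 / 2) with (sqrt ((3 / 2) * (3 / 2))) by (apply sqrt_square; lra).
    apply sqrt_le_1_alt. lra. }
  assert (A : forall n t, PI / 2 ^ (S n) <= t <= PI -> Rabs (Alw (PI - t)) <= 40 * sqrt t).
  { assert (P2 : forall n, 0 < 2 ^ n) by (intros n; apply pow_lt; lra).
    induction n; intros t Ht.
    - replace (PI / 2 ^ 1) with (PI / 2) in Ht by (simpl; field).
      eapply Rle_trans; [apply Alw_small; lra|].
      destruct (Sq t ltac:(lra)) as [Q1 Q2].
      assert (1 <= sqrt t) by (rewrite <- sqrt_1; apply sqrt_le_1_alt; generalize PI2_1; lra). lra.
    - destruct (Rle_dec (PI / 2 ^ (S n)) t) as [L|L]; [apply IHn; lra|].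
      assert (L1 : PI / 2 ^ (S n) <= PI / 2).
      { unfold Rdiv. apply Rmult_le_compat_l; [lra|]. apply Rinv_le_contravar; [lra|].
        simpl. assert (1 <= 2 ^ n) by (apply pow_R1_Rle; lra). lra. }
      assert (T0 : 0 < PI / 2 ^ S (S n)) by (apply Rdiv_lt_0_compat; auto).
      assert (L2 : 2 * (PI / 2 ^ S (S n)) = PI / 2 ^ S n).
      { simpl. field. apply Rgt_not_eq, P2. }
      rewrite Alw_double by lra.
      eapply Rle_trans; [apply Rabs_triang|]. unfold Rdiv. rewrite Rabs_mult, (Rabs_pos_eq (/ 2)) by lra.
      assert (H1 := Alw_small t ltac:(lra)). assert (H2 := IHn (2 * t) ltac:(lra)).
      rewrite sqrt_mult in H2 by lra.
      destruct (Sq t ltac:(lra)) as [Q1 Q2]. nra. }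
  intros t Ht. destruct (nfloor_ex (PI / t)) as [n [_ Hn]].
  { left. apply Rdiv_lt_0_compat; lra. }
  apply (A n). split; [|lra].
  assert (N : INR n + 1 <= 2 ^ S n).
  { clear. induction n; [change (INR 0) with 0; simpl; lra|]. rewrite S_INR.
    change (2 ^ S (S n)) with (2 * 2 ^ S n). assert (P := pos_INR n). lra. }
  assert (P2 : 0 < 2 ^ S n) by (apply pow_lt; lra).
  apply Rmult_le_reg_r with (2 ^ S n); auto. unfold Rdiv. rewrite Rmult_assoc, Rinv_l by lra.
  assert (PI = PI / t * t) by (field; lra).
  assert (PI / t * t <= 2 ^ S n * t) by (apply Rmult_le_compat_r; lra). lra.
Qed.

Lemma limL_sqrt : limL (fun b => sqrt (PI - b)) 0.
Proof.
  replace 0 with (sqrt (PI - PI)) by (rewrite Rminus_diag; apply sqrt_0).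
  apply (limL_continuous (fun b => sqrt (PI - b))).
  apply (continuous_comp (fun b => PI - b) sqrt).
  - Rcont.
  - apply continuity_pt_filterlim, continuity_pt_sqrt. lra.
Qed.

Lemma impR_lw : impR lw 0.
Proof.
  destruct Alw_near_PI as (K & K0 & H). exists Alw. split; [apply Alw_correct|].
  apply limL_squeeze_0 with (fun b => K * sqrt (PI - b)).
  - intros b Hb. replace b with (PI - (PI - b)) at 1 by ring. apply H. lra.
  - replace 0 with (K * 0) by ring. apply limL_scal, limL_sqrt.
Qed.

Lemma Alw_bounded : exists M, forall b, 0 <= b < PI -> Rabs (Alw b) <= M.
Proof.
  destruct Alw_near_PI as (K & K0 & H). exists (K * sqrt PI). intros b Hb.
  replace b with (PI - (PI - b)) by ring. eapply Rle_trans; [apply H; lra|].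
  apply Rmult_le_compat_l; auto. apply sqrt_le_1_alt. lra.
Qed.

(** * Moments of [1 + cos], plain and with the logarithm *)

Definition uu (t : R) : R := 1 + cos t.

Lemma uu_pos t : 0 <= t < PI -> 0 < uu t.
Proof. apply one_cos_pos. Qed.

Lemma uu_bound t : 0 <= uu t <= 2.
Proof. unfold uu. generalize (COS_bound t). lra. Qed.

Lemma uu_pow_bound n t : Rabs (uu t ^ n) <= 2 ^ n.
Proof.
  assert (B := uu_bound t). rewrite Rabs_pos_eq by (apply pow_le; lra). apply pow_incr. lra.
Qed.

(** With [r^4 = 2 u] one has [|sin t| <= r^2], as [sin^2 = u (2 - u)], and
    [|ln (2 u)| = 4 |ln r| <= 6 / r]; hence the bound [6 r]. It makes the boundary terms at [PI]
    vanish. *)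
Lemma sin_lw_bound t : 0 <= t < PI -> Rabs (sin t * lw t) <= 6 * sqrt (sqrt (2 * uu t)).
Proof.
  intros Ht. assert (P := uu_pos t Ht). assert (B := uu_bound t).
  set (s := sqrt (2 * uu t)). assert (s0 : 0 < s) by (apply sqrt_lt_R0; lra).
  assert (s2 : s * s = 2 * uu t) by (apply sqrt_sqrt; lra).
  set (r := sqrt s). assert (r0 : 0 < r) by now apply sqrt_lt_R0.
  assert (r2 : r * r = s) by (apply sqrt_sqrt; lra).
  assert (S : Rabs (sin t) <= s).
  { rewrite <- sqrt_Rsqr_abs. apply sqrt_le_1_alt. unfold Rsqr.
    assert (E := sin2_cos2 t). unfold Rsqr in E. unfold uu in *. nra. }
  assert (L : Rabs (lw t) * r <= 6).
  { assert (E : lw t = 4 * ln r).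
    { unfold lw. fold (uu t). rewrite <- s2, <- r2, !ln_mult by (try apply Rmult_lt_0_compat; auto). ring. }
    assert (U : lw t <= 3) by now apply lw_le_3.
    assert (V : - ln r <= / r - 1).
    { rewrite <- ln_Rinv by auto. apply ln_le_sub1. now apply Rinv_0_lt_compat. }
    assert (R : r * / r = 1) by (field; lra).
    assert (s <= 2) by nra. assert (r <= 3 / 2) by nra.
    unfold Rabs. destruct (Rcase_abs (lw t)).
    - rewrite E in *. assert (- (4 * ln r) <= 4 * (/ r - 1)) by lra. nra.
    - nra. }
  rewrite Rabs_mult. assert (X := Rabs_pos (lw t)). assert (Y := Rabs_pos (sin t)).
  apply Rle_trans with (s * Rabs (lw t)); [nra|]. rewrite <- r2. nra.
Qed.

Lemma limL_ssu : limL (fun t => sqrt (sqrt (2 * uu t))) 0.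
Proof.
  replace 0 with (sqrt (sqrt (2 * uu PI))).
  2: { unfold uu. rewrite cos_PI. replace (2 * (1 + -1)) with 0 by ring. now rewrite !sqrt_0. }
  apply (limL_continuous (fun t => sqrt (sqrt (2 * uu t)))).
  apply (continuous_comp (fun t => sqrt (2 * uu t)) sqrt).
  - apply (continuous_comp (fun t => 2 * uu t) sqrt).
    + unfold uu. Rcont.
    + apply continuity_pt_filterlim, continuity_pt_sqrt. generalize (uu_bound PI). lra.
  - apply continuity_pt_filterlim, continuity_pt_sqrt. apply sqrt_pos.
Qed.

Lemma limL_sin_lw (f : R -> R) (M : R) : 0 <= M -> (forall t, 0 <= t < PI -> Rabs (f t) <= M) ->
  limL (fun t => f t * (sin t * lw t)) 0.
Proof.
  intros HM H. apply limL_squeeze_0 with (fun t => M * 6 * sqrt (sqrt (2 * uu t))).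
  - intros b Hb. rewrite Rabs_mult, Rmult_assoc.
    apply Rmult_le_compat; auto using Rabs_pos. now apply sin_lw_bound.
  - replace 0 with (M * 6 * 0) by ring. apply limL_scal, limL_ssu.
Qed.

(** [mu n] and [lam n] are the means over [[0, PI]] of [u^n] and [u^n ln (2 u)], [u = 1 + cos]. *)
Fixpoint mu (n : nat) : R :=
  match n with O => 1 | S p => (2 * INR p + 1) / (INR p + 1) * mu p end.

Fixpoint lam (n : nat) : R :=
  match n with
  | O => 0
  | S p => ((2 * INR p + 1) * lam p + 2 * mu p - mu (S p)) / (INR p + 1)
  end.

Lemma sin2_uu t : sin t * sin t = uu t * (2 - uu t).
Proof. unfold uu. assert (E := sin2_cos2 t). unfold Rsqr in E. nra. Qed.

Lemma impR_const : impR (fun _ => 1) PI.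
Proof.
  replace PI with (PI - 0) by ring. apply (impR_derive (fun t => t)).
  - intros t _. auto_derive; auto.
  - intros t _. apply continuous_const.
  - apply (limL_continuous (fun t => t)). apply continuous_id.
Qed.

Lemma is_derive_uu_sin n t :
  is_derive (fun t => uu t ^ n * sin t) t ((INR n + 1) * uu t ^ S n - (2 * INR n + 1) * uu t ^ n).
Proof.
  unfold uu. auto_derive; auto. fold (uu t).
  assert (E := sin2_uu t). destruct n.
  - change (INR 0) with 0. simpl. unfold uu. ring.
  - simpl pred. rewrite S_INR. simpl pow.
    transitivity (- ((INR n + 1) * uu t ^ n * (sin t * sin t)) + uu t * uu t ^ n * cos t); [ring|].
    rewrite E. replace (cos t) with (uu t - 1) by (unfold uu; ring). ring.
Qed.

Lemma impR_mu n : impR (fun t => uu t ^ n) (PI * mu n).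
Proof.
  induction n.
  - simpl. rewrite Rmult_1_r. apply impR_const.
  - assert (N := pos_INR n).
    assert (D : impR (fun t => (INR n + 1) * uu t ^ S n - (2 * INR n + 1) * uu t ^ n) (0 - uu 0 ^ n * sin 0)).
    { apply (impR_derive (fun t => uu t ^ n * sin t)).
      - intros t _. apply is_derive_uu_sin.
      - intros t _. unfold uu. Rcont.
      - replace 0 with (uu PI ^ n * sin PI) by (rewrite sin_PI; ring).
        apply (limL_continuous (fun t => uu t ^ n * sin t)). unfold uu. Rcont. }
    assert (K := impR_scal (/ (INR n + 1)) _ _ (impR_plus _ _ _ _ D (impR_scal (2 * INR n + 1) _ _ IHn))).
    rewrite sin_0 in K.
    replace (/ (INR n + 1) * (0 - uu 0 ^ n * 0 + (2 * INR n + 1) * (PI * mu n))) with (PI * mu (S n)) in K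
      by (simpl; field; lra).
    apply impR_ext with (2 := K). intros t _. field. lra.
Qed.

Lemma impR_lam n : impR (fun t => uu t ^ n * lw t) (PI * lam n).
Proof.
  induction n.
  - simpl. rewrite Rmult_0_r. apply impR_ext with lw; [intros; ring|apply impR_lw].
  - assert (N := pos_INR n).
    (* Integration of the derivative of [u^n sin t ln (2 u)]. The logarithm contributes
       [- u^n sin^2 t / u = - u^n (2 - u)], which is where the plain moments come from. *)
    assert (D : impR (fun t => ((INR n + 1) * uu t ^ S n - (2 * INR n + 1) * uu t ^ n) * lw t
        - uu t ^ n * (2 - uu t)) (0 - uu 0 ^ n * sin 0 * lw 0)).
    { apply (impR_derive (fun t => uu t ^ n * sin t * lw t)).
      - intros t Ht. assert (P := uu_pos t Ht).
        assert (X := is_derive_mult (K := R_AbsRing) _ lw t _ _ (is_derive_uu_sin n t) (lw_derive t P) Rmult_comm).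
        unfold plus, mult in X; simpl in X.
        replace (((INR n + 1) * uu t ^ S n - (2 * INR n + 1) * uu t ^ n) * lw t - uu t ^ n * (2 - uu t))
          with (((INR n + 1) * (uu t * uu t ^ n) - (2 * INR n + 1) * uu t ^ n) * lw t +
            uu t ^ n * sin t * (- sin t / (1 + cos t))); [exact X|].
        fold (uu t). replace (uu t ^ n * sin t * (- sin t / uu t)) with (- (uu t ^ n * (sin t * sin t) / uu t)) by (field; lra).
        rewrite sin2_uu. simpl pow. field. lra.
      - intros t Ht. assert (P := uu_pos t Ht). unfold uu, lw. Rcont. unfold uu in P. lra.
      - apply limL_ext with (fun t => uu t ^ n * (sin t * lw t)); [intros; ring|].
        apply limL_sin_lw with (2 ^ n); [apply pow_le; lra|].
        intros t _. apply uu_pow_bound. }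
    assert (M := impR_plus _ _ _ _ (impR_scal 2 _ _ (impR_mu n)) (impR_scal (-1) _ _ (impR_mu (S n)))).
    assert (K := impR_scal (/ (INR n + 1)) _ _ (impR_plus _ _ _ _ (impR_plus _ _ _ _ D M)
      (impR_scal (2 * INR n + 1) _ _ IHn))).
    rewrite sin_0 in K.
    replace (PI * lam (S n)) with (/ (INR n + 1) * (0 - uu 0 ^ n * 0 * lw 0 +
      (2 * (PI * mu n) + -1 * (PI * mu (S n))) + (2 * INR n + 1) * (PI * lam n)))
      by (change (lam (S n)) with (((2 * INR n + 1) * lam n + 2 * mu n - mu (S n)) / (INR n + 1)); field; lra).
    apply impR_ext with (2 := K). intros t _. simpl pow. field. lra.
Qed.

(** The remainder [tan (t / 2) sin (m t)] as a trigonometric polynomial, which shows that it is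
    regular at [PI] and makes its integral elementary. The recursion is [tan (t / 2) (sin ((m + 1)
    t) + sin (m t)) = cos (m t) - cos ((m + 1) t)]. *)
Fixpoint tansin (m : nat) (t : R) : R :=
  match m with O => 0 | S p => cos (INR p * t) - cos (INR (S p) * t) - tansin p t end.

Lemma tansin_eq m t : 0 <= t < PI -> tansin m t * uu t = sin t * sin (INR m * t).
Proof.
  intros Ht. induction m.
  - change (INR 0 * t) with (0 * t). rewrite (Rmult_0_l t), sin_0. simpl. ring.
  - simpl tansin. rewrite S_INR. rewrite Rmult_minus_distr_r, IHm.
    replace ((INR m + 1) * t) with (INR m * t + t) by ring. rewrite cos_plus, sin_plus.
    set (c := cos (INR m * t)). set (s := sin (INR m * t)).
    assert (E := sin2_uu t). unfold uu in *. apply Rminus_diag_uniq.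
    transitivity (c * ((1 + cos t) * (2 - (1 + cos t)) - sin t * sin t)); [ring|].
    rewrite E; ring.
Qed.

Lemma impR_cos m : (1 <= m)%nat -> impR (fun t => cos (INR m * t)) 0.
Proof.
  intros Hm. assert (P : INR m <> 0) by (apply not_0_INR; lia).
  replace 0 with (sin (INR m * PI) / INR m - sin (INR m * 0) / INR m).
  - apply (impR_derive (fun t => sin (INR m * t) / INR m)).
    + intros t _. auto_derive; auto. field. auto.
    + intros t _. Rcont.
    + apply (limL_continuous (fun t => sin (INR m * t) / INR m)). Rcont.
  - rewrite Rmult_0_r, sin_0. replace (sin (INR m * PI)) with 0; [field; auto|].
    symmetry. clear. induction m; [change (INR 0) with 0; rewrite Rmult_0_l; apply sin_0|].
    rewrite S_INR. replace ((INR m + 1) * PI) with (INR m * PI + PI) by ring.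
    rewrite neg_sin, IHm. ring.
Qed.

(** Unfolding the recursion, only the term [cos 0] has a nonzero integral; each further step changes
    its sign. *)
Lemma impR_tansin m : impR (tansin (S m)) (PI * (-1) ^ m).
Proof.
  induction m.
  - assert (K := impR_plus _ _ _ _ impR_const (impR_scal (-1) _ _ (impR_cos 1 (le_n _)))).
    simpl. replace (PI * 1) with (PI + -1 * 0) by ring.
    apply impR_ext with (2 := K). intros t _. change (INR 0) with 0. rewrite Rmult_0_l, cos_0. ring.
  - assert (K := impR_plus _ _ _ _ (impR_plus _ _ _ _ (impR_cos (S m) ltac:(lia))
      (impR_scal (-1) _ _ (impR_cos (S (S m)) ltac:(lia)))) (impR_scal (-1) _ _ IHm)).
    replace (PI * (-1) ^ S m) with (0 + -1 * 0 + -1 * (PI * (-1) ^ m)) by (simpl; ring).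
    apply impR_ext with (2 := K). intros t _.
    change (tansin (S (S m)) t) with (cos (INR (S m) * t) - cos (INR (S (S m)) * t) - tansin (S m) t). ring.
Qed.

(** * Termwise integration of power series in [1 + cos] *)

Lemma is_series_tail (c d : nat -> R) (l D : R) N :
  is_series c l -> is_series d D -> (forall n, Rabs (c n) <= d n) ->
  Rabs (l - sum_n c N) <= D - sum_n d N.
Proof.
  intros Hc Hd H.
  assert (X : forall (e : nat -> R) (E : R), is_series e E -> is_series (fun k => e (S N + k)%nat) (E - sum_n e N)).
  { intros e E He. apply (is_series_incr_n e (S N)); [lia|]. simpl pred.
    change (is_series e ((E - sum_n e N) + sum_n e N)).
    replace ((E - sum_n e N) + sum_n e N) with E by ring. exact He. }
  apply (Rser_bound _ (fun k => d (S N + k)%nat) _ _ (X _ _ Hc)); auto.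
Qed.

Lemma is_RInt_sum_n (p : nat -> R) (f : nat -> R -> R) (F : nat -> R) (a b : R) N :
  (forall n, is_RInt (f n) a b (F n)) ->
  is_RInt (fun t => sum_n (fun n => p n * f n t) N) a b (sum_n (fun n => p n * F n) N).
Proof.
  intros H. induction N.
  - rewrite sum_O. apply is_RInt_ext with (fun t => p O * f O t); [intros; now rewrite sum_O|].
    apply (is_RInt_scal (V := R_NormedModule)); auto.
  - rewrite sum_Sn. apply is_RInt_ext with (fun t => plus (sum_n (fun n => p n * f n t) N) (p (S N) * f (S N) t));
      [intros; now rewrite sum_Sn|].
    apply (is_RInt_plus (V := R_NormedModule)); auto. apply (is_RInt_scal (V := R_NormedModule)); auto.
Qed.

Lemma limL_sum_n (p : nat -> R) (F : nat -> R -> R) (m : nat -> R) N :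
  (forall n, limL (F n) (m n)) ->
  limL (fun b => sum_n (fun n => p n * F n b) N) (sum_n (fun n => p n * m n) N).
Proof.
  intros H. induction N.
  - rewrite sum_O. apply limL_ext with (fun t => p O * F O t); [intros; now rewrite sum_O|].
    now apply limL_scal.
  - rewrite sum_Sn. apply limL_ext with (fun t => sum_n (fun n => p n * F n t) N + p (S N) * F (S N) t);
      [intros; now rewrite sum_Sn|].
    apply limL_plus; auto. now apply limL_scal.
Qed.

Lemma exptype_continuous p x : exptype p -> continuous (PSeries p) x.
Proof.
  intros Hp. apply continuity_pt_filterlim, PSeries_continuity. now rewrite exptype_CV.
Qed.

(** Since [0 <= u <= 2] and the primitive of the majorant [W] stays below [M], the tail of the
    series contributes at most [M * sum_(n>N) |p n| 2^n] to the integral, uniformly in [b]. The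
    limits [N -> oo] and [b -> PI] may therefore be exchanged. *)
Lemma impR_power (p m : nat -> R) (w W G : R -> R) (M : R) :
  exptype p ->
  (forall t, 0 <= t < PI -> continuous w t) ->
  (forall t, 0 <= t < PI -> Rabs (w t) <= W t) ->
  (forall b, 0 <= b < PI -> is_RInt W 0 b (G b) /\ G b <= M) ->
  (forall n, impR (fun t => uu t ^ n * w t) (m n)) ->
  exists S, is_series (fun n => p n * m n) S /\ impR (fun t => PSeries p (uu t) * w t) S.
Proof.
  intros Hp Hw HW HG Hm.
  assert (PP := PI_RGT_0).
  assert (M0 : 0 <= M).
  { destruct (HG 0 ltac:(lra)) as [G1 G2].
    assert (E : G 0 = 0).
    { apply (is_RInt_inj W 0 0); auto. apply (is_RInt_point (V := R_NormedModule)). }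
    lra. }
  set (F := fun n b => RInt (fun t => uu t ^ n * w t) 0 b).
  assert (HF : forall n, (forall b, 0 <= b < PI -> is_RInt (fun t => uu t ^ n * w t) 0 b (F n b)) /\
    limL (F n) (m n)).
  { intros n. destruct (Hm n) as (F0 & H1 & H2).
    assert (E : forall b, 0 <= b < PI -> F0 b = F n b).
    { intros b Hb. symmetry. apply (is_RInt_unique (V := R_CompleteNormedModule)). now apply H1. }
    split.
    - intros b Hb. rewrite <- E by auto. auto.
    - now apply limL_ext with F0. }
  assert (Dom : ex_series (fun n => Rabs (p n) * 2 ^ n)) by (apply exptype_bound; auto; lra).
  destruct Dom as [D HD].
  assert (HF2 : forall n b, 0 <= b < PI -> Rabs (F n b) <= 2 ^ n * M).
  { intros n b Hb. destruct (HG b Hb) as [G1 G2].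
    apply Rle_trans with (2 ^ n * G b); [|apply Rmult_le_compat_l; auto; apply pow_le; lra].
    apply (norm_RInt_le (V := R_NormedModule) (fun t => uu t ^ n * w t) (fun t => 2 ^ n * W t) 0 b); try lra.
    - intros t Ht. change (Rabs (uu t ^ n * w t) <= 2 ^ n * W t). rewrite Rabs_mult.
      apply Rmult_le_compat; auto using Rabs_pos, uu_pow_bound. apply HW; lra.
    - now apply HF.
    - now apply (is_RInt_scal (V := R_NormedModule)). }
  assert (Hm2 : forall n, Rabs (m n) <= 2 ^ n * M).
  { intros n. apply limL_le_const with (F n); auto. apply HF. }
  assert (EM : forall c : nat -> R, (forall n, Rabs (c n) <= 2 ^ n * M) ->
     exists S, is_series (fun n => p n * c n) S /\ forall N,
       Rabs (S - sum_n (fun n => p n * c n) N) <= (D - sum_n (fun n => Rabs (p n) * 2 ^ n) N) * M).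
  { intros c Hc.
    assert (Bd : forall n, Rabs (p n * c n) <= Rabs (p n) * 2 ^ n * M).
    { intros n. rewrite Rabs_mult, Rmult_assoc. apply Rmult_le_compat_l; auto. apply Rabs_pos. }
    assert (HDM : is_series (fun n => Rabs (p n) * 2 ^ n * M) (D * M)).
    { rewrite Rmult_comm. apply is_series_ext with (2 := Rser_scal M _ _ HD).
      intros n. Req. ring. }
    assert (E : ex_series (fun n => p n * c n)).
    { apply ex_series_dom with (1 := Bd). eexists; apply HDM. }
    destruct E as [S HS]. exists S. split; auto. intros N.
    replace ((D - sum_n (fun n => Rabs (p n) * 2 ^ n) N) * M)
      with (D * M - sum_n (fun n => Rabs (p n) * 2 ^ n * M) N).
    - apply is_series_tail; auto.
    - rewrite Rmult_minus_distr_r. f_equal.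
      rewrite (sum_n_ext _ (fun n => mult (Rabs (p n) * 2 ^ n) M)) by reflexivity.
      now rewrite (sum_n_mult_r (K := R_Ring)). }
  destruct (EM m Hm2) as (S & HS & TS).
  exists S. split; auto.
  assert (Cn : forall t, 0 <= t < PI -> continuous (fun t => PSeries p (uu t) * w t) t).
  { intros t Ht. apply (continuous_mult (K := R_AbsRing) (fun t => PSeries p (uu t)) w); auto.
    apply (continuous_comp uu (PSeries p)); [unfold uu; Rcont|now apply exptype_continuous]. }
  exists (fun b => RInt (fun t => PSeries p (uu t) * w t) 0 b).
  assert (RC : forall b, 0 <= b < PI ->
    is_RInt (fun t => PSeries p (uu t) * w t) 0 b (RInt (fun t => PSeries p (uu t) * w t) 0 b)).
  { intros b Hb. apply (RInt_correct (V := R_CompleteNormedModule)).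
    apply (ex_RInt_continuous (V := R_CompleteNormedModule)). intros t Ht.
    rewrite Rmin_left, Rmax_right in Ht by lra. apply Cn. lra. }
  split; auto. intros eps He.
  assert (Z : exists N, (D - sum_n (fun n => Rabs (p n) * 2 ^ n) N) * M < eps / 4).
  { assert (L : is_lim_seq (fun N => (D - sum_n (fun n => Rabs (p n) * 2 ^ n) N) * M) 0).
    { replace (Finite 0) with (Rbar_mult (D - D) M) by (simpl; f_equal; ring).
      apply is_lim_seq_scal_r. apply is_lim_seq_minus'; [apply is_lim_seq_const|exact HD]. }
    apply is_lim_seq_spec in L. destruct (L (mkposreal (eps / 4) ltac:(lra))) as [N HN].
    exists N. specialize (HN N (le_n _)). simpl in HN. rewrite Rminus_0_r in HN.
    generalize (Rle_abs ((D - sum_n (fun n => Rabs (p n) * 2 ^ n) N) * M)). lra. }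
  destruct Z as [N HN].
  destruct (limL_sum_n p F m N (fun n => proj2 (HF n)) (eps / 4) ltac:(lra)) as (d & Dd & K).
  exists d. split; auto. intros b B1 B2. specialize (K b B1 B2).
  assert (I : Rabs (RInt (fun t => PSeries p (uu t) * w t) 0 b - sum_n (fun n => p n * F n b) N)
     <= (D - sum_n (fun n => Rabs (p n) * 2 ^ n) N) * M).
  (* The tail [T] is nonnegative because it dominates the tail of the series at the point 0. *)
  { set (T := D - sum_n (fun n => Rabs (p n) * 2 ^ n) N) in *.
    assert (T0 : 0 <= T).
    { assert (X := is_series_tail _ _ _ _ N (exptype_PSeries p 0 Hp) HD).
      eapply Rle_trans; [apply Rabs_pos|apply X]. intros n. rewrite Rabs_mult.
      apply Rmult_le_compat_l; [apply Rabs_pos|]. rewrite <- RPow_abs, Rabs_R0. apply pow_incr. lra. }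
    destruct (HG b B1) as [G1 G2].
    apply Rle_trans with (T * G b); [|apply Rmult_le_compat_l; auto].
    apply (norm_RInt_le (V := R_NormedModule) (fun t => PSeries p (uu t) * w t - sum_n (fun n => p n * (uu t ^ n * w t)) N)
      (fun t => T * W t) 0 b); try lra.
    - intros t Ht. change (Rabs (PSeries p (uu t) * w t - sum_n (fun n => p n * (uu t ^ n * w t)) N) <= T * W t).
      replace (sum_n (fun n => p n * (uu t ^ n * w t)) N) with (sum_n (fun n => p n * uu t ^ n) N * w t).
      2: { rewrite (sum_n_ext (fun n => p n * (uu t ^ n * w t)) (fun n => mult (p n * uu t ^ n) (w t))).
           - now rewrite (sum_n_mult_r (K := R_Ring)).
           - intros n. unfold mult; simpl. Req. ring. }
      rewrite <- Rmult_minus_distr_r, Rabs_mult.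
      apply Rmult_le_compat; auto using Rabs_pos; [|apply HW; lra].
      apply is_series_tail; auto; [now apply exptype_PSeries|].
      intros n. rewrite Rabs_mult. apply Rmult_le_compat_l; auto using Rabs_pos, uu_pow_bound.
    - apply (is_RInt_minus (V := R_NormedModule)); auto.
      apply is_RInt_sum_n. intros n. now apply HF.
    - now apply (is_RInt_scal (V := R_NormedModule)). }
  specialize (TS N).
  set (x := RInt (fun t => PSeries p (uu t) * w t) 0 b) in *.
  set (y := sum_n (fun n => p n * F n b) N) in *. set (y' := sum_n (fun n => p n * m n) N) in *.
  replace (x - S) with ((x - y) + ((y - y') + - (S - y'))) by ring.
  eapply Rle_lt_trans; [apply Rabs_triang|].
  eapply Rle_lt_trans; [apply Rplus_le_compat_l, Rabs_triang|]. rewrite Rabs_Ropp. lra.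
Qed.

Lemma impR_power_1 (p : nat -> R) : exptype p ->
  exists S, is_series (fun n => p n * (PI * mu n)) S /\ impR (fun t => PSeries p (uu t)) S.
Proof.
  intros Hp. destruct (impR_power p (fun n => PI * mu n) (fun _ => 1) (fun _ => 1) (fun b => 1 * b) PI) as (S & H1 & H2); auto.
  - intros t _. apply continuous_const.
  - intros t _. rewrite Rabs_R1. lra.
  - intros b Hb. split; [apply is_RInt_cst|lra].
  - intros n. apply impR_ext with (2 := impR_mu n). intros; ring.
  - exists S. split; auto. apply impR_ext with (2 := H2). intros; ring.
Qed.

Lemma impR_power_lw (p : nat -> R) : exptype p ->
  exists S, is_series (fun n => p n * (PI * lam n)) S /\ impR (fun t => PSeries p (uu t) * lw t) S.
Proof.
  intros Hp. destruct Alw_bounded as [M HM].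
  (* As [lw <= 3], the function [6 - lw] majorizes [|lw|]; unlike [|lw|] it has the explicit
     primitive [6 b - Alw b]. *)
  apply (impR_power p (fun n => PI * lam n) lw (fun t => 6 - lw t) (fun b => 6 * b - Alw b) (6 * PI + M)); auto.
  - intros t Ht. now apply lw_continuous, one_cos_pos.
  - intros t Ht. assert (L := lw_le_3 t Ht). unfold Rabs. destruct (Rcase_abs (lw t)); lra.
  - intros b Hb. split.
    + apply (is_RInt_minus (V := R_NormedModule)); [apply is_RInt_cst|now apply Alw_correct].
    + specialize (HM b Hb). apply Rabs_le_between in HM. lra.
  - intros n. apply impR_lam.
Qed.

(** * Coefficient sequences *)

(** Coefficients of [e^x] times the power series with coefficients [a]. *)
Definition emul (a : nat -> R) : nat -> R := conv invfact a.
(** On generating functions this is the Euler operator [x d/dx], and [ashift] is multiplication by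
    [x]. *)
Definition theta (a : nat -> R) (n : nat) : R := INR n * a n.
Definition ashift (a : nat -> R) (n : nat) : R := match n with O => 0 | S p => a p end.

Lemma emul_0 a : emul a 0 = a 0%nat.
Proof. unfold emul, conv, invfact. simpl. change (INR 1) with 1. field. Qed.

Lemma emul_ext a b n : (forall k, a k = b k) -> emul a n = emul b n.
Proof. intros H. unfold emul, conv. apply sum_eq. intros i _. now rewrite H. Qed.

Lemma emul_plus a b n : emul (fun k => a k + b k) n = emul a n + emul b n.
Proof.
  unfold emul, conv. rewrite <- plus_sum. apply sum_eq. intros i _. ring.
Qed.

Lemma emul_scal c a n : emul (fun k => c * a k) n = c * emul a n.
Proof.
  unfold emul, conv. rewrite scal_sum. apply sum_eq. intros i _. ring.
Qed.

Lemma emul_shift a n : emul (ashift a) (S n) = emul a n.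
Proof.
  unfold emul, conv. rewrite tech5, Nat.sub_diag. unfold ashift at 2. rewrite Rmult_0_r, Rplus_0_r.
  apply sum_eq. intros i Hi. replace (S n - i)%nat with (S (n - i)) by lia. reflexivity.
Qed.

Lemma emul_theta a n : INR (S n) * emul a (S n) = emul (theta a) (S n) + emul a n.
Proof.
  unfold emul, conv.
  transitivity (sum_f_R0 (fun k => INR k * invfact k * a (S n - k)%nat) (S n)
    + sum_f_R0 (fun k => invfact k * theta a (S n - k)) (S n)).
  - rewrite scal_sum, <- plus_sum. apply sum_eq. intros i Hi. unfold theta.
    rewrite minus_INR by auto. ring.
  - rewrite Rplus_comm. f_equal. rewrite decomp_sum by lia.
    change (INR 0) with 0. rewrite !Rmult_0_l, Rplus_0_l. simpl pred.
    apply sum_eq. intros i Hi. now rewrite invfact_S.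
Qed.

(** Coefficient form of applying [(x d/dx)^2] to [e^x A], with [x e^x theta A] eliminated by the
    first-order rule. If [theta^2 A = x^2 A], the last two terms cancel and a two-term recurrence is
    left. *)
Lemma emul_theta2 a n : INR (S n) ^ 2 * emul a (S n) =
  (2 * INR n + 1) * emul a n - emul (ashift a) n + emul (theta (theta a)) (S n).
Proof.
  assert (H1 := emul_theta a n). assert (H2 := emul_theta (theta a) n).
  assert (H3 : emul (theta a) n = INR n * emul a n - emul (ashift a) n).
  { destruct n.
    - rewrite !emul_0. unfold theta, ashift. change (INR 0) with 0. ring.
    - rewrite emul_shift. generalize (emul_theta a n). lra. }
  rewrite S_INR in *. nra.
Qed.

(** Coefficients of [I_0 (x)] and of [sum_k H_k (x / 2)^(2 k) / k!^2]. *)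
Fixpoint besI (n : nat) : R :=
  match n with
  | O => 1
  | S O => 0
  | S (S p) => besI p / INR (S (S p)) ^ 2
  end.

Fixpoint hbesI (n : nat) : R :=
  match n with
  | S (S p) => (hbesI p + 2 * INR (S (S p)) * besI (S (S p))) / INR (S (S p)) ^ 2
  | _ => 0
  end.

Lemma two_step_ind (P : nat -> Prop) :
  P O -> P 1%nat -> (forall n, P n -> P (S (S n))) -> forall n, P n.
Proof.
  intros H0 H1 H. assert (X : forall n, P n /\ P (S n)) by (induction n; intuition auto).
  intros n; apply X.
Qed.

Lemma besI_SS n : INR (S (S n)) ^ 2 * besI (S (S n)) = besI n.
Proof.
  change (besI (S (S n))) with (besI n / INR (S (S n)) ^ 2). field. apply not_0_INR; lia.
Qed.

Lemma hbesI_SS n : INR (S (S n)) ^ 2 * hbesI (S (S n)) = hbesI n + 2 * theta besI (S (S n)).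
Proof.
  unfold theta.
  change (hbesI (S (S n))) with ((hbesI n + 2 * INR (S (S n)) * besI (S (S n))) / INR (S (S n)) ^ 2).
  field. apply not_0_INR; lia.
Qed.

(** The modified Bessel equation of order 0, read on coefficients. *)
Lemma theta2_besI n : theta (theta besI) n = ashift (ashift besI) n.
Proof.
  destruct n as [|[|n]]; [change (0 * (0 * 1) = 0); ring|change (INR 1 * (INR 1 * 0) = 0); ring|].
  change (theta (theta besI) (S (S n)) = besI n). unfold theta.
  rewrite <- (besI_SS n). ring.
Qed.

(** The same equation with a source: the increment [H_k - H_(k-1) = 1 / k] leaves [2 theta besI]. *)
Lemma theta2_hbesI n : theta (theta hbesI) n = ashift (ashift hbesI) n + 2 * theta besI n.
Proof.
  destruct n as [|[|n]].
  - change (0 * (0 * 0) = 0 + 2 * (0 * 1)). ring.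
  - change (INR 1 * (INR 1 * 0) = 0 + 2 * (INR 1 * 0)). ring.
  - change (ashift (ashift hbesI) (S (S n))) with (hbesI n).
    rewrite <- (hbesI_SS n). unfold theta. ring.
Qed.

(** Coefficient form of [e^x I_0 (x)] being the mean of [e^(x u)]: the cancellation in [emul_theta2]
    gives the recurrence of [mu]. *)
Lemma emul_besI n : emul besI n = mu n * invfact n.
Proof.
  induction n.
  - rewrite emul_0. unfold invfact. simpl. change (INR 1) with 1. field.
  - assert (H := emul_theta2 besI n).
    rewrite (emul_ext (theta (theta besI)) (ashift (ashift besI))) in H by apply theta2_besI.
    rewrite emul_shift, IHn, <- (invfact_S n), S_INR in H.
    assert (P := pos_INR n). simpl mu.
    apply Rmult_eq_reg_l with ((INR n + 1) ^ 2); [|apply pow_nonzero; lra].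
    transitivity ((2 * INR n + 1) * (mu n * ((INR n + 1) * invfact (S n)))); [lra|field; lra].
Qed.

(** The source term of [theta2_hbesI] becomes, through [emul_theta], a difference of plain moments.
    It accounts both for the inhomogeneity in the recurrence of [lam] and for the increments of
    [harm]. *)
Lemma emul_hbesI n : emul hbesI n = (harm n * mu n - lam n) * invfact n.
Proof.
  induction n.
  - rewrite emul_0. simpl. ring.
  - assert (H := emul_theta2 hbesI n).
    rewrite (emul_ext (theta (theta hbesI)) (fun n => ashift (ashift hbesI) n + 2 * theta besI n)) in H
      by apply theta2_hbesI.
    rewrite emul_plus, emul_scal, emul_shift, IHn in H.
    assert (K := emul_theta besI n). rewrite !emul_besI in K.
    replace (emul (theta besI) (S n)) with (INR (S n) * (mu (S n) * invfact (S n)) - mu n * invfact n) in H by lra.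
    rewrite <- (invfact_S n) in H. rewrite S_INR in H. assert (P := pos_INR n).
    rewrite harm_S, S_INR.
    change (lam (S n)) with (((2 * INR n + 1) * lam n + 2 * mu n - mu (S n)) / (INR n + 1)).
    apply Rmult_eq_reg_l with ((INR n + 1) ^ 2); [|apply pow_nonzero; lra].
    transitivity ((2 * INR n + 1) * ((harm n * mu n - lam n) * ((INR n + 1) * invfact (S n))) +
      2 * ((INR n + 1) * (mu (S n) * invfact (S n)) - mu n * ((INR n + 1) * invfact (S n)))); [lra|].
    simpl mu. field. lra.
Qed.

Lemma besI_even k : besI (2 * k) = (/ 4) ^ k * (invfact k * invfact k).
Proof.
  induction k; [unfold invfact; simpl; change (INR 1) with 1; field|].
  replace (2 * S k)%nat with (S (S (2 * k))) by lia.
  change (besI (S (S (2 * k)))) with (besI (2 * k) / INR (S (S (2 * k))) ^ 2).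
  rewrite IHk. rewrite <- (invfact_S k). rewrite !S_INR, mult_INR. change (INR 2) with (1 + 1).
  assert (P := pos_INR k). simpl. field. lra.
Qed.

Lemma besI_odd k : besI (2 * k + 1) = 0.
Proof.
  induction k; [reflexivity|].
  replace (2 * S k + 1)%nat with (S (S (2 * k + 1))) by lia.
  change (besI (S (S (2 * k + 1)))) with (besI (2 * k + 1) / INR (S (S (2 * k + 1))) ^ 2).
  rewrite IHk. unfold Rdiv. ring.
Qed.

Lemma hbesI_even k : hbesI (2 * k) = harm k * besI (2 * k).
Proof.
  induction k; [simpl; ring|].
  replace (2 * S k)%nat with (S (S (2 * k))) by lia.
  assert (E := hbesI_SS (2 * k)). rewrite IHk, <- (besI_SS (2 * k)) in E. unfold theta in E.
  rewrite harm_S.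
  assert (N : INR (S (S (2 * k))) = 2 * INR (S k)).
  { rewrite !S_INR, mult_INR. change (INR 2) with (1 + 1). ring. }
  assert (P : INR (S k) <> 0) by (apply not_0_INR; lia).
  set (j := besI (S (S (2 * k)))) in *.
  apply Rmult_eq_reg_l with (INR (S (S (2 * k))) ^ 2); [|rewrite N; apply pow_nonzero; lra].
  rewrite E, N. field. auto.
Qed.

Lemma hbesI_odd k : hbesI (2 * k + 1) = 0.
Proof.
  induction k; [reflexivity|].
  replace (2 * S k + 1)%nat with (S (S (2 * k + 1))) by lia.
  change (hbesI (S (S (2 * k + 1)))) with
    ((hbesI (2 * k + 1) + 2 * INR (S (S (2 * k + 1))) * besI (S (S (2 * k + 1)))) / INR (S (S (2 * k + 1))) ^ 2).
  rewrite IHk. replace (S (S (2 * k + 1))) with (2 * S k + 1)%nat by lia. rewrite besI_odd. unfold Rdiv. ring.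
Qed.

Lemma besI_bound n : 0 <= besI n <= invfact n.
Proof.
  induction n using two_step_ind; [unfold invfact; simpl; change (INR 1) with 1; lra| |].
  - simpl. generalize (invfact_pos 1). lra.
  - destruct IHn as [A B]. assert (P : 0 < INR (S (S n))) by (apply lt_0_INR; lia).
    assert (I := invfact_pos (S (S n))).
    rewrite <- (besI_SS n) in A, B. rewrite <- (invfact_S n), <- (invfact_S (S n)) in B.
    rewrite (S_INR (S n)) in *. set (k := INR (S n)) in *.
    assert (k0 : 0 < k) by (apply lt_0_INR; lia).
    assert (P2 : 0 < (k + 1) ^ 2) by (apply pow_lt; lra). nra.
Qed.

Lemma INR_le_pow2 n : INR n <= 2 ^ n.
Proof.
  induction n; [change (INR 0) with 0; simpl; lra|]. rewrite S_INR. simpl.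
  assert (1 <= 2 ^ n) by (apply pow_R1_Rle; lra). lra.
Qed.

Lemma exptype_theta a : exptype a -> exptype (theta a).
Proof.
  intros H. apply (exptype_le a _ 1 2); auto; try lra. intros n. unfold theta.
  rewrite Rabs_mult, (Rabs_pos_eq (INR n)) by apply pos_INR.
  apply Rmult_le_compat_r; [apply Rabs_pos|]. generalize (INR_le_pow2 n). lra.
Qed.

Lemma exptype_besI : exptype besI.
Proof.
  apply (exptype_le invfact _ 1 1); try lra; [apply exptype_invfact|]. intros n.
  assert (H := besI_bound n). rewrite pow1, !Rabs_pos_eq; lra.
Qed.

Lemma hbesI_bound n : 0 <= hbesI n <= INR n * besI n.
Proof.
  destruct (Nat.Even_or_Odd n) as [[k ->]|[k ->]].
  - rewrite hbesI_even. assert (H := harm_bound k). assert (I := besI_bound (2 * k)).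
    rewrite mult_INR. change (INR 2) with 2. split; [apply Rmult_le_pos; lra|].
    apply Rmult_le_compat_r; lra.
  - rewrite hbesI_odd, besI_odd. lra.
Qed.

Lemma exptype_hbesI : exptype hbesI.
Proof.
  apply (exptype_le (theta besI) _ 1 1); try lra; [apply exptype_theta, exptype_besI|]. intros n.
  assert (H := hbesI_bound n). unfold theta. rewrite pow1, !Rabs_pos_eq; lra.
Qed.

(** A shift turns [1 / n!] into [1 / (n - 1)!]; the lost factor [n] is absorbed by [2^n]. *)
Lemma exptype_shift a : exptype a -> exptype (ashift a).
Proof.
  intros (A & K & HA & HK & H). exists A, (2 * (K + 1)). repeat split; try lra.
  intros [|n]; simpl ashift.
  - rewrite Rabs_R0. simpl. change (INR 1) with 1. lra.
  - eapply Rle_trans; [apply H|].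
    assert (F := INR_fact_lt_0 n). assert (F' := INR_fact_lt_0 (S n)).
    apply Rle_trans with (A * (K + 1) ^ n / INR (fact n)).
    + unfold Rdiv. apply Rmult_le_compat_r; [left; now apply Rinv_0_lt_compat|].
      apply Rmult_le_compat_l; auto. apply pow_incr; lra.
    + rewrite Rpow_mult_distr, fact_simpl, mult_INR.
      assert (N := INR_le_pow2 (S n)). assert (P : 0 < INR (S n)) by (apply lt_0_INR; lia).
      apply Rmult_le_reg_r with (INR (S n) * INR (fact n)); [nra|].
      replace (A * (K + 1) ^ n / INR (fact n) * (INR (S n) * INR (fact n))) with (INR (S n) * (A * (K + 1) ^ n))
        by (field; lra).
      replace (A * (2 ^ S n * (K + 1) ^ S n) / (INR (S n) * INR (fact n)) * (INR (S n) * INR (fact n)))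
        with (2 ^ S n * (A * ((K + 1) * (K + 1) ^ n))) by (simpl; field; lra).
      assert (Q : 0 <= (K + 1) ^ n) by (apply pow_le; lra).
      assert (0 <= A * (K + 1) ^ n) by now apply Rmult_le_pos.
      apply Rmult_le_compat; nra.
Qed.

Definition hexp (n : nat) : R := harm n * invfact n.

Lemma exptype_hexp : exptype hexp.
Proof.
  apply (exptype_le (theta invfact) _ 1 1); try lra; [apply exptype_theta, exptype_invfact|].
  intros n. unfold hexp, theta. rewrite pow1, !Rabs_mult.
  assert (H := harm_bound n). rewrite !(Rabs_pos_eq (harm n)), !(Rabs_pos_eq (INR n)) by lra.
  generalize (Rabs_pos (invfact n)); nra.
Qed.

(** Coefficients of the entire part [sum_(n>=1) (-y)^n / (n n!)] of the exponential integral. *)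
Definition einc (n : nat) : R := match n with O => 0 | S p => (-1) ^ n * invfact n / INR n end.

Lemma exptype_einc : exptype einc.
Proof.
  apply (exptype_le invfact _ 1 1); try lra; [apply exptype_invfact|].
  intros [|n]; rewrite pow1.
  - simpl. rewrite Rabs_R0. generalize (Rabs_pos (invfact 0)). lra.
  - unfold einc, Rdiv. rewrite !Rabs_mult, pow_1_abs.
    assert (P : 1 <= INR (S n)) by (rewrite S_INR; generalize (pos_INR n); lra).
    rewrite (Rabs_pos_eq (/ INR (S n))) by (left; apply Rinv_0_lt_compat; lra).
    assert (/ INR (S n) <= 1) by (rewrite <- Rinv_1; apply Rinv_le_contravar; lra).
    generalize (Rabs_pos (invfact (S n))). nra.
Qed.

Definition altexp (n : nat) : R := (-1) ^ n * invfact n.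

Lemma emul_altexp n : emul altexp (S n) = 0.
Proof.
  assert (H := emul_theta altexp n).
  rewrite (emul_ext (theta altexp) (fun k => (-1) * ashift altexp k)) in H.
  - rewrite emul_scal, emul_shift in H.
    assert (P : INR (S n) <> 0) by (apply not_0_INR; lia).
    apply Rmult_eq_reg_l with (INR (S n)); auto. lra.
  - intros [|k]; unfold theta, ashift, altexp; [change (INR 0) with 0; ring|].
    rewrite <- (invfact_S k). simpl. ring.
Qed.

(** The series [E] of [einc] satisfies [x E' = e^(-x) - 1], so that [e^x E] satisfies
    [x F' = x F + 1 - e^x]. This is the recurrence of [- H_n / n!]. *)
Lemma emul_einc n : emul einc n = - hexp n.
Proof.
  induction n.
  - rewrite emul_0. unfold hexp. simpl. ring.
  - assert (H := emul_theta einc n). rewrite IHn in H.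
    rewrite (emul_ext (theta einc) (fun k => altexp k + (-1) * (match k with O => 1 | _ => 0 end))) in H.
    + rewrite emul_plus, emul_scal, emul_altexp in H.
      assert (D : emul (fun k => match k with O => 1 | _ => 0 end) (S n) = invfact (S n)).
      { unfold emul, conv. rewrite tech5, Nat.sub_diag.
        rewrite (sum_eq _ (fun _ => 0)); [rewrite sum_cte; ring|].
        intros i Hi. replace (S n - i)%nat with (S (n - i)) by lia. ring. }
      rewrite D in H. unfold hexp in *.
      assert (K := harm_invfact_S n).
      assert (P : INR (S n) <> 0) by (apply not_0_INR; lia).
      apply Rmult_eq_reg_l with (INR (S n)); auto. lra.
    + intros [|k]; unfold theta, altexp, einc.
      * unfold invfact. simpl. change (INR 0) with 0. change (INR 1) with 1. field.
      * field. apply not_0_INR; lia.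
Qed.

(** * The two base integrals *)

Open Scope C_scope.

Definition impC (f : R -> C) (l : C) : Prop :=
  impR (fun t => Re (f t)) (Re l) /\ impR (fun t => Im (f t)) (Im l).

Lemma impC_ext f g l : (forall t, (0 <= t < PI)%R -> f t = g t) -> impC f l -> impC g l.
Proof.
  intros H [H1 H2]. split.
  - apply impR_ext with (2 := H1). intros t Ht. now rewrite H.
  - apply impR_ext with (2 := H2). intros t Ht. now rewrite H.
Qed.

Lemma impC_plus f g l m : impC f l -> impC g m -> impC (fun t => f t + g t) (l + m).
Proof.
  intros [H1 H2] [H3 H4]. split.
  - exact (impR_plus _ _ _ _ H1 H3).
  - exact (impR_plus _ _ _ _ H2 H4).
Qed.

Lemma impC_scal (c : C) f l : impC f l -> impC (fun t => c * f t) (c * l).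
Proof.
  intros [H1 H2]. split.
  - assert (K := impR_plus _ _ _ _ (impR_scal (Re c) _ _ H1) (impR_scal (- Im c) _ _ H2)).
    rewrite Re_mult. replace (Re c * Re l - Im c * Im l)%R with (Re c * Re l + - Im c * Im l)%R by ring.
    apply impR_ext with (2 := K). intros t _. rewrite Re_mult. ring.
  - assert (K := impR_plus _ _ _ _ (impR_scal (Re c) _ _ H2) (impR_scal (Im c) _ _ H1)).
    exact K.
Qed.

Lemma impC_eq f l m : impC f l -> l = m -> impC f m.
Proof. now intros H <-. Qed.

Lemma impC_RtoC (f : R -> R) (l : R) : impR f l -> impC (fun t => RtoC (f t)) l.
Proof.
  intros H. split; [exact H|]. simpl.
  replace 0%R with (0 * l)%R by ring. apply impR_ext with (2 := impR_scal 0 _ _ H). intros; simpl; ring.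
Qed.

Lemma is_Cser_coef (a w : nat -> R) (x : C) (S1 S2 : R) :
  is_series (fun n => a n * Re (x ^ n) * (PI * w n))%R S1 ->
  is_series (fun n => a n * Im (x ^ n) * (PI * w n))%R S2 ->
  exists S, is_Cser (fun n => (a n * w n)%R * x ^ n) S /\ (S1, S2) = PI * S.
Proof.
  intros H1 H2. assert (PP := PI_neq0).
  exists ((S1 / PI)%R, (S2 / PI)%R). split.
  - split.
    + change (is_series (fun n => Re ((a n * w n)%R * x ^ n)) (S1 / PI)%R).
      replace (S1 / PI)%R with (/ PI * S1)%R by (field; auto).
      apply is_series_ext with (2 := Rser_scal (/ PI) _ _ H1).
      intros n. rewrite Re_RtoC_mult. Req. field. auto.
    + change (is_series (fun n => Im ((a n * w n)%R * x ^ n)) (S2 / PI)%R).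
      replace (S2 / PI)%R with (/ PI * S2)%R by (field; auto).
      apply is_series_ext with (2 := Rser_scal (/ PI) _ _ H2).
      intros n. rewrite Im_RtoC_mult. Req. field. auto.
  - apply C_ext; rewrite ?Re_RtoC_mult, ?Im_RtoC_mult; simpl; field; auto.
Qed.

Lemma impC_CPS (a : nat -> R) (x : C) : exptype a ->
  exists S, is_Cser (fun n => (a n * mu n)%R * x ^ n) S /\
    impC (fun t => CPS a (x * uu t)) (PI * S).
Proof.
  intros Ha.
  destruct (impR_power_1 _ (exptype_Re a x Ha)) as (S1 & H1 & K1).
  destruct (impR_power_1 _ (exptype_Im a x Ha)) as (S2 & H2 & K2).
  destruct (is_Cser_coef a mu x S1 S2 H1 H2) as (S & HS & E).
  exists S. split; auto. rewrite <- E. split.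
  - apply impR_ext with (2 := K1). intros t _. now rewrite CPS_Re.
  - apply impR_ext with (2 := K2). intros t _. now rewrite CPS_Im.
Qed.

Lemma impC_CPS_lw (a : nat -> R) (x : C) : exptype a ->
  exists S, is_Cser (fun n => (a n * lam n)%R * x ^ n) S /\
    impC (fun t => lw t * CPS a (x * uu t)) (PI * S).
Proof.
  intros Ha.
  destruct (impR_power_lw _ (exptype_Re a x Ha)) as (S1 & H1 & K1).
  destruct (impR_power_lw _ (exptype_Im a x Ha)) as (S2 & H2 & K2).
  destruct (is_Cser_coef a lam x S1 S2 H1 H2) as (S & HS & E).
  exists S. split; auto. rewrite <- E. split.
  - apply impR_ext with (2 := K1). intros t _. rewrite Re_RtoC_mult, CPS_Re. ring.
  - apply impR_ext with (2 := K2). intros t _. rewrite Im_RtoC_mult, CPS_Im. ring.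
Qed.

Lemma CPS_shift a y : exptype a -> CPS (ashift a) y = y * CPS a y.
Proof.
  intros Ha. apply is_Cser_unique.
  replace (y * CPS a y) with (y * CPS a y + ashift a 0 * y ^ 0) by (simpl; ring).
  apply (is_Cser_decr (fun n => ashift a n * y ^ n)).
  apply is_Cser_ext with (2 := is_Cser_scal y _ _ (CPS_correct a y Ha)).
  intros n. simpl. ring.
Qed.

(* [e^y (Gamma (0, y) - i PI / 2)] at [y = x u], rid of the exponential integral by
   [e^y sum_(n>=1) (-y)^n / (n n!) = - sum_n H_n y^n / n!]. *)
Definition gker (kappa x : C) (t : R) : C :=
  kappa * CPS invfact (x * uu t) + CPS hexp (x * uu t) - lw t * CPS invfact (x * uu t).

Lemma impC_gker (kappa x : C) :
  impC (gker kappa x) (PI * (Cexp x * (kappa * CPS besI x + CPS hbesI x))).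
Proof.
  destruct (impC_CPS invfact x exptype_invfact) as (S1 & H1 & K1).
  destruct (impC_CPS hexp x exptype_hexp) as (S2 & H2 & K2).
  destruct (impC_CPS_lw invfact x exptype_invfact) as (S3 & H3 & K3).
  assert (E1 : S1 = Cexp x * CPS besI x).
  { rewrite Cexp_CPS. apply is_Cser_inj with (1 := H1).
    apply CPS_conv; auto using exptype_invfact, exptype_besI.
    intros n. rewrite (Rmult_comm (invfact n)). apply emul_besI. }
  (* The harmonic and the logarithmic sums are evaluated together: [emul_hbesI] only knows the
     combination [harm n * mu n - lam n]. *)
  assert (E2 : S2 - S3 = Cexp x * CPS hbesI x).
  { rewrite Cexp_CPS. apply is_Cser_inj with (1 := is_Cser_minus _ _ _ _ H2 H3).
    apply is_Cser_ext with (fun n => emul hbesI n * x ^ n).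
    - intros n. rewrite emul_hbesI. unfold hexp. rewrite !RtoC_mult, RtoC_minus, !RtoC_mult. ring.
    - apply CPS_conv; auto using exptype_invfact, exptype_hbesI. }
  assert (K := impC_plus _ _ _ _ (impC_plus _ _ _ _ (impC_scal kappa _ _ K1) K2) (impC_scal (- (1)) _ _ K3)).
  eapply impC_eq; [apply impC_ext with (2 := K)|].
  - intros t _. unfold gker. ring.
  - transitivity (PI * (kappa * S1 + (S2 - S3))); [ring|]. rewrite E1, E2. ring.
Qed.

Lemma emul_theta_all a n : (INR n * emul a n = emul (theta a) n + ashift (emul a) n)%R.
Proof.
  destruct n.
  - rewrite !emul_0. unfold theta. simpl. change (INR 0) with 0%R. ring.
  - rewrite emul_theta. reflexivity.
Qed.

Lemma is_Cser_theta_emul a x : exptype a ->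
  is_Cser (fun n => (INR n * emul a n)%R * x ^ n) (Cexp x * CPS (theta a) x + x * (Cexp x * CPS a x)).
Proof.
  intros Ha.
  assert (H1 : is_Cser (fun n => emul (theta a) n * x ^ n) (Cexp x * CPS (theta a) x)).
  { rewrite Cexp_CPS. apply CPS_conv; auto using exptype_invfact, exptype_theta. }
  assert (H2 : is_Cser (fun n => ashift (emul a) n * x ^ n) (x * (Cexp x * CPS a x))).
  { replace (x * (Cexp x * CPS a x)) with (x * (Cexp x * CPS a x) + ashift (emul a) 0 * x ^ 0) by (simpl; ring).
    apply (is_Cser_decr (fun n => ashift (emul a) n * x ^ n)).
    assert (H3 : is_Cser (fun n => emul a n * x ^ n) (Cexp x * CPS a x)).
    { rewrite Cexp_CPS. apply CPS_conv; auto using exptype_invfact. }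
    apply is_Cser_ext with (2 := is_Cser_scal x _ _ H3). intros n. simpl. ring. }
  apply is_Cser_ext with (2 := is_Cser_plus _ _ _ _ H1 H2).
  intros n. rewrite emul_theta_all, RtoC_plus. ring.
Qed.

(** Serves [m = 1] through [cos t = u - 1]. Multiplication by [x u] shifts the coefficients, which
    amounts to the factor [n] of the Euler operator, except that
    [H_(n-1) / (n-1)! = n H_n / n! - 1 / n!] leaves the correction [e^x I_0 (x) - 1]. *)
Lemma impC_u_gker (kappa x : C) :
  impC (fun t => x * uu t * gker kappa x t)
    (PI * (Cexp x * (kappa * (CPS (theta besI) x + x * CPS besI x)
      + (CPS (theta hbesI) x + x * CPS hbesI x) - CPS besI x) + 1)).
Proof.
  destruct (impC_CPS _ x (exptype_shift _ exptype_invfact)) as (S1 & H1 & K1).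
  destruct (impC_CPS _ x (exptype_shift _ exptype_hexp)) as (S2 & H2 & K2).
  destruct (impC_CPS_lw _ x (exptype_shift _ exptype_invfact)) as (S3 & H3 & K3).
  assert (Q1 : forall n, ashift invfact n = (INR n * invfact n)%R).
  { intros [|n]; [simpl; change (INR 0) with 0%R; ring|]. now rewrite invfact_S. }
  assert (Hi : is_Cser (fun n => emul besI n * x ^ n) (Cexp x * CPS besI x)).
  { rewrite Cexp_CPS. apply CPS_conv; auto using exptype_invfact, exptype_besI. }
  (* The correction [- 1 / n!] occurs for [n >= 1] only, hence the series without its constant
     term. *)
  assert (Hi' : is_Cser (fun n => match n with O => 0 | S _ => emul besI n * x ^ n end) (Cexp x * CPS besI x - 1)).
  { replace (Cexp x * CPS besI x - 1) with (Cexp x * CPS besI x - emul besI 0 * x ^ 0 + 0).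
    - apply (is_Cser_decr (fun n => match n with O => 0 | S _ => emul besI n * x ^ n end)).
      now apply (is_Cser_incr (fun n => emul besI n * x ^ n)).
    - rewrite emul_0. simpl. ring. }
  assert (E1 : S1 = Cexp x * CPS (theta besI) x + x * (Cexp x * CPS besI x)).
  { apply is_Cser_inj with (1 := H1).
    apply is_Cser_ext with (2 := is_Cser_theta_emul besI x exptype_besI).
    intros n. f_equal. f_equal. rewrite Q1, emul_besI. ring. }
  assert (E2 : S2 - S3 = Cexp x * CPS (theta hbesI) x + x * (Cexp x * CPS hbesI x) - (Cexp x * CPS besI x - 1)).
  { apply is_Cser_inj with (1 := is_Cser_minus _ _ _ _ H2 H3).
    apply is_Cser_ext with (2 := is_Cser_minus _ _ _ _ (is_Cser_theta_emul hbesI x exptype_hbesI) Hi').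
    intros [|n].
    - simpl. change (INR 0) with 0%R. rewrite !Rmult_0_l. ring.
    - rewrite emul_hbesI, emul_besI, Q1. change (ashift hexp (S n)) with (hexp n).
      unfold hexp. replace (harm n * invfact n)%R with (INR (S n) * (harm (S n) * invfact (S n)) - invfact (S n))%R
        by (generalize (harm_invfact_S n); lra).
      rewrite !RtoC_mult, !RtoC_minus, !RtoC_mult. ring. }
  assert (K := impC_plus _ _ _ _ (impC_plus _ _ _ _ (impC_scal kappa _ _ K1) K2) (impC_scal (- (1)) _ _ K3)).
  eapply impC_eq; [apply impC_ext with (2 := K)|].
  - intros t _. unfold gker. rewrite !CPS_shift by auto using exptype_invfact, exptype_hexp. ring.
  - transitivity (PI * (kappa * S1 + (S2 - S3))); [ring|]. rewrite E1, E2. ring.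
Qed.

(** The integrand of the theorem for [x = - i z] and [kappa = - gamma - ln (z / 2)]. *)
Definition fker (kappa x : C) (m : nat) (t : R) : C :=
  Cexp (- x) * gker kappa x t * cos (INR m * t).

Definition I0val (kappa x : C) : C := PI * (kappa * CPS besI x + CPS hbesI x).
Definition I1val (kappa x : C) : C :=
  PI * (kappa * CPS (theta besI) x + CPS (theta hbesI) x - CPS besI x + Cexp (- x)) / x.

Lemma impC_fker_0 kappa x : impC (fker kappa x 0) (I0val kappa x).
Proof.
  assert (K := impC_scal (Cexp (- x)) _ _ (impC_gker kappa x)).
  eapply impC_eq; [apply impC_ext with (2 := K)|].
  - intros t _. unfold fker. change (INR 0) with 0%R. rewrite Rmult_0_l, cos_0. ring.
  - unfold I0val. rewrite Cexp_opp. field. apply Cexp_neq_0.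
Qed.

Lemma impC_fker_1 (kappa x : C) : x <> 0 -> impC (fker kappa x 1) (I1val kappa x).
Proof.
  intros Hx.
  assert (K := impC_plus _ _ _ _ (impC_scal (/ x * Cexp (- x)) _ _ (impC_u_gker kappa x))
    (impC_scal (- (1)) _ _ (impC_fker_0 kappa x))).
  eapply impC_eq; [apply impC_ext with (2 := K)|].
  - intros t _. unfold fker. change (INR 0) with 0%R. change (INR 1) with 1%R.
    rewrite Rmult_0_l, Rmult_1_l, cos_0. unfold uu. rewrite RtoC_plus. field. auto.
  - unfold I0val, I1val. rewrite Cexp_opp. field. cneq.
Qed.

Lemma CLn_half (z : C) : z <> 0 -> CLn (z / 2) = CLn z - ln 2.
Proof.
  intros Hz. assert (M : (0 < Cmod z)%R) by exact (proj1 (Cmod_gt_0 z) Hz).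
  assert (R2 : Re (z / 2) = (Re z / 2)%R).
  { replace (z / 2) with (RtoC (/ 2) * z) by (rewrite RtoC_inv by lra; field). rewrite Re_RtoC_mult. field. }
  assert (I2 : Im (z / 2) = (Im z / 2)%R).
  { replace (z / 2) with (RtoC (/ 2) * z) by (rewrite RtoC_inv by lra; field). rewrite Im_RtoC_mult. field. }
  assert (M2 : Cmod (z / 2) = (Cmod z / 2)%R).
  { rewrite Cmod_div; [|intros E; apply RtoC_inj in E; lra]. now rewrite Cmod_R, Rabs_pos_eq by lra. }
  assert (A : Carg (z / 2) = Carg z).
  { unfold Carg. rewrite R2, I2, M2.
    replace (Re z / 2 / (Cmod z / 2))%R with (Re z / Cmod z)%R by (field; lra).
    destruct (Rle_dec 0 (Im z)), (Rle_dec 0 (Im z / 2)); auto; exfalso; lra. }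
  unfold CLn. rewrite A, M2. apply C_ext; simpl; [|ring].
  unfold Rdiv. rewrite ln_mult, ln_Rinv by lra. ring.
Qed.

(** The [- i PI / 2] of the bracket cancels against the one in [ln (- i c z)]. What remains is
    [ln c + ln z = ln (2 c) + ln (z / 2)], a real logarithm in [t] plus a constant. *)
Lemma Y_integrand_fker (m : Z) (z : C) (t : R) : z <> 0 -> (0 <= t < PI)%R ->
  Y_integrand m z t = fker (- EulerMascheroni - CLn (z / 2)) (- (Ci * z)) (Z.abs_nat m) t.
Proof.
  intros Hz Ht. unfold Y_integrand, fker.
  assert (U : (0 < 1 + cos t)%R) by now apply one_cos_pos.
  set (x := - (Ci * z)). set (y := x * uu t).
  assert (Ec : cos (IZR m * t) = cos (INR (Z.abs_nat m) * t)).
  { rewrite INR_IZR_INZ, Zabs2Nat.id_abs.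
    destruct (Z.abs_spec m) as [[_ ->]|[_ ->]]; auto. rewrite opp_IZR, Ropp_mult_distr_l_reverse.
    now rewrite cos_neg. }
  rewrite Ec. f_equal.
  assert (Ee : Cexp (- (Ci * z * cos t)) = Cexp (- x) * Cexp y).
  { rewrite <- Cexp_add. f_equal. unfold y, x, uu. rewrite RtoC_plus. ring. }
  rewrite Ee, <- Cmult_assoc. f_equal.
  assert (Es : CSeries (fun n => (- (- Ci * (1 + cos t)%R * z)) ^ S n / (INR (S n) * INR (fact (S n)))) = CPS einc y).
  { apply is_Cser_unique.
    assert (H := is_Cser_incr _ _ (CPS_correct einc y exptype_einc)). cbv beta in H.
    replace (CPS einc y - einc 0 * y ^ 0) with (CPS einc y) in H by (simpl; ring).
    apply is_Cser_ext with (2 := H). intros n.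
    replace (- (- Ci * (1 + cos t)%R * z)) with (- (1) * y) by (unfold y, x, uu; ring).
    rewrite Cpow_mult_l. unfold einc, invfact.
    rewrite RtoC_div, RtoC_mult, RtoC_inv, RtoC_pow by (try apply not_0_INR; try apply fact_neq_0; lia).
    replace (RtoC (-1)) with (- (1)) by (apply C_ext; simpl; ring).
    field. cneq. }
  unfold Gamma0_mi, Gamma0. rewrite Es.
  assert (Eh : Cexp y * CPS einc y = - CPS hexp y).
  { rewrite Cexp_CPS.
    assert (H := CPS_conv invfact einc y _ exptype_invfact exptype_einc emul_einc).
    apply is_Cser_inj with (1 := H).
    replace (- CPS hexp y) with (- (1) * CPS hexp y) by ring.
    apply is_Cser_ext with (2 := is_Cser_scal (- (1)) _ _ (CPS_correct hexp y exptype_hexp)).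
    intros n. rewrite RtoC_opp. ring. }
  unfold gker. fold y. rewrite <- Cexp_CPS.
  assert (El : RtoC (lw t) = ln 2 + ln (1 + cos t)).
  { unfold lw. rewrite ln_mult by lra. now rewrite RtoC_plus. }
  rewrite El, CLn_half by auto.
  replace (CPS hexp y) with (- (Cexp y * CPS einc y)) by (rewrite Eh; ring). ring.
Qed.

Lemma is_RInt_gen_impC (f : R -> C) (l : C) : impC f l ->
  is_RInt_gen (V := C_R_CompleteNormedModule) f (at_point 0%R) (at_left PI) l.
Proof.
  intros [(F1 & H1 & L1) (F2 & H2 & L2)] P [eps HP].
  destruct (L1 eps (cond_pos eps)) as (d1 & D1 & K1).
  destruct (L2 eps (cond_pos eps)) as (d2 & D2 & K2).
  assert (PP := PI_RGT_0).
  set (d := Rmin PI (Rmin d1 d2)).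
  assert (d0 : (0 < d)%R) by (unfold d; repeat apply Rmin_glb_lt; auto).
  assert (m1 := Rmin_l PI (Rmin d1 d2)). assert (m2 := Rmin_r PI (Rmin d1 d2)).
  assert (m3 := Rmin_l d1 d2). assert (m4 := Rmin_r d1 d2). fold d in m1, m2.
  apply (Filter_prod _ _ _ (fun a => a = 0%R) (fun b => (PI - d < b < PI)%R)).
  - reflexivity.
  - exists (mkposreal d d0). intros b Hb Hlt. simpl.
    unfold ball in Hb; simpl in Hb; unfold AbsRing_ball, abs, minus, plus, opp in Hb; simpl in Hb.
    apply Rabs_lt_between in Hb. lra.
  - intros a b -> Hb. exists ((F1 b, F2 b) : C). split.
    + apply (is_RInt_fct_extend_pair (U := R_NormedModule) (V := R_NormedModule) f); simpl; [apply H1|apply H2]; lra.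
    + apply HP. split.
      * apply K1; lra.
      * apply K2; lra.
Qed.

(** * Recurrence of the integrals *)

Definition derC (f : R -> C) (t : R) (d : C) : Prop :=
  is_derive (fun t => Re (f t)) t (Re d) /\ is_derive (fun t => Im (f t)) t (Im d).

Definition contC (f : R -> C) (t : R) : Prop :=
  continuous (fun t => Re (f t)) t /\ continuous (fun t => Im (f t)) t.

Lemma derC_eq f t d d' : derC f t d -> d = d' -> derC f t d'.
Proof. now intros H <-. Qed.

Lemma derC_ext f g t d : (forall t, f t = g t) -> derC f t d -> derC g t d.
Proof.
  intros H [H1 H2]. split.
  - apply is_derive_ext with (2 := H1). intros s. now rewrite H.
  - apply is_derive_ext with (2 := H2). intros s. now rewrite H.
Qed.

Lemma derC_contC f t d : derC f t d -> contC f t.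
Proof.
  intros [H1 H2].
  split; apply (ex_derive_continuous (V := R_NormedModule)); eexists; eassumption.
Qed.

Lemma derC_plus f g t d e : derC f t d -> derC g t e -> derC (fun t => f t + g t) t (d + e).
Proof.
  intros [H1 H2] [H3 H4]. split.
  - exact (is_derive_plus (V := R_NormedModule) _ _ t _ _ H1 H3).
  - exact (is_derive_plus (V := R_NormedModule) _ _ t _ _ H2 H4).
Qed.

Lemma Rder_mult (f g : R -> R) (t d e : R) :
  is_derive f t d -> is_derive g t e -> is_derive (fun t => (f t * g t)%R) t (d * g t + f t * e)%R.
Proof. intros H1 H2. exact (is_derive_mult (K := R_AbsRing) f g t d e H1 H2 Rmult_comm). Qed.

Lemma derC_mult f g t d e : derC f t d -> derC g t e ->
  derC (fun t => f t * g t) t (d * g t + f t * e).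
Proof.
  intros [H1 H2] [H3 H4]. split.
  - assert (K := is_derive_minus (V := R_NormedModule) _ _ t _ _ (Rder_mult _ _ _ _ _ H1 H3) (Rder_mult _ _ _ _ _ H2 H4)).
    replace (Re (d * g t + f t * e)) with
      (minus (Re d * Re (g t) + Re (f t) * Re e)%R (Im d * Im (g t) + Im (f t) * Im e)%R); [exact K|].
    unfold minus, plus, opp; simpl. unfold Re, Im; simpl; ring.
  - assert (K := is_derive_plus (V := R_NormedModule) _ _ t _ _ (Rder_mult _ _ _ _ _ H1 H4) (Rder_mult _ _ _ _ _ H2 H3)).
    replace (Im (d * g t + f t * e)) with
      (plus (Re d * Im (g t) + Re (f t) * Im e)%R (Im d * Re (g t) + Im (f t) * Re e)%R); [exact K|].
    unfold plus; simpl. unfold Re, Im; simpl; ring.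
Qed.

Lemma derC_const c t : derC (fun _ => c) t 0.
Proof. split; apply (is_derive_const (V := R_NormedModule)). Qed.

Lemma derC_RtoC (f : R -> R) (t d : R) : is_derive f t d -> derC (fun t => RtoC (f t)) t d.
Proof.
  intros H. split; [exact H|]. exact (is_derive_const (V := R_NormedModule) 0%R t).
Qed.

Lemma derC_scal c f t d : derC f t d -> derC (fun t => c * f t) t (c * d).
Proof.
  intros H. eapply derC_eq; [apply derC_mult; [apply derC_const|exact H]|]. cbv beta; ring.
Qed.

Lemma contC_mult f g t : contC f t -> contC g t -> contC (fun t => f t * g t) t.
Proof.
  intros [H1 H2] [H3 H4]. split.
  - apply (continuous_minus (V := R_NormedModule) (fun t => (Re (f t) * Re (g t))%R) (fun t => (Im (f t) * Im (g t))%R));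
      now apply (continuous_mult (K := R_AbsRing)).
  - apply (continuous_plus (V := R_NormedModule) (fun t => (Re (f t) * Im (g t))%R) (fun t => (Im (f t) * Re (g t))%R));
      now apply (continuous_mult (K := R_AbsRing)).
Qed.

Lemma contC_plus f g t : contC f t -> contC g t -> contC (fun t => f t + g t) t.
Proof.
  intros [H1 H2] [H3 H4]. split.
  - now apply (continuous_plus (V := R_NormedModule) (fun t => Re (f t)) (fun t => Re (g t))).
  - now apply (continuous_plus (V := R_NormedModule) (fun t => Im (f t)) (fun t => Im (g t))).
Qed.

Lemma contC_const c t : contC (fun _ => c) t.
Proof. split; apply continuous_const. Qed.

Lemma contC_RtoC (f : R -> R) t : continuous f t -> contC (fun t => RtoC (f t)) t.
Proof. intros H; split; [exact H|apply continuous_const]. Qed.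

Lemma impC_derive (f df : R -> C) (L : C) :
  (forall t, (0 <= t < PI)%R -> derC f t (df t)) ->
  (forall t, (0 <= t < PI)%R -> contC df t) ->
  limL (fun t => Re (f t)) (Re L) -> limL (fun t => Im (f t)) (Im L) -> impC df (L - f 0%R).
Proof.
  intros H1 H2 H3 H4. split.
  - apply (impR_derive (fun t => Re (f t))); auto; intros t Ht; [now apply H1|now apply H2].
  - apply (impR_derive (fun t => Im (f t))); auto; intros t Ht; [now apply H1|now apply H2].
Qed.

Lemma CPS_mul_Re (a : nat -> R) (x : C) (s : R) : exptype a ->
  PSeries (fun n => (a n * Re (x ^ S n))%R) s = Re (x * CPS a (x * s)).
Proof.
  intros Ha. rewrite Re_mult, CPS_Re, CPS_Im. apply is_series_unique.
  apply is_series_ext with (fun n => (Re x * (a n * Re (x ^ n) * s ^ n) - Im x * (a n * Im (x ^ n) * s ^ n))%R).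
  - intros n. simpl Cpow. rewrite Re_mult. Req. ring.
  - apply Rser_minus; apply Rser_scal;
      apply (exptype_PSeries (fun n => _)); [now apply exptype_Re|now apply exptype_Im].
Qed.

Lemma CPS_mul_Im (a : nat -> R) (x : C) (s : R) : exptype a ->
  PSeries (fun n => (a n * Im (x ^ S n))%R) s = Im (x * CPS a (x * s)).
Proof.
  intros Ha. rewrite Im_mult, CPS_Re, CPS_Im. apply is_series_unique.
  apply is_series_ext with (fun n => (Re x * (a n * Im (x ^ n) * s ^ n) + Im x * (a n * Re (x ^ n) * s ^ n))%R).
  - intros n. simpl Cpow. rewrite Im_mult. Req. ring.
  - apply Rser_plus; apply Rser_scal;
      apply (exptype_PSeries (fun n => _)); [now apply exptype_Im|now apply exptype_Re].
Qed.

Lemma derC_CPS (a b : nat -> R) (x : C) (t : R) : exptype a -> exptype b ->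
  (forall n, (INR (S n) * a (S n))%R = b n) ->
  derC (fun t => CPS a (x * uu t)) t ((- sin t)%R * (x * CPS b (x * uu t))).
Proof.
  intros Ha Hb H.
  assert (Du : is_derive uu t (- sin t)%R) by (unfold uu; auto_derive; auto; ring).
  split.
  - apply is_derive_ext with (fun t => PSeries (fun n => (a n * Re (x ^ n))%R) (uu t)).
    { intros s. now rewrite CPS_Re. }
    rewrite Re_RtoC_mult, <- CPS_mul_Re by auto.
    apply (is_derive_comp (V := R_NormedModule) (PSeries (fun n => (a n * Re (x ^ n))%R)) uu); auto.
    apply exptype_is_derive; [now apply exptype_Re|]. intros n. rewrite <- H. ring.
  - apply is_derive_ext with (fun t => PSeries (fun n => (a n * Im (x ^ n))%R) (uu t)).
    { intros s. now rewrite CPS_Im. }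
    rewrite Im_RtoC_mult, <- CPS_mul_Im by auto.
    apply (is_derive_comp (V := R_NormedModule) (PSeries (fun n => (a n * Im (x ^ n))%R)) uu); auto.
    apply exptype_is_derive; [now apply exptype_Im|]. intros n. rewrite <- H. ring.
Qed.

(** Coefficients of the derivative of [sum_n H_n y^n / n!]. *)
Definition hexp' (n : nat) : R := (hexp n + invfact (S n))%R.

Lemma exptype_hexp' : exptype hexp'.
Proof.
  apply (exptype_le invfact _ 1 2); try lra; [apply exptype_invfact|]. intros n.
  unfold hexp', hexp. assert (H := harm_bound n). assert (P := INR_le_pow2 n).
  assert (I := invfact_pos n). assert (I' := invfact_pos (S n)).
  assert (E := invfact_S n). rewrite S_INR in E. assert (N := pos_INR n).
  rewrite !Rabs_pos_eq by nra.
  destruct n.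
  - simpl harm. change (INR 0) with 0%R in *. simpl. lra.
  - assert (P' : (INR (S n) + 1 <= 2 ^ S n)%R).
    { rewrite S_INR. simpl. clear. induction n; [change (INR 0) with 0%R; simpl; lra|].
      rewrite S_INR. simpl. assert (1 <= 2 ^ n)%R by (apply pow_R1_Rle; lra). lra. }
    assert (invfact (S (S n)) <= invfact (S n))%R by (rewrite <- E; nra). nra.
Qed.

Lemma CPS_hexp' y : y * CPS hexp' y = y * CPS hexp y + (Cexp y - 1).
Proof.
  assert (K : is_Cser (fun n => y * (hexp n * y ^ n) + invfact (S n) * y ^ S n)
    (y * CPS hexp y + (Cexp y - 1))).
  { apply is_Cser_plus; [apply is_Cser_scal, CPS_correct, exptype_hexp|].
    replace (Cexp y - 1) with (Cexp y - invfact 0 * y ^ 0).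
    - apply (is_Cser_incr (fun n => invfact n * y ^ n)), Cexp_ser.
    - unfold invfact. simpl. change (INR 1) with 1%R. rewrite Rinv_1. ring. }
  apply is_Cser_inj with (2 := K).
  apply is_Cser_ext with (2 := is_Cser_scal y _ _ (CPS_correct hexp' y exptype_hexp')).
  intros n. unfold hexp'. rewrite RtoC_plus. simpl Cpow. ring.
Qed.

Definition gA (kappa x : C) (t : R) : C := kappa * CPS invfact (x * uu t) + CPS hexp (x * uu t).

(** [gA] is [gker] without its logarithmic term, hence differentiable at [PI] too. The formula is
    kept multiplied by [u], which vanishes there. *)
Lemma derC_gA kappa x t : exists d, derC (gA kappa x) t d /\
  uu t * d = (- sin t)%R * (x * uu t * gA kappa x t + Cexp (x * uu t) - 1).
Proof.
  eexists. split.
  - apply derC_plus; [apply derC_scal, (derC_CPS invfact invfact)|apply (derC_CPS hexp hexp')];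
      auto using exptype_invfact, exptype_hexp, exptype_hexp', invfact_S.
    intros n. unfold hexp, hexp'. apply harm_invfact_S.
  - unfold gA.
    transitivity ((- sin t)%R * (kappa * (x * uu t) * CPS invfact (x * uu t) + x * uu t * CPS hexp' (x * uu t))); [ring|].
    rewrite CPS_hexp'. ring.
Qed.

Lemma derC_gB x t : derC (fun t => CPS invfact (x * uu t)) t ((- sin t)%R * (x * CPS invfact (x * uu t))).
Proof. apply derC_CPS; auto using exptype_invfact, invfact_S. Qed.

(** The rule [(e^y Gamma (0, y))' = e^y Gamma (0, y) - 1 / y]: the terms [e^(x u) / u] from the
    series and from the logarithm cancel. *)
Lemma derC_gker (kappa x : C) t : (0 <= t < PI)%R ->
  derC (gker kappa x) t ((- sin t)%R * (x * gker kappa x t - / uu t)).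
Proof.
  intros Ht. assert (U := uu_pos t Ht).
  assert (Uc : RtoC (uu t) <> 0) by (intros E; apply RtoC_inj in E; lra).
  destruct (derC_gA kappa x t) as (d & D & E).
  assert (K := derC_plus _ _ _ _ _ D (derC_scal (- (1)) _ _ _ (derC_mult _ _ _ _ _
    (derC_RtoC _ _ _ (lw_derive t U)) (derC_gB x t)))).
  eapply derC_eq; [apply derC_ext with (2 := K)|].
  - intros s. unfold gker, gA. ring.
  - replace d with (/ uu t * (uu t * d)) by (field; auto). rewrite E, Cexp_CPS. fold (uu t).
    rewrite RtoC_div by lra. rewrite !RtoC_opp. unfold gker, gA. field. auto.
Qed.

Lemma contC_fker kappa x m t : (0 <= t < PI)%R -> contC (fker kappa x m) t.
Proof.
  intros Ht. unfold fker. apply contC_mult; [apply contC_mult; [apply contC_const|]|].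
  - eapply derC_contC, derC_gker, Ht.
  - apply contC_RtoC. Rcont.
Qed.

Lemma continuous_tansin m t : continuous (tansin m) t.
Proof.
  induction m; [apply continuous_const|].
  apply (continuous_minus (V := R_NormedModule) (fun t => (cos (INR m * t) - cos (INR (S m) * t))%R) (tansin m)); auto.
  Rcont.
Qed.

Definition Wker (kappa x : C) (m : nat) (t : R) : C :=
  Cexp (- x) * gker kappa x t * sin (INR m * t).

(** [Wker] is the function to integrate by parts. The product [sin t sin ((m + 1) t)] splits into
    cosines of the neighbouring orders, and its quotient by [u] is [tansin]. *)
Lemma derC_Wker (kappa x : C) m t : (0 <= t < PI)%R ->
  derC (Wker kappa x (S m)) t
    (- (x / 2) * (fker kappa x m t + - (1) * fker kappa x (S (S m)) t)
     + INR (S m) * fker kappa x (S m) t + Cexp (- x) * tansin (S m) t).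
Proof.
  intros Ht. assert (U := uu_pos t Ht).
  assert (Uc : RtoC (uu t) <> 0) by (intros E; apply RtoC_inj in E; lra).
  assert (Ds : is_derive (fun t => sin (INR (S m) * t)) t (INR (S m) * cos (INR (S m) * t))%R).
  { auto_derive; auto. ring. }
  assert (K := derC_mult _ _ _ _ _ (derC_scal (Cexp (- x)) _ _ _ (derC_gker kappa x t Ht)) (derC_RtoC _ _ _ Ds)).
  eapply derC_eq; [exact K|]. cbv beta.
  assert (ET := tansin_eq (S m) t Ht).
  assert (T : RtoC (tansin (S m) t) = sin t * sin (INR (S m) * t) / uu t).
  { rewrite <- RtoC_mult, <- ET, RtoC_mult. field. auto. }
  rewrite T. unfold fker.
  set (th := (INR (S m) * t)%R).
  replace (INR m * t)%R with (th - t)%R by (unfold th; rewrite S_INR; ring).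
  replace (INR (S (S m)) * t)%R with (th + t)%R by (unfold th; rewrite (S_INR (S m)); ring).
  rewrite cos_minus, cos_plus. rewrite RtoC_plus, RtoC_minus, !RtoC_mult, RtoC_opp. field. auto.
Qed.

(** The quotient [sin (m t) / sin t], that is the Chebyshev polynomial [U_(m-1) (cos t)]. Its
    boundedness frees a factor [sin t] to control the logarithm at [PI]. *)
Fixpoint sinfac (m : nat) (t : R) : R :=
  match m with O => 0%R | S p => (sinfac p t * cos t + cos (INR p * t))%R end.

Lemma sinfac_eq m t : sin (INR m * t) = (sinfac m t * sin t)%R.
Proof.
  induction m.
  - change (INR 0) with 0%R. rewrite (Rmult_0_l t), sin_0. simpl. ring.
  - rewrite S_INR. replace ((INR m + 1) * t)%R with (INR m * t + t)%R by ring.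
    rewrite sin_plus, IHm. simpl. ring.
Qed.

Lemma sinfac_bound m t : (Rabs (sinfac m t) <= INR m)%R.
Proof.
  induction m.
  - simpl. rewrite Rabs_R0. apply pos_INR.
  - simpl sinfac. rewrite S_INR. eapply Rle_trans; [apply Rabs_triang|]. rewrite Rabs_mult.
    assert (C1 : (Rabs (cos t) <= 1)%R) by (apply Rabs_le, COS_bound).
    assert (C2 : (Rabs (cos (INR m * t)) <= 1)%R) by (apply Rabs_le, COS_bound).
    generalize (Rabs_pos (sinfac m t)). nra.
Qed.

Lemma limL_Wker_aux (a b : R -> R) (M : R) m :
  continuous a PI -> (0 <= M)%R -> (forall t, (0 <= t < PI)%R -> Rabs (b t) <= M)%R ->
  limL (fun t => (a t - lw t * b t) * sin (INR m * t))%R 0%R.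
Proof.
  intros Ha HM Hb.
  assert (H1 : limL (fun t => a t * (sinfac m t * sin t))%R 0%R).
  { replace 0%R with (a PI * (sinfac m PI * sin PI))%R by (rewrite sin_PI; ring).
    apply (limL_continuous (fun t => a t * (sinfac m t * sin t))%R).
    apply (continuous_mult (K := R_AbsRing) a (fun t => (sinfac m t * sin t)%R)); auto.
    apply continuous_ext with (fun t => sin (INR m * t)); [intros t; apply sinfac_eq|]. Rcont. }
  assert (H2 : limL (fun t => (- (b t * sinfac m t)) * (sin t * lw t))%R 0%R).
  { apply limL_sin_lw with (M * INR m)%R; [apply Rmult_le_pos; auto; apply pos_INR|].
    intros t Ht. rewrite Rabs_Ropp, Rabs_mult. apply Rmult_le_compat; auto using Rabs_pos, sinfac_bound. }
  assert (H := limL_plus _ _ _ _ H1 H2). rewrite Rplus_0_r in H.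
  apply limL_ext with (2 := H). intros t _. rewrite sinfac_eq. ring.
Qed.

Lemma gB_bound (x : C) t : (Cmod (Cexp (- x) * CPS invfact (x * uu t)) <= exp (Cmod x) * exp (2 * Cmod x))%R.
Proof.
  rewrite Cmod_mult, <- Cexp_CPS.
  apply Rmult_le_compat; auto using Cmod_ge_0.
  - rewrite <- (Cmod_opp x). apply Cmod_Cexp.
  - eapply Rle_trans; [apply Cmod_Cexp|]. rewrite Cmod_mult, Cmod_R.
    assert (B := uu_bound t). rewrite Rabs_pos_eq by lra. assert (M := Cmod_ge_0 x).
    apply exp_le_exp. nra.
Qed.

Lemma limL_Wker (kappa x : C) m :
  limL (fun t => Re (Wker kappa x m t)) 0%R /\ limL (fun t => Im (Wker kappa x m t)) 0%R.
Proof.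
  assert (Ca : contC (fun t => Cexp (- x) * gA kappa x t) PI).
  { apply contC_mult; [apply contC_const|].
    destruct (derC_gA kappa x PI) as (d & D & _). eapply derC_contC, D. }
  destruct Ca as [Ca1 Ca2].
  set (M := (exp (Cmod x) * exp (2 * Cmod x))%R).
  assert (M0 : (0 <= M)%R) by (apply Rmult_le_pos; left; apply exp_pos).
  set (a := fun t => Cexp (- x) * gA kappa x t) in *.
  set (b := fun t => Cexp (- x) * CPS invfact (x * uu t)).
  assert (W : forall t, Wker kappa x m t = sin (INR m * t) * (a t + - (lw t * b t))).
  { intros t. unfold Wker, gker, a, b, gA. ring. }
  split.
  - apply limL_ext with (fun t => (Re (a t) - lw t * Re (b t)) * sin (INR m * t))%R.
    + intros t _. rewrite W, Re_RtoC_mult, Rmult_comm, <- Re_RtoC_mult. reflexivity.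
    + apply (limL_Wker_aux (fun t => Re (a t)) (fun t => Re (b t)) M); auto.
      intros t _. eapply Rle_trans; [apply re_le_Cmod|apply gB_bound].
  - apply limL_ext with (fun t => (Im (a t) - lw t * Im (b t)) * sin (INR m * t))%R.
    + intros t _. rewrite W, Im_RtoC_mult, Rmult_comm, <- Im_RtoC_mult. reflexivity.
    + apply (limL_Wker_aux (fun t => Im (a t)) (fun t => Im (b t)) M); auto.
      intros t _. eapply Rle_trans; [apply im_le_Cmod|apply gB_bound].
Qed.

Lemma impC_fker_SS (kappa x Im0 Im1 : C) m : x <> 0 ->
  impC (fker kappa x m) Im0 -> impC (fker kappa x (S m)) Im1 ->
  impC (fker kappa x (S (S m)))
    (Im0 - 2 / x * (INR (S m) * Im1 + Cexp (- x) * (PI * (- (1)) ^ m))).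
Proof.
  intros Hx H0 H1.
  destruct (limL_Wker kappa x (S m)) as [L1 L2].
  assert (K : impC (fun t => - (x / 2) * (fker kappa x m t + - (1) * fker kappa x (S (S m)) t)
     + INR (S m) * fker kappa x (S m) t + Cexp (- x) * tansin (S m) t) (0 - Wker kappa x (S m) 0%R)).
  { apply impC_derive; auto.
    - intros t Ht. now apply derC_Wker.
    - intros t Ht. apply contC_plus; [apply contC_plus; apply contC_mult; try apply contC_const|].
      + apply contC_plus; [now apply contC_fker|apply contC_mult; [apply contC_const|now apply contC_fker]].
      + now apply contC_fker.
      + apply contC_mult; [apply contC_const|apply contC_RtoC, continuous_tansin]. }
  (* The boundary term at 0 vanishes by [sin 0 = 0], the one at [PI] by [limL_Wker]. *)
  replace (0 - Wker kappa x (S m) 0%R) with (RtoC 0) in K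
    by (unfold Wker; rewrite Rmult_0_r, sin_0; ring).
  assert (T := impC_RtoC _ _ (impR_tansin m)).
  rewrite RtoC_mult, RtoC_pow in T. replace (RtoC (-1)) with (- (1)) in T by (apply C_ext; simpl; ring).
  assert (Q := impC_plus _ _ _ _ H0 (impC_plus _ _ _ _ (impC_scal (2 / x) _ _ K)
    (impC_scal (- (2 / x)) _ _ (impC_plus _ _ _ _ (impC_scal (INR (S m)) _ _ H1) (impC_scal (Cexp (- x)) _ _ T))))).
  eapply impC_eq; [apply impC_ext with (2 := Q)|].
  - intros t _. cbv beta. field. auto.
  - ring.
Qed.

(** * The finite sum *)

(** [Gamma (1 / 2 - j) / sqrt PI]. *)
Fixpoint ghalf (j : nat) : R :=
  match j with O => 1%R | S p => (- 2 * ghalf p / (2 * INR p + 1))%R end.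

Lemma ghalf_neq_0 j : ghalf j <> 0%R.
Proof.
  induction j; simpl; [lra|]. assert (P := pos_INR j).
  apply Rmult_integral_contrapositive. split; [lra|]. apply Rinv_neq_0_compat. lra.
Qed.

Lemma RGamma_half_sub j : RGamma (1 / 2 - INR j) = RtoC (/ (sqrt PI * ghalf j)).
Proof.
  assert (SP : (0 < sqrt PI)%R) by (apply sqrt_lt_R0, PI_RGT_0).
  induction j.
  - change (INR 0) with 0%R. replace (1 / 2 - 0) with (1 / 2) by ring. rewrite RGamma_half.
    simpl. now rewrite Rmult_1_r.
  - rewrite RGamma_rec, S_INR, RtoC_plus.
    replace (1 / 2 - (INR j + 1) + 1) with (1 / 2 - INR j) by ring. rewrite IHj.
    replace (1 / 2 - (INR j + 1)) with (RtoC (- (2 * INR j + 1) / 2)%R).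
    + rewrite <- RtoC_mult. f_equal. assert (N := ghalf_neq_0 j). simpl. assert (P := pos_INR j).
      field. repeat split; auto; lra.
    + rewrite RtoC_div, RtoC_opp, RtoC_plus, RtoC_mult by lra. field.
Qed.

Lemma Gamma_half_sub j : Gamma (1 / 2 - INR j) = RtoC (sqrt PI * ghalf j).
Proof.
  assert (SP : (0 < sqrt PI)%R) by (apply sqrt_lt_R0, PI_RGT_0).
  assert (N := ghalf_neq_0 j). unfold Gamma. rewrite RGamma_half_sub, <- RtoC_inv.
  - f_equal. now rewrite Rinv_inv.
  - apply Rinv_neq_0_compat, Rmult_integral_contrapositive. split; lra.
Qed.

Lemma Gamma_nat n : Gamma (INR n + 1) = INR (fact n).
Proof.
  unfold Gamma. rewrite RGamma_nat. unfold invfact.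
  rewrite <- RtoC_inv by apply Rinv_neq_0_compat, INR_fact_neq_0. now rewrite Rinv_inv.
Qed.

(* Zero beyond [m], so that sums of different lengths can be compared termwise. *)
Definition sfact (m j : nat) : R :=
  if le_dec j m then (INR (fact (j + m - 1)) * invfact (m - j))%R else 0%R.

Definition sterm (y : C) (m j : nat) : C := (ghalf j * sfact m j)%R * y ^ j.

Fixpoint bigS (f : nat -> C) (n : nat) : C :=
  match n with O => 0 | S p => bigS f p + f (S p) end.

Lemma sum_n_m_bigS (f : nat -> C) n : sum_n_m (G := C_AbelianMonoid) f 1 n = bigS f n.
Proof.
  induction n; [now rewrite sum_n_m_zero by lia|].
  rewrite sum_n_Sm by lia. rewrite IHn. reflexivity.
Qed.

Lemma bigS_ext f g n : (forall j, (1 <= j <= n)%nat -> f j = g j) -> bigS f n = bigS g n.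
Proof.
  intros H. induction n; simpl; auto. rewrite IHn, H by (try lia; intros; apply H; lia). reflexivity.
Qed.

Lemma bigS_plus f g n : bigS (fun j => f j + g j) n = bigS f n + bigS g n.
Proof. induction n; simpl; [ring|rewrite IHn; ring]. Qed.

Lemma bigS_scal c f n : bigS (fun j => c * f j) n = c * bigS f n.
Proof. induction n; simpl; [ring|rewrite IHn; ring]. Qed.

Lemma bigS_shift f n : bigS f (S n) = f 1%nat + bigS (fun j => f (S j)) n.
Proof.
  induction n; [simpl; ring|].
  change (bigS f (S (S n))) with (bigS f (S n) + f (S (S n))). rewrite IHn. simpl. ring.
Qed.

Definition ssum (y : C) (m : nat) : C := bigS (sterm y m) m.

Lemma sigmaY_ssum (m : Z) (z : C) : z <> 0 ->
  sigmaY m z = CpowZ (- (1)) m * Cexp (Ci * z) * ssum (/ (2 * Ci * z)) (Z.abs_nat m).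
Proof.
  intros Hz. unfold sigmaY. set (M := Z.abs_nat m). rewrite sum_n_m_bigS.
  assert (SP : (0 < sqrt PI)%R) by (apply sqrt_lt_R0, PI_RGT_0).
  assert (SPc : RtoC (sqrt PI) <> 0) by (intros E; apply RtoC_inj in E; lra).
  rewrite (bigS_ext _ (fun j => sqrt PI * sterm (/ (2 * Ci * z)) M j)).
  - rewrite bigS_scal. fold (ssum (/ (2 * Ci * z)) M). field. auto.
  - intros j Hj. rewrite Gamma_half_sub.
    replace (INR j + INR M) with (INR (j + M - 1) + 1).
    2: { rewrite <- !RtoC_plus, <- plus_INR. rewrite <- S_INR. do 2 f_equal. lia. }
    replace (INR M - INR j + 1) with (INR (M - j) + 1).
    2: { rewrite minus_INR, RtoC_minus by lia. ring. }
    rewrite !Gamma_nat. unfold sterm, sfact.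
    destruct (le_dec j M) as [L|L]; [|lia].
    unfold invfact. rewrite Cpow_inv.
    2: { repeat apply Cmult_neq_0; auto using Ci_neq_0. intros E; apply RtoC_inj in E; lra. }
    rewrite !RtoC_mult, RtoC_inv by apply INR_fact_neq_0.
    unfold Cdiv. ring.
Qed.

Lemma invfact_eq n : invfact n = (INR (S n) * invfact (S n))%R.
Proof. symmetry. apply invfact_S. Qed.

Lemma fact_INR_S n : INR (fact (S n)) = (INR (S n) * INR (fact n))%R.
Proof. now rewrite fact_simpl, mult_INR. Qed.

Lemma sfact_rec n i : (1 <= i <= S n)%nat ->
  (sfact (S (S n)) (S i) - sfact n (S i) = 2 * INR (S n) * (2 * INR i + 1) * sfact (S n) i)%R.
Proof.
  intros Hi. unfold sfact.
  destruct (le_dec (S i) (S (S n))) as [L1|L1]; [|lia].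
  destruct (le_dec i (S n)) as [L2|L2]; [|lia].
  (* For [i = n + 1] and [i = n] the term [sfact n (S i)] lies beyond the range and is 0; for
     smaller [i] all factorials are expressed through [p = n - i - 1]. *)
  destruct (Nat.eq_dec i (S n)) as [E1|E1]; [|destruct (Nat.eq_dec i n) as [E2|E2]].
  - subst i. destruct (le_dec (S (S n)) n) as [L|L]; [lia|].
    rewrite !Nat.sub_diag. replace (S (S n) + S (S n) - 1)%nat with (S (S (S (2 * n)))) by lia.
    replace (S n + S n - 1)%nat with (S (2 * n)) by lia.
    rewrite (fact_INR_S (S (S (2 * n)))), (fact_INR_S (S (2 * n))), !S_INR, mult_INR.
    change (INR 2) with 2%R. ring.
  - subst i. destruct (le_dec (S n) n) as [L|L]; [lia|].
    replace (S (S n) - S n)%nat with 1%nat by lia. replace (S n - n)%nat with 1%nat by lia.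
    replace (S n + S (S n) - 1)%nat with (S (S (2 * n))) by lia.
    replace (n + S n - 1)%nat with (2 * n)%nat by lia.
    rewrite (fact_INR_S (S (2 * n))), (fact_INR_S (2 * n)), !S_INR, mult_INR.
    change (INR 2) with 2%R. ring.
  - destruct (le_dec (S i) n) as [L|L]; [|lia].
    destruct (Nat.le_exists_sub (S i) n L) as (p & Ep & _).
    replace n with (i + p + 1)%nat by lia. clear - Hi.
    replace (S (S (i + p + 1)) - S i)%nat with (S (S p)) by lia.
    replace (i + p + 1 - S i)%nat with p by lia.
    replace (S (i + p + 1) - i)%nat with (S (S p)) by lia.
    replace (S i + S (S (i + p + 1)) - 1)%nat with (S (S (2 * i + p + 1))) by lia.
    replace (S i + (i + p + 1) - 1)%nat with (2 * i + p + 1)%nat by lia.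
    replace (i + S (i + p + 1) - 1)%nat with (2 * i + p + 1)%nat by lia.
    rewrite (fact_INR_S (S (2 * i + p + 1))), (fact_INR_S (2 * i + p + 1)).
    rewrite (invfact_eq p), (invfact_eq (S p)).
    rewrite !S_INR, !plus_INR, mult_INR. change (INR 2) with 2%R. change (INR 1) with 1%R. ring.
Qed.

Lemma sfact_1 m : sfact m 1 = INR m.
Proof.
  unfold sfact. destruct (le_dec 1 m) as [L|L].
  - destruct m; [lia|]. replace (1 + S m - 1)%nat with (S m) by lia.
    replace (S m - 1)%nat with m by lia. rewrite fact_INR_S. unfold invfact. field. apply INR_fact_neq_0.
  - replace m with O by lia. reflexivity.
Qed.

Lemma bigS_sterm_extend y m k : bigS (sterm y m) (m + k) = ssum y m.
Proof.
  induction k; [now rewrite Nat.add_0_r|].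
  replace (m + S k)%nat with (S (m + k)) by lia. simpl. rewrite IHk.
  unfold sterm, sfact. destruct (le_dec (S (m + k)) m); [lia|]. rewrite Rmult_0_r. ring.
Qed.

(** The [j = 1] terms leave [4 y]; the others match by [sfact_rec] and the recursion of [ghalf]. The
    inhomogeneity is what must absorb the integral of [tansin]. *)
Lemma ssum_rec y n :
  ssum y n - ssum y (S (S n)) = 4 * INR (S n) * y * ssum y (S n) + 4 * y.
Proof.
  rewrite <- (bigS_sterm_extend y n 2). replace (n + 2)%nat with (S (S n)) by lia.
  unfold ssum at 1. rewrite !(bigS_shift _ (S n)).
  assert (H1 : sterm y n 1 - sterm y (S (S n)) 1 = 4 * y).
  { unfold sterm. rewrite !sfact_1. simpl ghalf. change (INR 0) with 0%R. rewrite !S_INR. simpl Cpow.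
    replace (- 2 * 1 / (2 * 0 + 1) * (INR n + 1 + 1))%R with (- 2 * 1 / (2 * 0 + 1) * INR n + -4)%R by field.
    rewrite RtoC_plus. replace (RtoC (-4)) with (- (4)) by (apply C_ext; simpl; ring). ring. }
  assert (H2 : bigS (fun j => sterm y n (S j)) (S n) + - (1) * bigS (fun j => sterm y (S (S n)) (S j)) (S n)
    = 4 * INR (S n) * y * ssum y (S n)).
  { unfold ssum. rewrite <- !bigS_scal, <- bigS_plus. apply bigS_ext. intros i Hi. unfold sterm.
    assert (E := sfact_rec n i Hi).
    replace (sfact (S (S n)) (S i)) with (sfact n (S i) + 2 * INR (S n) * (2 * INR i + 1) * sfact (S n) i)%R by lra.
    simpl Cpow.
    assert (G : (ghalf (S i) * (2 * INR i + 1) = - 2 * ghalf i)%R).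
    { simpl ghalf. assert (P := pos_INR i). field. lra. }
    transitivity (- RtoC (ghalf (S i) * (2 * INR i + 1) * (2 * INR (S n) * sfact (S n) i))%R * (y * y ^ i)).
    { repeat first [rewrite RtoC_mult | rewrite RtoC_plus]. ring. }
    rewrite G. rewrite !RtoC_mult. replace (RtoC (- 2)%R) with (- (2)) by (apply C_ext; simpl; ring). ring. }
  rewrite <- H1, <- H2. ring.
Qed.

Lemma ssum_1 y : ssum y 1 = - (2) * y.
Proof.
  unfold ssum. simpl. unfold sterm. rewrite sfact_1. simpl ghalf. change (INR 0) with 0%R. change (INR 1) with 1%R.
  replace (-2 * 1 / (2 * 0 + 1) * 1)%R with (-2)%R by field.
  replace (RtoC (-2)%R) with (- (2)) by (apply C_ext; simpl; ring). simpl. ring.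
Qed.

(** * Conclusion *)

Lemma CPS_even (b c : nat -> R) (x : C) : exptype b ->
  (forall k, b (2 * k + 1)%nat = 0%R) -> (forall k, b (2 * k)%nat = ((/ 4) ^ k * c k)%R) ->
  is_Cser (fun k => c k * (x * x / 4) ^ k) (CPS b x).
Proof.
  intros Hb Ho He.
  assert (O : forall k, b (2 * k + 1)%nat * x ^ (2 * k + 1) = 0) by (intros k; rewrite Ho; ring).
  assert (K := is_Cser_even _ _ O (CPS_correct b x Hb)).
  apply is_Cser_ext with (2 := K). intros k. cbv beta. rewrite He.
  replace (2 * k)%nat with (k + k)%nat by lia.
  rewrite Cpow_add, RtoC_mult, RtoC_pow, RtoC_inv by lra.
  unfold Cdiv. rewrite !Cpow_mult_l. ring.
Qed.

(** For series whose constant term vanishes as well: a factor [x^2 / 4] comes out, as with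
    [x I_0' (x)], which leads to the coefficients of order 1. *)
Lemma CPS_even_S (b c : nat -> R) (x : C) : exptype b ->
  (forall k, b (2 * k + 1)%nat = 0%R) -> b O = 0%R ->
  (forall k, b (2 * S k)%nat = ((/ 4) ^ S k * (2 * c k))%R) -> exptype c ->
  CPS b x = 2 * (x * x / 4) * CPS c (x * x / 4).
Proof.
  intros Hb Ho H0 He Hc.
  set (c' := ashift (fun k => (2 * c k)%R)).
  assert (K : is_Cser (fun k => c' k * (x * x / 4) ^ k) (CPS b x)).
  { apply CPS_even; auto. intros [|k]; [|apply He].
    change (2 * 0)%nat with 0%nat. rewrite H0. unfold c'. simpl. ring. }
  assert (K2 := is_Cser_incr _ _ K). cbv beta in K2.
  replace (CPS b x - c' 0%nat * (x * x / 4) ^ 0) with (CPS b x) in K2 by (unfold c'; simpl; ring).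
  apply is_Cser_inj with (1 := K2).
  apply is_Cser_ext with (2 := is_Cser_scal (2 * (x * x / 4)) _ _ (CPS_correct c (x * x / 4) Hc)).
  intros k. change (c' (S k)) with (2 * c k)%R. rewrite RtoC_mult. simpl Cpow. ring.
Qed.

Lemma CPS_besI x : CPS besI x = CPS (Jcoef 0) (x * x / 4).
Proof.
  symmetry. apply is_Cser_unique, CPS_even; [apply exptype_besI|apply besI_odd|].
  intros k. rewrite besI_even. unfold Jcoef. now rewrite Nat.add_0_r.
Qed.

Lemma CPS_hbesI x : CPS hbesI x = CPS (Hcoef 0) (x * x / 4).
Proof.
  symmetry. apply is_Cser_unique, CPS_even; [apply exptype_hbesI|apply hbesI_odd|].
  intros k. rewrite hbesI_even, besI_even. unfold Hcoef. rewrite Nat.add_0_r. ring.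
Qed.

Lemma CPS_theta_besI x : CPS (theta besI) x = 2 * (x * x / 4) * CPS (Jcoef 1) (x * x / 4).
Proof.
  apply CPS_even_S.
  - apply exptype_theta, exptype_besI.
  - intros k. unfold theta. rewrite besI_odd. ring.
  - unfold theta. change (INR 0) with 0%R. ring.
  - intros k. unfold theta. rewrite besI_even. unfold Jcoef. rewrite Nat.add_1_r, <- (invfact_S k), mult_INR.
    change (INR 2) with 2%R. ring.
  - apply exptype_Jcoef.
Qed.

Lemma CPS_theta_hbesI x : CPS (theta hbesI) x = 2 * (x * x / 4) * CPS (Hcoef 1) (x * x / 4).
Proof.
  apply CPS_even_S.
  - apply exptype_theta, exptype_hbesI.
  - intros k. unfold theta. rewrite hbesI_odd. ring.
  - unfold theta. change (INR 0) with 0%R. ring.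
  - intros k. unfold theta. rewrite hbesI_even, besI_even. unfold Hcoef.
    rewrite Nat.add_1_r, <- (invfact_S k), mult_INR.
    change (INR 2) with 2%R. ring.
  - apply exptype_Hcoef.
Qed.

Fixpoint Ival (kappa x : C) (m : nat) : C :=
  match m with
  | O => I0val kappa x
  | S p => match p with
    | O => I1val kappa x
    | S n => Ival kappa x n - 2 / x * (INR p * Ival kappa x p + Cexp (- x) * (PI * (- (1)) ^ n))
    end
  end.

Lemma impC_fker (kappa x : C) m : x <> 0 -> impC (fker kappa x m) (Ival kappa x m).
Proof.
  intros Hx.
  assert (H : impC (fker kappa x m) (Ival kappa x m) /\ impC (fker kappa x (S m)) (Ival kappa x (S m))).
  { induction m.
    - split; [apply impC_fker_0|now apply impC_fker_1].
    - destruct IHm as [H1 H2]. split; auto. now apply impC_fker_SS. }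
  apply H.
Qed.

Definition kap (z : C) : C := - EulerMascheroni - CLn (z / 2).

(** The braces of the theorem with [n = |m|]; the argument of [ssum] is [1 / (2 i z)]. *)
Definition Sval (z : C) (n : nat) : C :=
  1 / PI * Ival (kap z) (- (Ci * z)) n + (- (1)) ^ n * Cexp (Ci * z) * ssum (- Ci / (2 * z)) n.

Lemma Cinv_Ci : / Ci = - Ci.
Proof.
  replace (- Ci) with (- (Ci * Ci) * / Ci) by (field; apply Ci_neq_0). rewrite Ci2. ring.
Qed.

Lemma x_neq_0 (z : C) : z <> 0 -> - (Ci * z) <> 0.
Proof.
  intros Hz E. apply (Cmult_neq_0 Ci z Ci_neq_0 Hz).
  replace (Ci * z) with (- - (Ci * z)) by ring. rewrite E. ring.
Qed.

Lemma Cinv_x (z : C) : z <> 0 -> / - (Ci * z) = Ci / z.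
Proof.
  intros Hz. replace Ci with (- - Ci) at 2 by ring. rewrite <- Cinv_Ci. field. auto using Ci_neq_0.
Qed.

(** The inhomogeneous terms cancel: integration by parts leaves [(2 i / z) (-1)^n e^(i z)] and the
    finite sum [4 y (-1)^n e^(i z)] with [y = - i / (2 z)]. *)
Lemma Sval_rec (z : C) n : z <> 0 ->
  Sval z n - Sval z (S (S n)) = 2 * Ci * INR (S n) / z * Sval z (S n).
Proof.
  intros Hz. unfold Sval.
  change (Ival (kap z) (- (Ci * z)) (S (S n))) with
    (Ival (kap z) (- (Ci * z)) n - 2 / - (Ci * z) *
      (INR (S n) * Ival (kap z) (- (Ci * z)) (S n) + Cexp (- - (Ci * z)) * (PI * (- (1)) ^ n))).
  assert (R := ssum_rec (- Ci / (2 * z)) n).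
  replace (ssum (- Ci / (2 * z)) (S (S n))) with
    (ssum (- Ci / (2 * z)) n - (4 * INR (S n) * (- Ci / (2 * z)) * ssum (- Ci / (2 * z)) (S n) + 4 * (- Ci / (2 * z))))
    by (rewrite <- R; ring).
  replace (- - (Ci * z)) with (Ci * z) by ring.
  replace (2 / - (Ci * z)) with (2 * Ci / z) by (unfold Cdiv; rewrite Cinv_x by auto; unfold Cdiv; ring).
  simpl Cpow. field. auto using PI_C_neq_0.
Qed.

Definition Rval (z : C) (m : Z) : C :=
  - (2 * CpowZ Ci m / PI) * Sval z (Z.abs_nat m).

Lemma CpowZ_nat c n : CpowZ c (Z.of_nat n) = c ^ n.
Proof.
  destruct n; [reflexivity|].
  change (c ^ Pos.to_nat (Pos.of_succ_nat n) = c ^ S n). now rewrite SuccNat2Pos.id_succ.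
Qed.

Lemma CpowZ_opp (c : C) n : c <> 0 -> CpowZ c (- Z.of_nat n) = (/ c) ^ n.
Proof.
  intros Hc. destruct n; [reflexivity|].
  change (/ c ^ Pos.to_nat (Pos.of_succ_nat n) = (/ c) ^ S n).
  rewrite SuccNat2Pos.id_succ. symmetry. now apply Cpow_inv.
Qed.

Lemma abs_nat_opp n : Z.abs_nat (- Z.of_nat n) = n.
Proof. lia. Qed.

(** The factor [i^m] turns the difference in [Sval_rec] into a sum, since [i^2 = - 1]. [Sval]
    depends on [|m|] only, so negative [m] uses powers of [1 / i = - i], and at [m = 0] the two
    neighbours cancel. *)
Lemma Rval_rec (z : C) (m : Z) : z <> 0 ->
  Rval z (m - 1)%Z + Rval z (m + 1)%Z = 2 * IZR m / z * Rval z m.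
Proof.
  intros Hz. unfold Rval.
  assert (HPI := PI_C_neq_0).
  destruct (Z.lt_trichotomy m 0) as [M|[M|M]].
  - set (n := Z.to_nat (- m - 1)).
    replace (m - 1)%Z with (- Z.of_nat (S (S n)))%Z by lia.
    replace (m + 1)%Z with (- Z.of_nat n)%Z by lia.
    replace m with (- Z.of_nat (S n))%Z by lia.
    rewrite !CpowZ_opp by apply Ci_neq_0. rewrite !abs_nat_opp.
    rewrite opp_IZR, <- INR_IZR_INZ, RtoC_opp, Cinv_Ci.
    assert (R := Sval_rec z n Hz).
    replace (Sval z (S (S n))) with (Sval z n - 2 * Ci * INR (S n) / z * Sval z (S n)) by (rewrite <- R; ring).
    simpl Cpow. replace (- Ci * (- Ci * (- Ci) ^ n)) with (Ci * Ci * (- Ci) ^ n) by ring. rewrite Ci2.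
    field. auto.
  - subst m. change (0 - 1)%Z with (- Z.of_nat 1)%Z. change (0 + 1)%Z with (Z.of_nat 1).
    rewrite CpowZ_opp, CpowZ_nat by apply Ci_neq_0. rewrite abs_nat_opp, Zabs2Nat.id, Cinv_Ci.
    simpl Cpow. unfold Cdiv. ring.
  - set (n := Z.to_nat (m - 1)).
    replace (m - 1)%Z with (Z.of_nat n) by lia.
    replace (m + 1)%Z with (Z.of_nat (S (S n))) by lia.
    replace m with (Z.of_nat (S n)) by lia.
    rewrite !CpowZ_nat, !Zabs2Nat.id, <- INR_IZR_INZ.
    assert (R := Sval_rec z n Hz).
    replace (Sval z (S (S n))) with (Sval z n - 2 * Ci * INR (S n) / z * Sval z (S n)) by (rewrite <- R; ring).
    simpl Cpow. replace (Ci * (Ci * Ci ^ n)) with (Ci * Ci * Ci ^ n) by ring. rewrite Ci2.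
    field. auto.
Qed.

Lemma q_eq (z : C) : z <> 0 -> - Cexp (2 * CLn (z / 2)) = - (Ci * z) * - (Ci * z) / 4.
Proof.
  intros Hz. replace (2 * CLn (z / 2)) with (CLn (z / 2) + CLn (z / 2)) by ring.
  rewrite Cexp_add, !Cexp_CLn.
  - replace (- (Ci * z) * - (Ci * z)) with (Ci * Ci * (z * z)) by ring. rewrite Ci2. field.
  - intros E. apply Hz. replace z with (2 * (z / 2)) by field. rewrite E. ring.
Qed.

Lemma Rval_0 (z : C) : z <> 0 -> Rval z 0 = 2 * Jder 0 z / PI.
Proof.
  intros Hz. assert (HPI := PI_C_neq_0).
  unfold Rval, Jder, Jval. rewrite q_eq by auto. rewrite <- CPS_besI, <- CPS_hbesI.
  change (INR 0) with 0%R. rewrite Cmult_0_l, Cexp_0. simpl Z.abs_nat.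
  unfold Sval, ssum. simpl. unfold I0val, kap. field. auto.
Qed.

Lemma Rval_1 (z : C) : z <> 0 -> Rval z 1 = (2 * Jder 1 z - 2 / z * Jval 0 z) / PI.
Proof.
  intros Hz. assert (HPI := PI_C_neq_0).
  assert (Hz2 : z / 2 <> 0).
  { intros E. apply Hz. replace z with (2 * (z / 2)) by field. rewrite E. ring. }
  unfold Rval, Jder, Jval. rewrite q_eq by auto. set (x := - (Ci * z)).
  change (INR 0) with 0%R. change (INR 1) with 1%R. rewrite Cmult_0_l, Cexp_0, Cmult_1_l, Cexp_CLn by auto.
  rewrite <- CPS_besI.
  assert (X2 : 2 * (x * x / 4) = - (z * (z / 2))).
  { unfold x. replace (- (Ci * z) * - (Ci * z)) with (Ci * Ci * (z * z)) by ring. rewrite Ci2. field. }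
  assert (E1 := CPS_theta_besI x). assert (E2 := CPS_theta_hbesI x). rewrite X2 in E1, E2.
  set (j := CPS (Jcoef 1) (x * x / 4)) in *. set (h := CPS (Hcoef 1) (x * x / 4)) in *.
  change (Z.abs_nat 1) with 1%nat. unfold Sval. simpl Ival. unfold I1val. fold x.
  rewrite ssum_1, E1, E2. replace (- x) with (Ci * z) by (unfold x; ring).
  set (e := Cexp (Ci * z)). set (i := CPS besI x).
  unfold Cdiv at 3. replace (/ x) with (Ci / z) by (unfold x; now rewrite Cinv_x).
  change (CpowZ Ci 1) with (Ci * 1).
  (* The exponential in [I1val] cancels against the single term of [ssum] at [m = 1]. *)
  transitivity (Ci * Ci * (- (2 / PI) * ((kap z * (- (z * (z / 2)) * j) + - (z * (z / 2)) * h - i + e) / z - e / z))).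
  - simpl Cpow. field. auto.
  - rewrite Ci2. unfold kap. field. auto.
Qed.

Theorem mainTheorem4 :
  forall (m : Z) (z : C),
    ~ (Im z = 0%R /\ (Re z <= 0)%R) ->
    ex_RInt_gen (V := C_R_CompleteNormedModule)
      (Y_integrand m z) (at_point 0%R) (at_left PI) /\
    BesselY m z =
      - (2 * CpowZ Ci m / PI)
      * (1 / PI * RInt_gen (V := C_R_CompleteNormedModule)
                    (Y_integrand m z) (at_point 0%R) (at_left PI)
         + sigmaY m z).
Proof.
  intros m z Hm.
  assert (Hz : z <> 0).
  { intros E. apply Hm. rewrite E. simpl. split; [reflexivity|lra]. }
  assert (I : is_RInt_gen (V := C_R_CompleteNormedModule) (Y_integrand m z) (at_point 0%R) (at_left PI)
    (Ival (kap z) (- (Ci * z)) (Z.abs_nat m))).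
  { apply is_RInt_gen_impC.
    apply impC_ext with (fker (kap z) (- (Ci * z)) (Z.abs_nat m)).
    - intros t Ht. symmetry. now apply Y_integrand_fker.
    - now apply impC_fker, x_neq_0. }
  split; [eexists; apply I|].
  rewrite (is_RInt_gen_unique (V := C_R_CompleteNormedModule) _ _ I).
  apply BesselY_LimAt.
  replace (- (2 * CpowZ Ci m / PI) * (1 / PI * Ival (kap z) (- (Ci * z)) (Z.abs_nat m) + sigmaY m z))
    with (Rval z m).
  - apply LimAt_Yquot_all with (Rm := Rval z); auto.
    + intros k. now apply Rval_rec.
    + rewrite Rval_0 by auto. apply LimAt_Yquot_0.
    + rewrite Rval_1 by auto. now apply LimAt_Yquot_1.
  - unfold Rval, Sval. rewrite sigmaY_ssum by auto.
    replace (/ (2 * Ci * z)) with (- Ci / (2 * z)).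
    2: { rewrite <- Cinv_Ci. field. auto using Ci_neq_0. }
    (* [- 1] is its own inverse, so the sign of the exponent does not matter. *)
    replace (CpowZ (- (1)) m) with ((- (1)) ^ Z.abs_nat m); [reflexivity|].
    destruct (Z.abs_eq_or_opp m) as [E|E]; rewrite <- (Zabs2Nat.id_abs m) in E.
    + rewrite <- E at 2. now rewrite CpowZ_nat.
    + replace m with (- Z.of_nat (Z.abs_nat m))%Z at 2 by lia. rewrite CpowZ_opp.
      * f_equal. field.
      * intros F. apply (f_equal Re) in F. simpl in F. lra.
Qed.
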